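(* Let $M$ be a simple connected matroid of rank $r\ge 3$, and suppose $M$ has an adjoint sequence $ad^0M, adM, ad^2M,\ldots$ such that $ad^iM\cong ad^jM$ for some integers $0\le i<j$. Then: (i) if $r=3$, the adjoint sequence can be continued indefinitely (a $k$-th term $ad^kM$ exists for every $k\ge i$), and for any such continuation: (a) if $j-i$ is odd, then all $ad^kM$ with $k\ge i$ are isomorphic to one and the same finite projective plane; (b) if $j-i$ is even, then all $ad^{i+2k}M$ ($k\ge0$) are isomorphic to one and the same finite projective plane, and all $ad^{i+2k+1}M$ ($k\ge 0$) are isomorphic to one and the same finite projective plane; (ii) if $r\ge 4$, the adjoint sequence can be continued indefinitely, and for any such continuation all $ad^kM$ with $k\ge i$ are isomorphic to one and the same finite projective geometry $PG(r-1,q)$.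
   Context: All matroids are finite and nonempty. $\mathcal{L}(M)$ denotes the lattice of flats of $M$. A matroid $N$ is an adjoint of $M$ if $r(N)=r(M)$ and there is an injective order-reversing map $\phi:\mathcal{L}(M)\to\mathcal{L}(N)$ sending the coatoms of $\mathcal{L}(M)$ (the hyperplanes of $M$) bijectively onto the atoms of $\mathcal{L}(N)$. An adjoint sequence of $M$ is a sequence $ad^0M=M, ad^1M=adM, ad^2M,\ldots$ in which $ad^kM$ is an adjoint of $ad^{k-1}M$ for each $k\ge1$. A projective geometry is a triple $(P,L,\iota)$ of a set of points $P$, a set of lines $L$ and an incidence relation such that (p1) any two distinct points lie on exactly one line, (p2) every line contains at least three points, (p3) if $a,b,c,d$ are four distinct points, no three collinear, and the line through $a,b$ meets the line through $c,d$, then the line through $a,c$ meets the line through $b,d$; it is identified with the simple matroid on $P$ whose flats are the subspaces (subsets containing every point of the line through any two of their distinct points). A projective plane is a projective geometry of rank $3$. $PG(r-1,q)$ is the simple matroid whose elements are the $1$-dimensional subspaces of $GF(q)^r$, with independence given by linear independence.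
   Formalization: Every adjoint in the sequence and in its continuations is required to be a simple matroid; with loops or parallel elements allowed the claim fails (Fano plane, its dual with one point doubled, Fano plane). *)

(* Defs.v *)
From mathcomp Require Import all_boot all_order all_algebra.

Set Implicit Arguments.
Unset Strict Implicit.
Unset Printing Implicit Defensive.

Import GRing.Theory.

Record matroid := Matroid {
  ground :> finType;
  indep : {set {set ground}};
  indep0 : set0 \in indep;
  indepS : forall A B : {set ground}, A \subset B -> B \in indep -> A \in indep;
  indep_augment : forall A B : {set ground},
    A \in indep -> B \in indep -> #|A| < #|B| ->
    exists2 x, x \in B :\: A & x |: A \in indep
}.

Section MatroidNotions.
Variable M : matroid.

Definition rank_set (A : {set M}) : nat :=
  \max_(I in indep M | I \subset A) #|I|.

Definition rank : nat := rank_set setT.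

Definition circuit (C : {set M}) : bool :=
  minset [pred A : {set M} | A \notin indep M] C.

(* No loops (one-element circuits) and no parallel pairs (two-element ones). *)
Definition simple : Prop := forall C : {set M}, circuit C -> 2 < #|C|.

Definition connected : Prop :=
  forall x y : M, x != y -> exists C : {set M}, [/\ circuit C, x \in C & y \in C].

Definition flat (F : {set M}) : bool :=
  [forall x, (x \notin F) ==> (rank_set F < rank_set (x |: F))].

(* The lattice of flats, ordered by inclusion of the underlying sets. *)
Definition flats := {F : {set M} | flat F}.

Definition covers (F G : flats) : bool :=
  (val F \proper val G) &&
  [forall H : flats, ~~ ((val F \proper val H) && (val H \proper val G))].

Definition is_bottom (F : flats) : bool :=
  [forall G : flats, val F \subset val G].

Definition is_top (F : flats) : bool :=
  [forall G : flats, val G \subset val F].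

Definition atoms : {set flats} :=
  [set F | [exists Z : flats, is_bottom Z && covers Z F]].

Definition coatoms : {set flats} :=
  [set F | [exists Z : flats, is_top Z && covers F Z]].

End MatroidNotions.

Definition isomorphic (M N : matroid) : Prop :=
  exists2 f : M -> N, bijective f &
    forall A : {set M}, (f @: A \in indep N) = (A \in indep M).

(* [adjoint N M]: N is an adjoint of M.  Since phi is injective, the last
   clause says that it maps the coatoms bijectively onto the atoms. *)
Definition adjoint (N M : matroid) : Prop :=
  rank N = rank M /\
  exists phi : flats M -> flats N,
    [/\ injective phi,
        forall F G : flats M, val F \subset val G -> val (phi G) \subset val (phi F)
      & phi @: coatoms M = atoms N].

(* The condition on phi only sees the lattice of flats of N, hence does not
   prevent loops or parallel elements in N; terms of an adjoint sequence are
   taken to be simple, as they are to be compared up to matroid isomorphism. *)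
Definition adjoint_step (M N : matroid) : Prop := adjoint N M /\ simple N.

(* The terms of index at most n of A form an adjoint sequence of M; the terms of
   larger index are irrelevant. *)
Definition adjoint_sequence (M : matroid) (n : nat) (A : nat -> matroid) : Prop :=
  A 0 = M /\ forall k, k < n -> adjoint_step (A k) (A k.+1).

Definition infinite_continuation (n : nat) (A B : nat -> matroid) : Prop :=
  (forall k, k <= n -> B k = A k) /\ forall k, adjoint_step (B k) (B k.+1).

Definition collinear (P L : Type) (inc : P -> L -> Prop) (a b c : P) : Prop :=
  exists l, [/\ inc a l, inc b l & inc c l].

(* The line through a and b meets the line through c and d (a <> b, c <> d). *)
Definition lines_meet (P L : Type) (inc : P -> L -> Prop) (a b c d : P) : Prop :=
  exists p, collinear inc a b p /\ collinear inc c d p.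

Record projective_geometry (P L : Type) := ProjectiveGeometry {
  inc :> P -> L -> Prop;
  pg1 : forall a b : P, a <> b -> exists! l : L, inc a l /\ inc b l;
  pg2 : forall l : L, exists a b c : P,
    [/\ a <> b, a <> c & b <> c] /\ [/\ inc a l, inc b l & inc c l];
  pg3 : forall a b c d : P,
    [/\ a <> b, a <> c & a <> d] -> [/\ b <> c, b <> d & c <> d] ->
    [/\ ~ collinear inc a b c, ~ collinear inc a b d,
        ~ collinear inc a c d & ~ collinear inc b c d] ->
    lines_meet inc a b c d -> lines_meet inc a c b d
}.

Definition subspace (P : finType) (L : Type) (G : projective_geometry P L)
    (S : {set P}) : Prop :=
  forall (a b : P) (l : L), a \in S -> b \in S -> a <> b -> G a l -> G b l ->
  forall c : P, G c l -> c \in S.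

(* Geometries are identified with matroids on their point sets; finiteness is
   built in, the ground set of a matroid being a finType. *)
Definition is_projective_geometry (N : matroid) : Prop :=
  simple N /\
  exists (L : Type) (G : projective_geometry N L),
    forall S : {set N}, flat S <-> subspace G S.

Definition is_projective_plane (N : matroid) : Prop :=
  is_projective_geometry N /\ rank N = 3.

Section PG.
Variables (F : finFieldType) (r : nat).
Local Notation V := 'rV[F]_r.
Local Open Scope ring_scope.

(* One-dimensional subspaces, as sets of vectors: unlike {vspace V}, this is
   canonically a finType. *)
Definition is_pg_point (U : {set V}) : bool :=
  [exists v : V, (v != 0) && (U == [set u in <[v]>%VS])].

Definition pg_point := {U : {set V} | is_pg_point U}.

(* A spanning vector; independence does not depend on its choice. *)
Definition pg_vec (U : pg_point) : V := xchoose (existsP (valP U)).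

Definition pg_vecs (S : {set pg_point}) : seq V := [seq pg_vec U | U <- enum S].

Definition pg_indep : {set {set pg_point}} := [set S | free (pg_vecs S)].

Lemma pg_vecP (U : pg_point) :
  (pg_vec U != 0) && (val U == [set u in <[pg_vec U]>%VS]).
Proof. exact: (xchooseP (existsP (valP U))). Qed.

Lemma pg_vec_inj : injective pg_vec.
Proof.
move=> U W eqUW; apply: val_inj.
have /andP[_ /eqP->] := pg_vecP U.
by have /andP[_ /eqP->] := pg_vecP W; rewrite eqUW.
Qed.

Lemma pg_vecs_uniq S : uniq (pg_vecs S).
Proof. by rewrite map_inj_uniq ?enum_uniq //; exact: pg_vec_inj. Qed.

Lemma mem_pg_vecs S U : (pg_vec U \in pg_vecs S) = (U \in S).
Proof. by rewrite mem_map ?mem_enum //; exact: pg_vec_inj. Qed.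

Lemma pg_vecsU1 (U : pg_point) (S : {set pg_point}) :
  U \notin S -> perm_eq (pg_vecs (U |: S)) (pg_vec U :: pg_vecs S).
Proof.
move=> US; apply: uniq_perm; rewrite ?pg_vecs_uniq //=.
  by rewrite mem_pg_vecs US pg_vecs_uniq.
move=> v; rewrite inE; apply/mapP/orP => [[W]|].
  rewrite mem_enum !inE => /orP[/eqP-> ->|WS ->]; first by left.
  by right; rewrite mem_pg_vecs.
case=> [/eqP->|/mapP[W]].
  by exists U; rewrite // mem_enum setU11.
by rewrite mem_enum => WS ->; exists W; rewrite // mem_enum setU1r.
Qed.

Lemma pg_indep0 : set0 \in pg_indep.
Proof. by rewrite inE /pg_vecs enum_set0 nil_free. Qed.

Lemma pg_indepS (S T : {set pg_point}) :
  S \subset T -> T \in pg_indep -> S \in pg_indep.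
Proof.
move=> sST; rewrite !inE => freeT.
rewrite (@perm_free _ _ _ [seq v <- pg_vecs T | v \in pg_vecs S]) ?filter_free //.
apply: uniq_perm; rewrite ?filter_uniq ?pg_vecs_uniq // => v.
rewrite mem_filter; case: (boolP (v \in pg_vecs S)) => //= /mapP[U].
by rewrite mem_enum => US ->; rewrite mem_pg_vecs (subsetP sST).
Qed.

Lemma pg_indep_augment (S T : {set pg_point}) :
  S \in pg_indep -> T \in pg_indep -> (#|S| < #|T|)%N ->
  exists2 U, U \in T :\: S & U |: S \in pg_indep.
Proof.
rewrite !inE => freeS freeT ltST.
have [sTS|] := boolP (<<pg_vecs T>> <= <<pg_vecs S>>)%VS.
  have := dimvS sTS; move: freeS freeT; rewrite /free => /eqP-> /eqP->.
  by rewrite !size_map -!cardE leqNgt ltST.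
move/span_subvP => nsub.
have /existsP[U /andP[UT nU]] :
    [exists U in T, pg_vec U \notin <<pg_vecs S>>%VS].
  apply: contraT; rewrite negb_exists => /forallP all_in; case: nsub => v.
  case/mapP=> U; rewrite mem_enum => UT ->.
  by have := all_in U; rewrite UT /= negbK.
have nUS : U \notin S.
  by apply: contra nU => US; apply: memv_span; rewrite mem_pg_vecs.
exists U; first by rewrite inE nUS.
by rewrite inE (perm_free (pg_vecsU1 nUS)) free_cons nU.
Qed.

(* The projective geometry usually written PG(r-1, q), with q = #|F|. *)
Definition PG : matroid := Matroid pg_indep0 pg_indepS pg_indep_augment.

End PG.

(* Main.v *)
Require Import Defs.
From HB Require Import structures.
From mathcomp Require Import all_boot all_order all_fingroup all_algebra all_field.
From mathcomp Require Import zify.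

(* If M is simple of rank r >= 3, the points of an adjoint of M are the
   hyperplanes of M, and there are at least as many of these as points
   (Motzkin, Greene); equality holds only if every line meets every hyperplane,
   that is, if M is modular. Cardinalities are hence nondecreasing along an
   adjoint sequence, and ad^i M = ad^j M forces ad^i M to be modular. Adjoints
   preserve connectedness, and a connected modular matroid is a projective
   geometry; its only adjoint is the dual geometry, so that taking adjoints
   twice gives the matroid back. This settles rank 3. From rank 4 on, the
   geometry is coordinatized: Desargues' theorem yields the dilatations with a
   given axis H, the translations among them form an abelian group, regular on
   the complement of H, and its direction-preserving endomorphisms form a finite
   division ring, which is a field by Wedderburn's theorem. Finally, the dual of
   PG(r-1, q) is PG(r-1, q), a hyperplane being given by its normal vector. *)

Set Implicit Arguments.
Unset Strict Implicit.
Unset Printing Implicit Defensive.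

(** * Rank, closure and hyperplanes *)

(** The map of an adjoint is only injective and order-reversing. That it turns rank into corank, and
    that it reflects the incidence of flats with hyperplanes, has to be extracted from this;
    afterwards the lattices are dropped, and an adjoint is a labelling of the hyperplanes of M by
    the points of N. The comparison of points with hyperplanes is proved for all flats F at once,
    with covers of F in the role of points: the induction passes from F to its covers, and
    contractions need not be formed. Connectedness is given by circuits, which a labelling does not
    transport. It is restated as the absence of separators, which a labelling does transport. From
    rank 4 on, a point outside a plane is used twice: it lifts plane Desargues configurations into
    space, and it shows that a dilatation, whose definition on the line of the given pair of points
    uses an auxiliary pair, respects all directions. Coordinates are handed from one term of the
    sequence to the next over the same field, so that all terms are compared with one geometry and
    fields never have to be compared. *)

Section Rank.
Variable M : matroid.
Implicit Types (A B C F G H I J X Y : {set M}) (x y z : M).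

Local Notation r := (@rank_set M).

Lemma card_indep_le I A : I \in indep M -> I \subset A -> #|I| <= r A.
Proof. by move=> II sIA; apply: (bigmax_sup I); rewrite ?II. Qed.

Lemma rank_basis A : exists I, [/\ I \in indep M, I \subset A & #|I| = r A].
Proof.
have : 0 < #|[pred I : {set M} | (I \in indep M) && (I \subset A)]|.
  by apply/card_gt0P; exists set0; rewrite !inE (indep0 M) sub0set.
by case/(eq_bigmax_cond (fun I : {set M} => #|I|)) => I; rewrite inE => /andP[? ?] E; exists I.
Qed.

Lemma rank_set_card A : r A <= #|A|.
Proof. by have [I [_ sIA <-]] := rank_basis A; exact: subset_leq_card. Qed.

Lemma indepE I : (I \in indep M) = (r I == #|I|).
Proof.
apply/idP/eqP => [II|E].
  by apply/eqP; rewrite eqn_leq rank_set_card card_indep_le.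
have [J [JJ sJI cJ]] := rank_basis I.
suff -> : I = J by [].
by apply/eqP; rewrite eq_sym eqEcard sJI cJ E leqnn.
Qed.

Lemma rank_setS A B : A \subset B -> r A <= r B.
Proof.
move=> sAB; have [I [II sIA <-]] := rank_basis A.
exact: card_indep_le (subset_trans sIA sAB).
Qed.

Lemma rank_set_le A : r A <= rank M.
Proof. exact: rank_setS (subsetT A). Qed.

Lemma rank_set0 : r set0 = 0.
Proof. by apply/eqP; rewrite -leqn0 -(cards0 M) rank_set_card. Qed.

Lemma extend_basis I A : I \in indep M -> I \subset A ->
  exists J, [/\ J \in indep M, I \subset J, J \subset A & #|J| = r A].
Proof.
have [n] := ubnP (r A - #|I|); elim: n I => // n IHn I le_n II sIA.
have := card_indep_le II sIA; rewrite leq_eqVlt => /orP[/eqP E|lt]; first by exists I.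
have [B [BI sBA cB]] := rank_basis A.
have [x] := indep_augment II BI (eq_ind_r (fun k => #|I| < k) lt cB).
rewrite inE => /andP[xI xB] xII.
have sxA : x |: I \subset A by rewrite subUset sub1set (subsetP sBA) //=.
have := cardsU1 x I; rewrite xI /= => cxI.
have [|J [JI sJ sJA cJ]] := IHn _ _ xII sxA.
  have lxA := card_indep_le xII sxA; lia.
by exists J; split => //; apply: subset_trans sJ; exact: subsetUr.
Qed.

Lemma rank_submod A B : r (A :|: B) + r (A :&: B) <= r A + r B.
Proof.
have [I [II sI cI]] := rank_basis (A :&: B).
have [|J [JI sIJ sJ cJ]] := @extend_basis I (A :|: B) II.
  by apply: subset_trans sI _; apply: subset_trans (subsetIl _ _) (subsetUl _ _).
rewrite -cJ -cI.
have rA : #|J :&: A| <= r A.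
  by apply: card_indep_le (subsetIr _ _); apply: indepS JI; exact: subsetIl.
have rB : #|J :&: B| <= r B.
  by apply: card_indep_le (subsetIr _ _); apply: indepS JI; exact: subsetIl.
have EJ : J = (J :&: A) :|: (J :&: B) by rewrite -setIUr; apply/esym/setIidPl.
have := cardsUI (J :&: A) (J :&: B); rewrite -EJ => c.
have : #|I| <= #|J :&: A :&: (J :&: B)|.
  apply: subset_leq_card; move: sI; rewrite !subsetI => /andP[-> ->].
  by rewrite sIJ.
lia.
Qed.

Lemma rank_setU A B : r (A :|: B) <= r A + r B.
Proof. by have := rank_submod A B; lia. Qed.

Lemma rank_setU1 x A : r (x |: A) <= (r A).+1.
Proof.
have := rank_setU [set x] A; have := rank_set_card [set x].
rewrite cards1; lia.
Qed.

Definition cl A := [set x | r (x |: A) == r A].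

Lemma in_cl x A : (x \in cl A) = (r (x |: A) == r A).
Proof. by rewrite inE. Qed.

Lemma notin_cl x A : (x \notin cl A) = (r (x |: A) == (r A).+1).
Proof.
rewrite in_cl; have := rank_setU1 x A.
by have := rank_setS (subsetUr [set x] A); case: eqP; case: eqP => //; lia.
Qed.

Lemma sub_cl A : A \subset cl A.
Proof. by apply/subsetP => x xA; rewrite in_cl (setUidPr _) // sub1set. Qed.

Lemma mem_cl x A : x \in A -> x \in cl A.
Proof. exact/subsetP/sub_cl. Qed.

Lemma clS A B : A \subset B -> cl A \subset cl B.
Proof.
move=> sAB; apply/subsetP => x; rewrite !in_cl => /eqP E.
have := rank_submod (x |: A) B; rewrite -setUA (setUidPr sAB).
have := rank_setS (_ : A \subset (x |: A) :&: B).
rewrite subsetI sAB subsetUr => /(_ isT).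
have := rank_setS (subsetUr [set x] B).
by move=> *; apply/eqP; lia.
Qed.

Lemma rank_cl A : r (cl A) = r A.
Proof.
apply/eqP; rewrite eqn_leq [X in _ && X]rank_setS ?sub_cl // andbT.
have [I [II sIA cI]] := rank_basis A.
have [J [JI sIJ sJA cJ]] := extend_basis II (subset_trans sIA (sub_cl A)).
rewrite -cJ -cI; apply: subset_leq_card.
apply/subsetP => x xJ; apply/contraT => xI.
have xIi : x |: I \in indep M.
  by apply: indepS JI; rewrite subUset sub1set xJ.
have := subsetP sJA _ xJ; rewrite in_cl => /eqP E.
have := card_indep_le xIi (setUS [set x] sIA); rewrite cardsU1 xI E; lia.
Qed.

Lemma flatP F : reflect (cl F = F) (flat F).
Proof.
apply: (iffP forallP) => [fF|E x].
  apply/eqP; rewrite eqEsubset sub_cl andbT; apply/subsetP => x.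
  rewrite in_cl => /eqP E; have := fF x; rewrite E ltnn implybF negbK //.
by rewrite -{1}E notin_cl; apply/implyP => /eqP ->.
Qed.

Lemma cl_rank_sub A B : A \subset B -> r B <= r A -> cl A = cl B.
Proof.
move=> sAB le; apply/eqP; rewrite eqEsubset clS //=; apply/subsetP => x.
rewrite !in_cl => /eqP E.
have := rank_setS (setUS [set x] sAB); have := rank_setS (subsetUr [set x] A).
by move=> *; apply/eqP; have := rank_setS sAB; lia.
Qed.

Lemma flat_cl A : flat (cl A).
Proof. by apply/flatP/esym/cl_rank_sub; rewrite ?sub_cl ?rank_cl. Qed.

Lemma cl_id A : cl (cl A) = cl A.
Proof. exact/flatP/flat_cl. Qed.

Lemma cl_min A F : flat F -> A \subset F -> cl A \subset F.
Proof. by move/flatP => {2}<-; exact: clS. Qed.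

Lemma cl_sub A B : (cl A \subset cl B) = (A \subset cl B).
Proof.
apply/idP/idP => [|s]; first by apply: subset_trans; exact: sub_cl.
exact: cl_min (flat_cl _) s.
Qed.

Lemma flatT : flat [set: M].
Proof. by apply/forallP => x; rewrite inE. Qed.

Lemma flatI F G : flat F -> flat G -> flat (F :&: G).
Proof.
move=> fF fG; apply/flatP/eqP; rewrite eqEsubset sub_cl andbT subsetI.
by rewrite !cl_min ?subsetIl ?subsetIr.
Qed.

Lemma flat_bigI (I : finType) (P : pred I) (F : I -> {set M}) :
  (forall i, P i -> flat (F i)) -> flat (\bigcap_(i | P i) F i).
Proof. by move=> fF; elim/big_ind: _ => //; [exact: flatT | exact: flatI]. Qed.

Lemma flat_eq F B : flat F -> F \subset B -> r B <= r F -> F = B.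
Proof.
move=> /flatP fF sFB le; apply/eqP; rewrite eqEsubset sFB /=.
by rewrite -fF (cl_rank_sub sFB le) sub_cl.
Qed.

Lemma flat_rankS F B : flat F -> F \proper B -> r F < r B.
Proof.
move=> fF /properP[sFB [x xB xF]]; rewrite ltnNge; apply: contra xF => le.
by rewrite (flat_eq fF sFB le).
Qed.

Lemma flat_notin x F : flat F -> x \notin F -> r (x |: F) = (r F).+1.
Proof. by move=> /flatP fF xF; apply/eqP; rewrite -notin_cl fF. Qed.

Lemma flat_rank1 x F : flat F -> x \notin F -> r (cl (x |: F)) = (r F).+1.
Proof. by move=> fF xF; rewrite rank_cl flat_notin. Qed.

(** Independence in terms of closure alone: a bijection that respects closures is then an
    isomorphism of matroids. *)
Lemma indep_cl I : (I \in indep M) = [forall x in I, x \notin cl (I :\ x)].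
Proof.
apply/idP/forall_inP => [II x xI|nI].
  rewrite notin_cl setD1K //; move: (II); rewrite indepE => /eqP ->.
  have : I :\ x \in indep M by apply: indepS II; exact: subD1set.
  by rewrite indepE => /eqP ->; rewrite (cardsD1 x I) xI.
have [J [JI sJI cJ]] := rank_basis I.
suff -> : I = J by [].
apply/eqP; rewrite eqEsubset sJI andbT; apply/subsetP => x xI.
apply/contraT => xJ; have := nI x xI; rewrite notin_cl setD1K // -cJ => /eqP E.
have : #|J| <= r (I :\ x).
  by apply: card_indep_le; rewrite // subsetD1 sJI.
lia.
Qed.

Lemma indepU1 x I : I \in indep M -> x \notin cl I -> x |: I \in indep M.
Proof.
move=> II xI; have nI : x \notin I by apply: contra xI; exact: mem_cl.
by move: II xI; rewrite !indepE notin_cl cardsU1 nI => /eqP -> /eqP ->.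
Qed.

Lemma exists_subflat F : flat F -> 0 < r F ->
  exists G, [/\ flat G, G \subset F & (r G).+1 = r F].
Proof.
move=> fF r0; have [I [II sIF cI]] := rank_basis F.
have /card_gt0P[x xI] : 0 < #|I| by rewrite cI.
exists (cl (I :\ x)); split; first exact: flat_cl.
  by apply: cl_min => //; apply: subset_trans sIF; exact: subD1set.
rewrite rank_cl -cI (cardsD1 x I) xI add1n; congr _.+1.
have : I :\ x \in indep M by apply: indepS II; exact: subD1set.
by rewrite indepE => /eqP.
Qed.

Definition hyperplane H := flat H && ((r H).+1 == rank M).

Lemma hyperplaneP H : reflect (flat H /\ (r H).+1 = rank M) (hyperplane H).
Proof. by apply: (iffP andP) => -[? /eqP]. Qed.

(* Extend a basis of A by x and then to a basis of M; drop x. *)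
Lemma separating_hyperplane x A : x \notin cl A ->
  exists H, [/\ hyperplane H, A \subset H & x \notin H].
Proof.
move=> xA; have [I [II sIA cI]] := rank_basis A.
have clI : cl I = cl A.
  by apply: cl_rank_sub => //; rewrite -cI; apply: card_indep_le.
have xI : x |: I \in indep M by apply: indepU1; rewrite ?clI.
have [J [JI sJ _ cJ]] := extend_basis xI (subsetT _).
have xJ : x \in J by apply: (subsetP sJ); rewrite setU11.
have xJc : x \notin cl (J :\ x) by move: JI; rewrite indep_cl => /forall_inP; apply.
exists (cl (J :\ x)); split => //.
  apply/hyperplaneP; split; first exact: flat_cl.
  rewrite rank_cl; move: xJc; rewrite notin_cl setD1K // => /eqP <-.
  by move: JI; rewrite indepE => /eqP ->.
suff : cl A \subset cl (J :\ x) by apply: subset_trans; exact: sub_cl.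
rewrite -clI clS // subsetD1; apply/andP; split.
  exact: subset_trans (subsetUr _ _) sJ.
by apply: contra xA => xI'; rewrite -clI mem_cl.
Qed.

Lemma hyperplane_flat H : hyperplane H -> flat H.
Proof. by case/andP. Qed.

Lemma hyperplane_rank H : hyperplane H -> (r H).+1 = rank M.
Proof. by case/hyperplaneP. Qed.

Lemma flat_capE F x : flat F ->
  (forall H, hyperplane H -> F \subset H -> x \in H) -> x \in F.
Proof.
move=> /flatP fF xH; rewrite -fF; apply/contraT => /separating_hyperplane[H [hH sH]].
by rewrite xH.
Qed.

Lemma hyperplane_sub_eq H B : hyperplane H -> H \subset B -> r B < rank M -> H = B.
Proof.
by case/hyperplaneP => fH <- sHB lt; apply: (flat_eq fH sHB); rewrite -ltnS.
Qed.

Lemma hyperplane_inj H G : hyperplane H -> hyperplane G -> H \subset G -> H = G.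
Proof. by move=> hH /hyperplaneP[fG rG] s; apply: hyperplane_sub_eq => //; rewrite -rG. Qed.

Lemma exists_hyperplane A : r A < rank M -> exists2 H, hyperplane H & A \subset H.
Proof.
move=> lt; have : ~~ ([set: M] \subset cl A).
  by apply/negP => /rank_setS; rewrite rank_cl -/(rank M) leqNgt lt.
by case/subsetPn => x _ /separating_hyperplane[H [? ? _]]; exists H.
Qed.

Lemma simpleP : simple M <-> forall x y, [set x; y] \in indep M.
Proof.
split=> [sM x y|sM C].
  apply/contraT => ni; have [C mC sC] := @minset_exists _ [pred A | A \notin indep M] _ ni.
  have /sM := mC; rewrite ltnNge; case/negP.
  apply: leq_trans (subset_leq_card sC) _; rewrite cardsU1 cards1; case: (_ \notin _) => //.
case/minsetP => /= nC _; rewrite ltnNge; apply: contra nC => le2.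
case: (set_0Vmem C) => [->|[x xC]]; first exact: indep0.
case: (set_0Vmem (C :\ x)) => [E|[y]].
  by have := sM x x; rewrite setUid; rewrite -(setD1K xC) E setU0.
rewrite in_setD1 => /andP[yx yC].
suff -> : C = [set x; y] by [].
apply/esym/eqP; rewrite eqEcard; apply/andP; split.
  by apply/subsetP => z /set2P[] ->.
by rewrite cards2 eq_sym yx.
Qed.

Hypothesis sM : simple M.

Lemma rank_set2 x y : x != y -> r [set x; y] = 2.
Proof.
move=> xy; have := (simpleP.1 sM) x y; rewrite indepE => /eqP ->.
by rewrite cards2 xy.
Qed.

Lemma rank_set1 x : r [set x] = 1.
Proof.
have := (simpleP.1 sM) x x; rewrite setUid indepE => /eqP ->; exact: cards1.
Qed.

Lemma cl_set0 : cl set0 = set0.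
Proof.
apply/eqP; rewrite -subset0; apply/subsetP => x.
by rewrite in_cl setU0 rank_set1 rank_set0.
Qed.

Lemma cl_set1 x : cl [set x] = [set x].
Proof.
apply/setP => y; apply/idP/set1P => [|->]; last by rewrite mem_cl ?set11.
by rewrite in_cl rank_set1; case: (eqVneq y x) => // yx; rewrite rank_set2.
Qed.

Lemma flat0 : flat (set0 : {set M}).
Proof. exact/flatP/cl_set0. Qed.

Lemma flat1 x : flat [set x].
Proof. exact/flatP/cl_set1. Qed.

Lemma rank_set_gt0 A : (0 < r A) = (A != set0).
Proof.
case: (set_0Vmem A) => [->|[x xA]]; first by rewrite rank_set0 eqxx.
have -> : A != set0 by apply/set0Pn; exists x.
by have := rank_setS (_ : [set x] \subset A); rewrite sub1set rank_set1 => /(_ xA).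
Qed.

Lemma flat_rank1P F : flat F -> r F = 1 -> exists x, F = [set x].
Proof.
move=> fF rF; have /set0Pn[x xF] : F != set0 by rewrite -rank_set_gt0 rF.
exists x; apply/esym/flat_eq; rewrite ?rF ?rank_set1 ?sub1set //; exact: flat1.
Qed.

End Rank.

(** * Adjoints as labellings of hyperplanes *)

Section FlatLattice.
Variable M : matroid.
Implicit Types F G Z : flats M.

Definition Flat (A : {set M}) (fA : flat A) : flats M := exist _ A fA.

Lemma coversE F G : covers F G = (val F \subset val G) && (rank_set (val G) == (rank_set (val F)).+1).
Proof.
apply/andP/andP => [[pFG /forallP nH]|[sFG /eqP rG]].
  have [sFG [x xG xF]] := properP pFG; split=> //.
  have := nH (Flat (flat_cl (x |: val F))); rewrite /= negb_and.
  have s : cl (x |: val F) \subset val G.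
    by apply: cl_min (valP G) _; rewrite subUset sub1set xG.
  have -> : val F \proper cl (x |: val F).
    apply/properP; split; last by exists x; rewrite // mem_cl ?setU11.
    exact: subset_trans (subsetUr _ _) (sub_cl _).
  rewrite properE s /= negbK => s'.
  have -> : val G = cl (x |: val F) by apply/eqP; rewrite eqEsubset s s'.
  by rewrite flat_rank1 ?(valP F).
split; first by rewrite properE sFG; apply/negP => /rank_setS; rewrite rG ltnn.
apply/forallP => H; apply/negP => /andP[/(flat_rankS (valP F)) lt1 /(flat_rankS (valP H))].
by rewrite rG ltnS leqNgt lt1.
Qed.

Lemma is_bottomE F : is_bottom F = (rank_set (val F) == 0).
Proof.
apply/forallP/eqP => [/(_ (Flat (flat_cl set0))) /= /rank_setS|rF G].
  by rewrite rank_cl rank_set0 leqn0 => /eqP.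
have /flatP <- := valP F; rewrite -(cl_rank_sub (sub0set (val F))) ?rF //.
exact: cl_min (valP G) (sub0set _).
Qed.

Lemma is_topE F : is_top F = (val F == setT).
Proof.
apply/forallP/eqP => [/(_ (Flat (flatT M))) /= s|-> G]; last exact: subsetT.
by apply/eqP; rewrite -subTset.
Qed.

Lemma atomsE F : (F \in atoms M) = (rank_set (val F) == 1).
Proof.
rewrite inE; apply/existsP/eqP => [[Z]|rF].
  by rewrite is_bottomE coversE => /andP[/eqP -> /andP[_ /eqP ->]].
exists (Flat (flat_cl set0)); rewrite is_bottomE coversE /= rank_cl rank_set0 rF eqxx.
by rewrite (cl_min (valP F)) ?sub0set.
Qed.

Lemma coatomsE F : (F \in coatoms M) = hyperplane (val F).
Proof.
rewrite /hyperplane (valP F) /= /rank inE; apply/existsP/eqP => [[Z]|rF].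
  by rewrite is_topE coversE => /andP[/eqP -> /andP[_ /eqP ->]].
by exists (Flat (flatT M)); rewrite is_topE coversE /= eqxx subsetT /= rF.
Qed.

End FlatLattice.

(* [h] lists the hyperplanes of M, and [F |-> {n | F <= h n}] reverses ranks:
   the adjoint relation, without the lattices. *)
Definition hyperplane_labelling (M N : matroid) (h : N -> {set M}) : Prop :=
  [/\ injective h,
      forall H, hyperplane H <-> exists n, h n = H,
      forall F, flat F -> flat [set n | F \subset h n] /\
        rank_set [set n | F \subset h n] + rank_set F = rank M
    & rank N = rank M].

Section AdjointLabelling.
Variables (M N : matroid) (phi : flats M -> flats N).
Hypotheses (rkE : rank N = rank M) (phi_inj : injective phi)
  (phi_rev : forall F G : flats M, val F \subset val G -> val (phi G) \subset val (phi F))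
  (phi_at : phi @: coatoms M = atoms N).

Let rphi_lt (F G : flats M) : val F \proper val G ->
  rank_set (val (phi G)) < rank_set (val (phi F)).
Proof.
move=> pFG; apply: flat_rankS; first exact: (valP (phi G)).
rewrite properEneq phi_rev ?proper_sub // andbT.
by apply: contraTneq pFG => /val_inj/phi_inj ->; rewrite properxx.
Qed.

(** A chain from F up to the ground set that gains one rank at a time is sent to a strictly
    descending chain, whose length bounds the rank of [phi F] from below. *)
Let rphi_ge (F : flats M) : rank M <= rank_set (val (phi F)) + rank_set (val F).
Proof.
have [n] := ubnP (rank M - rank_set (val F)); elim: n F => // n IHn F le_n.
case: (eqVproper (subsetT (val F))) => [E|/properP[_ [x _ xF]]]; first by rewrite E leq_addl.
have rx := flat_rank1 (valP F) xF.
have sF : val F \proper cl (x |: val F).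
  apply/properP; split; last by exists x; rewrite // mem_cl ?setU11.
  exact: subset_trans (subsetUr _ _) (sub_cl _).
pose G := Flat (flat_cl (x |: val F)); have rG : rank_set (val G) = (rank_set (val F)).+1 by [].
have ltF : rank_set (val F) < rank M by rewrite -rG rank_set_le.
apply: leq_trans (IHn G _) _.
  by rewrite rG; move: le_n ltF; move: (rank_set _) (rank M) => k m; clear; lia.
by rewrite rG addnS -addSn leq_add2r; apply: rphi_lt.
Qed.

(** The same chain argument downwards from F; at a flat of rank 0 the bound is [rank N = rank M]. *)
Let rphi_le (F : flats M) : rank_set (val (phi F)) + rank_set (val F) <= rank M.
Proof.
have [n] := ubnP (rank_set (val F)); elim: n F => // n IHn F le_n.
have [r0|r0] := posnP (rank_set (val F)); first by rewrite r0 addn0 -rkE rank_set_le.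
have [G [fG sG rG]] := exists_subflat (valP F) r0.
have pG : val (Flat fG) \proper val F.
  by rewrite properE sG; apply/negP => /rank_setS /=; rewrite -rG ltnn.
rewrite -rG addnS -addSn; apply: leq_trans (IHn (Flat fG) _).
  by rewrite leq_add2r; apply: rphi_lt.
by rewrite -ltnS rG.
Qed.

Let rphi (F : flats M) : rank_set (val (phi F)) + rank_set (val F) = rank M.
Proof. by apply/eqP; rewrite eqn_leq rphi_le rphi_ge. Qed.

(* Decreasing induction on the rank of F: if phi H <= phi F, take f in H - F,
   F' = F v f and G = F' /\ H; then phi F and phi G are both phi F' v phi H. *)
Let phi_hyperplane_step (F H : flats M) : hyperplane (val H) ->
  ~~ (val F \subset val H) ->
  rank_set (val F) <= (rank_set (val F :&: val H)).+1 ->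
  ~~ (val (phi H) \subset val (phi F)).
Proof.
have [n] := ubnP (rank M - rank_set (val F)); elim: n F => // n IHn F le_n hH nFH rFH.
apply/negP => sHF; have [x xF xH] := subsetPn nFH.
have [s|] := boolP (val H \subset val F).
  have pH : val H \proper val F by rewrite properE s nFH.
  by have := leq_trans (rphi_lt pH) (rank_setS sHF); rewrite ltnn.
case/subsetPn => f fH fF.
pose F' := Flat (flat_cl (f |: val F)).
have rF' : rank_set (val F') = (rank_set (val F)).+1 by exact: flat_rank1 (valP F) fF.
have sFF' : val F \subset val F' by apply: subset_trans (sub_cl _); exact: subsetUr.
pose G := Flat (flatI (valP F') (valP H)).
have rG : rank_set (val F) <= rank_set (val G).
  have nf : f \notin val F :&: val H by rewrite inE (negPf fF).
  apply: leq_trans rFH _; rewrite -(flat_rank1 (flatI (valP F) (valP H)) nf).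
  apply: rank_setS; apply: cl_min; first exact: (valP G).
  rewrite subUset sub1set inE fH mem_cl ?setU11 //= subsetI subsetIr andbT.
  exact: subset_trans (subsetIl _ _) sFF'.
have nF'H : ~~ (val F' \subset val H) by apply: contra nFH; apply: subset_trans.
have pGF' : val G \proper val F'.
  by rewrite properE subsetIl /= subsetI subxx nF'H.
have rGF : rank_set (val G) = rank_set (val F).
  apply/eqP; rewrite eqn_leq rG andbT -ltnS -rF'; exact: flat_rankS (valP G) pGF'.
have nphi : ~~ (val (phi H) \subset val (phi F')).
  apply: IHn => //; last by rewrite rF' ltnS.
  have := rank_set_le (val F'); rewrite rF'.
  by move: le_n; move: (rank_set _) (rank M) => k m; clear; lia.
have [m mH mF'] := subsetPn nphi.
have join_eq (K : flats M) : val (phi F') \subset val (phi K) -> val (phi H) \subset val (phi K) ->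
    rank_set (val K) = rank_set (val F) -> val (phi K) = cl (m |: val (phi F')).
  move=> s1 s2 rK; apply/esym/flat_eq; first exact: flat_cl.
    by apply: cl_min (valP (phi K)) _; rewrite subUset sub1set (subsetP s2).
  rewrite rank_cl flat_notin ?(valP (phi F')) //.
  have := rphi K; have := rphi F'; rewrite rK rF' addnS -addSn => <- /eqP.
  by rewrite eqn_add2r => /eqP ->.
have sGH : val G \subset val H by exact: subsetIr.
have eF := join_eq F (phi_rev sFF') sHF erefl.
have eG := join_eq G (phi_rev (proper_sub pGF')) (phi_rev sGH) rGF.
have /val_inj/phi_inj EFG : val (phi F) = val (phi G) by exact: etrans eF (esym eG).
by have := xF; rewrite EFG inE (negPf xH) andbF.
Qed.

(** [phi_hyperplane_step] asks that cutting F with H lower the rank by at most one, which can fail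
    for a general F. The closure of a single point of F outside H satisfies it, and lies below F. *)
Let phi_hyperplane (F H : flats M) : hyperplane (val H) ->
  (val (phi H) \subset val (phi F)) = (val F \subset val H).
Proof.
move=> hH; apply/idP/idP => [|/phi_rev //]; apply: contraTT => /subsetPn[e eF eH].
pose E := Flat (flat_cl [set e]).
have sEF : val E \subset val F by apply: cl_min (valP F) _; rewrite sub1set.
have nE : ~~ (val E \subset val H).
  by apply/subsetPn; exists e; rewrite ?mem_cl ?set11.
have rE : rank_set (val E) <= (rank_set (val E :&: val H)).+1.
  by apply: (@leq_trans 1) => //; rewrite rank_cl (leq_trans (rank_set_card _)) ?cards1.
apply: contra (phi_hyperplane_step hH nE rE) => s.
exact: subset_trans s (phi_rev sEF).
Qed.

Hypothesis sN : simple N.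

(** As N is simple, its atoms are the singletons of its points; [h n] is the hyperplane that [phi]
    sends to the atom of n. *)
Lemma hyperplane_labelling_phi : exists h : N -> {set M}, hyperplane_labelling h.
Proof.
pose P (n : N) := [pred K : flats M | (K \in coatoms M) && (val (phi K) == [set n])].
have exP n : exists K, P n K.
  have : Flat (flat1 sN n) \in atoms N by rewrite atomsE /= rank_set1.
  by rewrite -phi_at => /imsetP[K cK /(congr1 val) /= E]; exists K; rewrite /= cK -E eqxx.
pose k n := xchoose (exP n); pose h n := val (k n).
have hypk n : hyperplane (val (k n)).
  by have /andP[] := xchooseP (exP n); rewrite coatomsE.
have phik n : val (phi (k n)) = [set n] by have /andP[_ /eqP] := xchooseP (exP n).
exists h; split => //.
- move=> m n /val_inj E; have := phik m; rewrite E phik => /setP/(_ n).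
  by rewrite !inE eqxx => /esym/eqP.
- move=> H; split => [hH|[n <-]]; last exact: hypk.
  have fH := hyperplane_flat hH; have : phi (Flat fH) \in atoms N.
    by rewrite -phi_at imset_f // coatomsE.
  rewrite atomsE => /eqP /(flat_rank1P sN (valP _)) [n E].
  have /(congr1 val) /= Ek : k n = Flat fH by apply/phi_inj/val_inj; rewrite phik E.
  by exists n.
- move=> F fF; suff -> : [set n | F \subset h n] = val (phi (Flat fF)).
    by split; [exact: valP | exact: (rphi (Flat fF))].
  by apply/setP => n; rewrite inE -(@phi_hyperplane (Flat fF)) // phik sub1set.
Qed.

End AdjointLabelling.

Lemma adjoint_labelling (M N : matroid) : adjoint_step M N ->
  exists h : N -> {set M}, hyperplane_labelling h.
Proof.
by case=> -[rNM [phi [injphi revphi atphi]]] sN; apply: (hyperplane_labelling_phi rNM injphi).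
Qed.

(** * Points and hyperplanes *)

Section DeBruijnErdos.
Import GRing.Theory Num.Theory.
Variables (S T : finType) (A : {set S}) (B : {set T}) (I : S -> T -> bool).

Local Notation dA x := #|[set y in B | I x y]|.
Local Notation dB y := #|[set x in A | I x y]|.
Local Notation nA x := #|[set y in B | ~~ I x y]|.
Local Notation nB y := #|[set x in A | ~~ I x y]|.

Let dnA x : dA x + nA x = #|B|.
Proof.
rewrite -(cardsID [set y | I x y] B); congr addn.
  by apply: eq_card => y; rewrite !inE.
by apply: eq_card => y; rewrite !inE andbC.
Qed.

Let dnB y : dB y + nB y = #|A|.
Proof.
rewrite -(cardsID [set x | I x y] A); congr addn.
  by apply: eq_card => x; rewrite !inE.
by apply: eq_card => x; rewrite !inE andbC.
Qed.

(* Conway: the weights 1/(|A| (|B| - d x)) and 1/(|B| (|A| - d y)) of the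
   non-incident pairs (x, y) both have total 1, and the first dominate. *)
Lemma nonincident_degrees : A != set0 ->
  (forall x, x \in A -> exists2 y, y \in B & ~~ I x y) ->
  (forall y, y \in B -> exists2 x, x \in A & ~~ I x y) ->
  (forall y, y \in B -> 0 < dB y) ->
  (forall x y, x \in A -> y \in B -> ~~ I x y -> dB y <= dA x) ->
  #|B| <= #|A| ->
  #|A| = #|B| /\ forall x y, x \in A -> y \in B -> ~~ I x y -> dB y = dA x.
Proof.
move=> A0 exA exB dB0 dBA leBA.
pose w1 x : rat := ((#|A| * nA x)%:R^-1)%R; pose w2 y : rat := ((#|B| * nB y)%:R^-1)%R.
have cA : 0 < #|A| by rewrite card_gt0.
have nA0 x : x \in A -> 0 < nA x.
  by case/exA => y yB nI; rewrite card_gt0; apply/set0Pn; exists y; rewrite inE yB.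
have nB0 y : y \in B -> 0 < nB y.
  by case/exB => x xA nI; rewrite card_gt0; apply/set0Pn; exists x; rewrite inE xA.
have cB : 0 < #|B|.
  by have /set0Pn[x /exA[y yB _]] := A0; rewrite card_gt0; apply/set0Pn; exists y.
have S1 : (\sum_(x in A) \sum_(y in B | ~~ I x y) w1 x = 1)%R.
  transitivity (\sum_(x in A) (#|A|%:R^-1 : rat))%R; last first.
    by rewrite sumr_const -[LHS]mulr_natl mulfV // pnatr_eq0 -lt0n.
  apply: eq_bigr => x xA; rewrite sumr_const -[LHS]mulr_natl.
  have -> : #|[pred y in B | ~~ I x y]| = nA x by apply: eq_card => y; rewrite !inE.
  rewrite /w1 natrM invfM mulrCA mulfV ?mulr1 // pnatr_eq0 -lt0n; exact: nA0.
have S2 : (\sum_(x in A) \sum_(y in B | ~~ I x y) w2 y = 1)%R.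
  transitivity (\sum_(y in B) (#|B|%:R^-1 : rat))%R; last first.
    by rewrite sumr_const -[LHS]mulr_natl mulfV // pnatr_eq0 -lt0n.
  rewrite (exchange_big_dep (mem B)) /=; last by move=> x y _ /andP[].
  apply: eq_bigr => y yB; rewrite sumr_const -[LHS]mulr_natl.
  have -> : #|[pred x | (x \in A) && ((y \in B) && ~~ I x y)]| = nB y.
    by apply: eq_card => x; rewrite !inE yB.
  rewrite /w2 natrM invfM mulrCA mulfV ?mulr1 // pnatr_eq0 -lt0n; exact: nB0.
have w21 x y : x \in A -> y \in B -> ~~ I x y -> (w2 y <= w1 x)%R.
  move=> xA yB nI; rewrite /w1 /w2 lef_pV2 ?posrE ?ltr0n ?muln_gt0 ?cA ?cB ?nA0 ?nB0 //.
  rewrite ler_nat; have := dBA x y xA yB nI; have := dnA x; have := dnB y.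
  move: (dA x) (dB y) (nA x) (nB y) leBA => a b c d; move: #|A| #|B| => v w; clear; nia.
have wE x y : x \in A -> y \in B -> ~~ I x y -> w1 x = w2 y.
  have : (\sum_(x in A) (\sum_(y in B | ~~ I x y) (w1 x - w2 y)) = 0)%R.
    under eq_bigr do rewrite big_split /= sumrN.
    by rewrite big_split /= sumrN S1 S2 subrr.
  move=> E xA yB nI.
  have ge0 x' : x' \in A -> (0 <= \sum_(y in B | ~~ I x' y) (w1 x' - w2 y))%R.
    by move=> x'A; apply: sumr_ge0 => y' /andP[y'B nI']; rewrite subr_ge0 w21.
  have Ex := psumr_eq0P ge0 E xA.
  have /eqP : (w1 x - w2 y = 0)%R.
    apply: (psumr_eq0P _ Ex); last by rewrite yB.
    by move=> y' /andP[y'B nI']; rewrite subr_ge0 w21.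
  by rewrite subr_eq0 => /eqP.
have main x y : x \in A -> y \in B -> ~~ I x y -> #|A| = #|B| /\ dB y = dA x.
  move=> xA yB nI; have /invr_inj/eqP := wE x y xA yB nI.
  rewrite eqr_nat => /eqP.
  have := dBA x y xA yB nI; have := dnA x; have := dnB y; have := dB0 y yB.
  move: (dA x) (dB y) (nA x) (nB y) leBA => a b c d; move: #|A| #|B| => v w; clear.
  move=> le1 b0 E1 E2 le2 E3.
  (* Equal weights amount to this equation between products. Both factors on the right are at most
     those on the left, and [0 < dB y] then forces equality factor by factor. *)
  have E : v * a = w * b by nia.
  by split; nia.
split; last by move=> x y xA yB nI; have [] := main x y xA yB nI.
by have /set0Pn[x xA] := A0; have [y yB nI] := exA x xA; have [] := main x y xA yB nI.
Qed.

End DeBruijnErdos.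

(** * Covers of a flat and hyperplanes above it *)

Section Greene.
Variable M : matroid.
Implicit Types (F G H P Q X : {set M}) (x y z : M).
Local Notation r := (@rank_set M).

(** Together with [hyperplanes_above F], these are the points and the hyperplanes of the contraction
    of M by F, described inside M. *)
Definition flat_covers F := [set G | [&& flat G, F \subset G & r G == (r F).+1]].
Definition hyperplanes_above F := [set H | hyperplane H && (F \subset H)].

Lemma flat_coversP F G :
  reflect [/\ flat G, F \subset G & r G = (r F).+1] (G \in flat_covers F).
Proof. by rewrite inE; apply: (iffP and3P) => -[? ? /eqP]. Qed.

Lemma rank_coversU F P Q : P \in flat_covers F -> Q \in flat_covers F -> P != Q ->
  r (P :|: Q) = (r F).+2.
Proof.
move=> /flat_coversP[fP sFP rP] /flat_coversP[fQ sFQ rQ] PQ; apply/eqP; rewrite eqn_leq.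
have := rank_submod P Q; have := rank_setS (_ : F \subset P :&: Q).
rewrite subsetI sFP sFQ => /(_ isT) => le1 le2; apply/andP; split; first by lia.
rewrite -rP; apply: flat_rankS => //; rewrite properE subsetUl subUset subxx /=.
by apply: contra PQ => sQP; rewrite (flat_eq fQ sQP) ?rP ?rQ.
Qed.

(** If distinct covers Q and Q' in H had the same join with P, this join would by rank also be that
    of Q and Q'; it would lie in H and contain P. *)
Lemma cl_covers_inj F P H : P \in flat_covers F -> flat H -> ~~ (P \subset H) ->
  {in [set Q in flat_covers F | Q \subset H] &, injective (fun Q => cl (P :|: Q))}.
Proof.
move=> cP fH nPH Q Q' /setIdP[cQ sQ] /setIdP[cQ' sQ'] E.
have neP (K : {set M}) : K \subset H -> P != K by move=> sK; apply: contraNneq nPH => ->.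
apply/eqP/contraT => QQ'; case/negP: nPH.
have sQQ : cl (Q :|: Q') \subset H by apply: cl_min => //; rewrite subUset sQ.
apply: subset_trans sQQ; have -> : cl (Q :|: Q') = cl (P :|: Q).
  rewrite -[RHS]cl_id; apply: cl_rank_sub.
    rewrite subUset; apply/andP; split; last rewrite E.
      by apply: subset_trans (sub_cl _); exact: subsetUr.
    by apply: subset_trans (sub_cl _); exact: subsetUr.
  by rewrite rank_cl !(@rank_coversU F) ?neP.
by apply: subset_trans (sub_cl _); exact: subsetUl.
Qed.

Lemma cl_covers_sub F P H : P \in flat_covers F -> ~~ (P \subset H) ->
  [set cl (P :|: Q) | Q in [set Q in flat_covers F | Q \subset H]] \subset flat_covers P.
Proof.
move=> cP nPH; apply/subsetP => K /imsetP[Q /setIdP[cQ sQ] ->].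
apply/flat_coversP; split; first exact: flat_cl.
  by apply: subset_trans (sub_cl _); exact: subsetUl.
rewrite rank_cl (rank_coversU cP cQ); first by have /flat_coversP[_ _ ->] := cP.
by apply: contraNneq nPH => ->.
Qed.

Lemma flat_covers_above F x : flat F -> x \notin F -> cl (x |: F) \in flat_covers F.
Proof.
move=> fF xF; apply/flat_coversP; split; [exact: flat_cl | | exact: flat_rank1].
by apply: subset_trans (sub_cl _); exact: subsetUr.
Qed.

(** By induction on the corank of F. If P is not in H, joining with P maps the covers of F in H
    injectively to covers of P, which by induction are no more numerous than the hyperplanes above
    P: this is the degree condition of [nonincident_degrees]. In the case of equality the injection
    is onto, that is, every line through P meets H in the contraction. *)
Lemma flat_covers_le F : flat F -> (r F).+2 <= rank M ->
  #|flat_covers F| <= #|hyperplanes_above F| /\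
  (#|flat_covers F| = #|hyperplanes_above F| -> (r F).+3 <= rank M ->
   forall P H, P \in flat_covers F -> H \in hyperplanes_above F -> ~~ (P \subset H) ->
   flat_covers P \subset [set cl (P :|: Q) | Q in [set Q in flat_covers F | Q \subset H]]).
Proof.
have [n] := ubnP (rank M - r F); elim: n F => // n IHn F le_n fF le2.
have [le3|gt3] := leqP (r F).+3 (rank M); last first.
  (* In corank two the covers of F are themselves hyperplanes, and the equality case is vacuous. *)
  split=> // ; apply: subset_leq_card; apply/subsetP => G /flat_coversP[fG sFG rG].
  by rewrite inE sFG andbT; apply/hyperplaneP; split=> //; rewrite rG; lia.
have IH P : P \in flat_covers F -> #|flat_covers P| <= #|hyperplanes_above P|.
  by case/flat_coversP => fP sFP rP; case: (IHn P _ fP _) => //; rewrite rP //; lia.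
have card_im P H : P \in flat_covers F -> H \in hyperplanes_above F -> ~~ (P \subset H) ->
    #|[set cl (P :|: Q) | Q in [set Q in flat_covers F | Q \subset H]]| =
    #|[set Q in flat_covers F | Q \subset H]|.
  move=> cP; rewrite inE => /andP[hH _] nPH.
  by rewrite card_in_imset //; apply: cl_covers_inj (hyperplane_flat hH) nPH.
have aboveE P : P \in flat_covers F ->
    hyperplanes_above P = [set H in hyperplanes_above F | P \subset H].
  case/flat_coversP => _ sFP _; apply/setP => H; rewrite !inE -andbA.
  by case: (hyperplane H) => //=; case: (boolP (P \subset H)) => [/(subset_trans sFP) ->|]; rewrite ?andbF.
have degs P H : P \in flat_covers F -> H \in hyperplanes_above F -> ~~ (P \subset H) ->
    #|[set Q in flat_covers F | Q \subset H]| <= #|[set H in hyperplanes_above F | P \subset H]|.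
  move=> cP hH nPH; rewrite -(card_im P) // -aboveE //; apply: leq_trans (IH P cP).
  exact/subset_leq_card/cl_covers_sub.
have sub_of (A : {set M}) : A != setT -> exists x, x \notin A.
  by move=> AT; have /subsetPn[x _ xA] : ~~ ([set: M] \subset A); [rewrite subTset|exists x].
have rT (A : {set M}) : r A < rank M -> A != setT.
  by apply: contraTneq => ->; rewrite ltnn.
have D : #|hyperplanes_above F| <= #|flat_covers F| ->
    #|flat_covers F| = #|hyperplanes_above F| /\ (forall P H, P \in flat_covers F ->
      H \in hyperplanes_above F -> ~~ (P \subset H) ->
      #|[set P in flat_covers F | P \subset H]| = #|[set H in hyperplanes_above F | P \subset H]|).
  apply: nonincident_degrees.
  - have [x xF] := sub_of F (rT F (ltnW le2)).
    by apply/set0Pn; exists (cl (x |: F)); exact: flat_covers_above.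
  - move=> P /flat_coversP[fP sFP rP].
    have : ~~ (P \subset F) by apply/negP => /rank_setS; rewrite rP ltnn.
    case/subsetPn => x xP xF; have xcF : x \notin cl F by have /flatP -> := fF.
    have [H [hH sFH xH]] := separating_hyperplane xcF.
    by exists H; [rewrite inE hH | apply: contra xH => /subsetP; apply].
  - move=> H; rewrite inE => /andP[hH sFH].
    have [|x xH] := sub_of H; first by apply: rT; rewrite -(hyperplane_rank hH).
    exists (cl (x |: F)); first by apply: flat_covers_above => //; apply: contra xH; exact/subsetP.
    by apply: contra xH => /subsetP; apply; rewrite mem_cl ?setU11.
  - move=> H; rewrite inE => /andP[hH sFH].
    have : ~~ (H \subset F).
      by apply/negP => /rank_setS; have := hyperplane_rank hH; lia.
    case/subsetPn => x xH xF; rewrite card_gt0; apply/set0Pn; exists (cl (x |: F)).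
    rewrite inE flat_covers_above //=; apply: cl_min (hyperplane_flat hH) _.
    by rewrite subUset sub1set xH.
  - exact: degs.
split=> [|E _ P H cP hH nPH].
  by have [/ltnW //|/D[-> _]] := ltnP #|flat_covers F| #|hyperplanes_above F|.
have [_ Ed] := D (eq_leq (esym E)).
(* The joins are as many as the covers of F in H, hence, the degrees being equal, as the hyperplanes
   above P, and these are by induction at least as many as the covers of P. *)
suff /eqP -> : [set cl (P :|: Q) | Q in [set Q in flat_covers F | Q \subset H]] == flat_covers P by [].
by rewrite eqEcard cl_covers_sub // card_im // (Ed P H) // -aboveE // IH.
Qed.

Hypothesis sM : simple M.

Lemma flat_covers0 : flat_covers set0 = [set [set x] | x in M].
Proof.
apply/setP => F; apply/flat_coversP/imsetP => [[fF _]|[x _ ->]].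
  by rewrite rank_set0 => /(flat_rank1P sM fF) [x ->]; exists x.
by rewrite flat1 ?rank_set1 ?rank_set0 ?sub0set.
Qed.

Lemma card_flat_covers0 : #|flat_covers set0| = #|M|.
Proof. by rewrite flat_covers0 card_imset //; exact: set1_inj. Qed.

Lemma hyperplanes_above0 : hyperplanes_above set0 = [set H | hyperplane H].
Proof. by apply/setP => H; rewrite !inE sub0set andbT. Qed.

Lemma card_hyperplanes : 2 <= rank M -> #|M| <= #|[set H | hyperplane (H : {set M})]|.
Proof.
move=> r2; have [] := flat_covers_le (flat0 sM); first by rewrite rank_set0.
by rewrite card_flat_covers0 hyperplanes_above0.
Qed.

Definition line_meets_hyperplane :=
  forall x y H, x != y -> hyperplane H -> exists2 z, z \in H & z \in cl [set x; y].

(** The equality case at the empty flat with P = {x}: the line xy covers {x}, hence is the join of x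
    with a point z of H. *)
Lemma card_hyperplanes_eq : 3 <= rank M ->
  #|M| = #|[set H | hyperplane (H : {set M})]| -> line_meets_hyperplane.
Proof.
move=> r3 E x y H xy hH.
have [xH|xH] := boolP (x \in H); first by exists x; rewrite // mem_cl ?set21.
have [] := flat_covers_le (flat0 sM); rewrite rank_set0 ?(ltnW r3) //.
rewrite card_flat_covers0 hyperplanes_above0 => _ /(_ E r3 [set x] H).
rewrite flat_covers0 imset_f // inE hH sub1set => /(_ isT isT xH) /subsetP.
have yx : y \notin [set x] by rewrite inE eq_sym.
move=> /(_ (cl (y |: [set x])) (flat_covers_above (flat1 sM x) yx)) /imsetP[Q].
rewrite inE => /andP[/imsetP[z _ ->] ]; rewrite sub1set => zH Ez.
by exists z => //; rewrite setUC Ez mem_cl // setU1r ?set11.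
Qed.
End Greene.

(** * Modular matroids *)

Definition modular (M : matroid) : Prop := forall F G : {set M}, flat F -> flat G ->
  rank_set (F :|: G) + rank_set (F :&: G) = rank_set F + rank_set G.

Section Modular.
Variable M : matroid.
Implicit Types (F G H : {set M}) (x y z : M).
Local Notation r := (@rank_set M).
Hypothesis sM : simple M.

Lemma line_eq x y u v : u != v -> u \in cl [set x; y] -> v \in cl [set x; y] ->
  cl [set u; v] = cl [set x; y].
Proof.
move=> uv ul vl; rewrite -[RHS]cl_id; apply: cl_rank_sub.
  by apply/subsetP => z /set2P[] ->.
by rewrite rank_cl (rank_set2 sM uv) (leq_trans (rank_set_card _)) // cards2; case: (x == y).
Qed.

(** Otherwise F contains points x and y independent over the flat of F in H. The line xy meets H in
    a point z of that flat, and y lies on xz: a contradiction. *)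
Lemma meets_rank F H : line_meets_hyperplane M -> flat F -> hyperplane H ->
  r F <= (r (F :&: H)).+1.
Proof.
move=> mM fF hH; have fE := flatI fF (hyperplane_flat hH).
rewrite leqNgt; apply/negP => lt.
have : ~~ (F \subset F :&: H) by apply: contraL lt => /rank_setS; lia.
case/subsetPn => x xF xE; have rx := flat_rank1 fE xE.
have : ~~ (F \subset cl (x |: F :&: H)).
  by apply: contraL lt => /rank_setS; rewrite rx -ltnNge.
case/subsetPn => y yF yE.
have xy : x != y by apply: contraNneq yE => <-; rewrite mem_cl ?setU11.
have [z zH zl] := mM x y H xy hH.
have zE : z \in F :&: H.
  rewrite inE zH andbT; apply: subsetP zl; apply: cl_min => //.
  by apply/subsetP => w /set2P[] ->.
have xz : x != z by apply: contraNneq xE => ->.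
have := line_eq xz (mem_cl (set21 x y)) zl.
move/setP/(_ y); rewrite (mem_cl (set22 x y)) => yl.
case/negP: yE; apply: subsetP (yl); apply: clS.
by rewrite setUS // sub1set.
Qed.

(** By induction on the corank of G. Adding a point x to G gives G', and a hyperplane H through G
    that misses x cuts G' back to G. If x is in the join of F and G, then F has the same join with G
    and G', and by [meets_rank] the meets differ by at most one in rank. Otherwise H is chosen to
    contain F as well; then the meets agree, and the joins differ by at most one in rank. *)
Lemma meets_modular : line_meets_hyperplane M -> modular M.
Proof.
move=> mM F G fF fG; apply/eqP; rewrite eqn_leq rank_submod /=.
have [n] := ubnP (rank M - r G); elim: n G fG => // n IHn G fG le_n.
have [->|GT] := eqVneq G setT; first by rewrite setUT setIT addnC.
have exH : exists2 H, hyperplane H & (G \subset H) && [exists x, (x \notin H) &&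
    ((x \notin cl (F :|: G)) ==> (F \subset H))].
  have [/existsP[x xFG]|] := boolP [exists x, x \notin cl (F :|: G)].
    have [H [hH]] := separating_hyperplane xFG; rewrite subUset => /andP[sF sG] xH.
    by exists H => //; rewrite sG; apply/existsP; exists x; rewrite xH sF implybT.
  move=> /existsPn FG.
  have [x _ xG] : exists2 x, x \in [set: M] & x \notin cl G.
    by apply/subsetPn; have /flatP -> := fG; rewrite subTset.
  have [H [hH sG xH]] := separating_hyperplane xG.
  exists H => //; rewrite sG; apply/existsP; exists x; rewrite xH.
  by have := FG x; rewrite negbK => ->.
have [H hH /andP[sGH /existsP[x /andP[xH xFG]]]] := exH.
have xG : x \notin G by apply: contra xH; exact/subsetP.
pose G' := cl (x |: G); have fG' : flat G' := flat_cl _.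
have rG' : r G' = (r G).+1 := flat_rank1 fG xG.
have sGG' : G \subset G' by apply: subset_trans (sub_cl _); exact: subsetUr.
have EG : G = G' :&: H.
  apply: flat_eq => //; first by rewrite subsetI sGG'.
  rewrite -ltnS -rG'; apply: flat_rankS; first exact: flatI (hyperplane_flat hH).
  apply/properP; split; first exact: subsetIl.
  by exists x; rewrite ?in_setI ?(negPf xH) ?andbF //; apply: mem_cl; rewrite setU11.
have := IHn G' fG'; rewrite rG'.
have ltG : r G < rank M by rewrite -rG' rank_set_le.
have -> : rank M - (r G).+1 < n by move: le_n ltG; clear; lia.
move=> /(_ isT) IH.
have EI : F :&: G = F :&: G' :&: H by rewrite {1}EG setIA.
move: xFG; have [xFG _|xFG /= sFH] := boolP (x \in cl (F :|: G)).
  have -> : r (F :|: G) = r (F :|: G').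
    have s : F :|: G' \subset cl (F :|: G).
      rewrite subUset (subset_trans (subsetUl _ G) (sub_cl _)) cl_sub subUset sub1set xFG.
      by rewrite (subset_trans (subsetUr F _) (sub_cl _)).
    by apply/eqP; rewrite eqn_leq -[X in _ && (_ <= X)]rank_cl !rank_setS // setUS.
  have := meets_rank mM (flatI fF fG') hH; rewrite -EI; move: IH; clear; lia.
have -> : F :&: G = F :&: G' by rewrite EI (setIidPl _) // (subset_trans (subsetIl _ _)).
have : r (F :|: G') <= (r (F :|: G)).+1.
  have s : F :|: G' \subset cl (x |: (F :|: G)).
    rewrite subUset cl_sub -[X in X && _]andbT -andbA; apply/and3P; split=> //.
      by apply: subset_trans (sub_cl _); rewrite setUCA subsetUl.
    by apply: subset_trans (sub_cl _); rewrite setUCA subsetUr.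
  by apply: leq_trans (rank_setS s) _; rewrite rank_cl rank_setU1.
move: IH; clear; lia.
Qed.

Hypothesis mM : modular M.

Lemma modular_hyperplane F H : flat F -> hyperplane H -> ~~ (F \subset H) ->
  (r (F :&: H)).+1 = r F.
Proof.
move=> fF hH nFH; have := mM fF (hyperplane_flat hH).
have -> : r (F :|: H) = rank M.
  apply/eqP; rewrite eqn_leq rank_set_le leqNgt; apply: contra nFH => lt.
  by have -> := hyperplane_sub_eq hH (subsetUr F H) lt; exact: subsetUl.
rewrite -(hyperplane_rank hH); lia.
Qed.

Lemma modular_hyperplane_le F H : flat F -> hyperplane H ->
  r F <= (r (F :&: H)).+1.
Proof.
move=> fF hH; have [/setIidPl ->|/(modular_hyperplane fF hH) <- //] := boolP (F \subset H).
exact: leqnSn.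
Qed.

Lemma modular_meets : line_meets_hyperplane M.
Proof.
move=> x y H xy hH; have := modular_hyperplane_le (flat_cl [set x; y]) hH.
rewrite rank_cl rank_set2 // ltnS (rank_set_gt0 sM) => /set0Pn[z].
by rewrite inE => /andP[? ?]; exists z.
Qed.

(* A maximal flat inside a line-closed set is all of it. *)
Lemma line_closed_flat (S : {set M}) :
  (forall x y, x \in S -> y \in S -> x != y -> cl [set x; y] \subset S) -> flat S.
Proof.
move=> lS; have p0 : flat (set0 : {set M}) && (set0 \subset S) by rewrite flat0 ?sub0set.
have [F maxF _] := @maxset_exists _ [pred F | flat F && (F \subset S)] _ p0.
have /maxsetP[/= /andP[fF sFS] maxi] := maxF.
suff <- : F = S by [].
apply/eqP; rewrite eqEsubset sFS /=; apply/subsetP => x xS; apply/contraT => xF.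
suff sx : cl (x |: F) \subset S.
  have E : cl (x |: F) = F.
    by apply: maxi; [rewrite /= flat_cl | apply: subset_trans (sub_cl _); exact: subsetUr].
  by case/negP: xF; rewrite -E mem_cl ?setU11.
apply/subsetP => y yE; have [yF|yF] := boolP (y \in F); first exact: (subsetP sFS).
have [->//|yx] := eqVneq y x.
(* By modularity the line xy meets F in some z, so that y is on a line through the points x and z of
   S. *)
have := mM fF (flat_cl [set x; y]); rewrite rank_cl rank_set2 1?eq_sym //.
have : r (F :|: cl [set x; y]) <= (r F).+1.
  rewrite -(flat_rank1 fF xF); apply: rank_setS; rewrite subUset.
  rewrite (subset_trans (subsetUr [set x] F) (sub_cl _)) cl_sub.
  by apply/subsetP => w /set2P[] -> //; rewrite mem_cl ?setU11.
move=> le E; have : 0 < r (F :&: cl [set x; y]) by move: le E; clear; lia.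
rewrite (rank_set_gt0 sM) => /set0Pn[z]; rewrite inE => /andP[zF zl].
have xz : x != z by apply: contraNneq xF => ->.
apply: (subsetP (lS x z xS (subsetP sFS z zF) xz)).
by rewrite (line_eq xz (mem_cl (set21 x y)) zl) mem_cl ?set22.
Qed.

End Modular.

(** * Connectedness and double adjoints *)

Lemma inj_surj_bij (S T : finType) (f : S -> T) :
  injective f -> (forall y, exists x, f x = y) -> bijective f.
Proof.
move=> injf surf; apply: inj_card_bij => //.
have exf y : exists x, f x == y by have [x <-] := surf y; exists x.
apply: (@leq_card _ _ (fun y => xchoose (exf y))); apply: (can_inj (g := f)) => y.
exact/eqP/(xchooseP (exf y)).
Qed.

Lemma isomorphic_flats (M N : matroid) (f : M -> N) : bijective f ->
  (forall S : {set M}, flat (f @: S) = flat S) -> isomorphic M N.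
Proof.
move=> bijf flatf; have injf := bij_inj bijf; have [g fK gK] := bijf.
have imK (A : {set N}) : f @: (g @: A) = A.
  by rewrite -imset_comp -[RHS]imset_id; apply: eq_imset => x; exact: gK.
have clf (S : {set M}) : cl (f @: S) = f @: cl S.
  apply/eqP; rewrite eqEsubset; apply/andP; split.
    by apply: cl_min; rewrite ?flatf ?flat_cl // imsetS // sub_cl.
  rewrite -(imK (cl (f @: S))) imsetS //; apply: cl_min.
    by rewrite -flatf imK flat_cl.
  apply/subsetP => x xS; rewrite -(fK x) imset_f // mem_cl //; exact: imset_f.
exists f => // A; rewrite !indep_cl; apply/forall_inP/forall_inP => nA x xA.
  apply: contra (nA (f x) (imset_f _ xA)) => xc.
  have -> : f @: A :\ f x = f @: (A :\ x).
    apply/setP => y; rewrite -(gK y) !inE (inj_eq injf) !mem_imset //.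
    by rewrite !inE.
  by rewrite clf mem_imset.
have [y yA ->] := imsetP xA; apply: contra (nA y yA).
have -> : f @: A :\ f y = f @: (A :\ y).
  apply/setP => z; rewrite -(gK z) !inE (inj_eq injf) !mem_imset //.
  by rewrite !inE.
by rewrite clf mem_imset.
Qed.

Lemma isomorphic_refl M : isomorphic M M.
Proof. by exists id => [|A]; [exact: (@inv_bij _ id) | rewrite imset_id]. Qed.

Lemma isomorphic_sym M N : isomorphic M N -> isomorphic N M.
Proof.
case=> f [g fK gK] fI; exists g => [|A]; first exact: Bijective gK fK.
suff E : f @: (g @: A) = A by rewrite -fI E.
by rewrite -imset_comp -[RHS]imset_id; apply: eq_imset => x; exact: gK.
Qed.

Lemma isomorphic_trans N M P : isomorphic M N -> isomorphic N P -> isomorphic M P.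
Proof.
case=> f bf fI [g bg gI]; exists (g \o f); first exact: bij_comp.
by move=> A; rewrite imset_comp gI fI.
Qed.

Lemma isomorphic_card M N : isomorphic M N -> #|M| = #|N|.
Proof. by case=> f bf _; exact: bij_eq_card bf. Qed.

Lemma isomorphic_rank M N : isomorphic M N -> rank M = rank N.
Proof.
suff le M' N' : isomorphic M' N' -> rank M' <= rank N'.
  by move=> iMN; apply/eqP; rewrite eqn_leq !le //; exact: isomorphic_sym.
case=> f bf fI; have [I [II _ cI]] := @rank_basis M' setT.
rewrite /rank -cI -(card_imset _ (bij_inj bf)); apply: card_indep_le; [rewrite fI // | exact: subsetT].
Qed.

Section Separators.

(** The form of connectedness that a labelling transports. The reverse of the inequality always
    holds, so a set satisfying it is a separator. *)
Definition separator_free (M : matroid) : Prop := forall X : {set M},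
  rank_set X + rank_set (~: X) <= rank M -> X = set0 \/ X = setT.

(** A circuit C through a point of X and a point outside X meets both X and its complement in
    proper, hence independent, subsets. If the ranks of X and of its complement add up, applying
    submodularity twice makes C independent. *)
Lemma connected_separator_free M : connected M -> separator_free M.
Proof.
move=> cM X le; have [->|/set0Pn[x xX]] := eqVneq X set0; first by left.
have [->|XT] := eqVneq X setT; first by right.
have : ~~ ([set: M] \subset X) by rewrite subTset.
case/subsetPn => y _ yX.
have [|C [cC xC yC]] := cM x y; first by apply: contraNneq yX => <-.
have /minsetP[/= nC minC] := cC.
have rC (B : {set M}) : B \proper C -> rank_set B = #|B|.
  move=> pB; apply/eqP; rewrite -indepE; apply/contraT => nB.
  by have := pB; rewrite (minC B nB (proper_sub pB)) properxx.
have r1 : rank_set (C :&: X) = #|C :&: X|.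
  by apply: rC; apply/properP; split; [exact: subsetIl | exists y; rewrite // inE (negPf yX) andbF].
have r2 : rank_set (C :\: X) = #|C :\: X|.
  by apply: rC; apply/properP; split; [exact: subsetDl | exists x; rewrite // inE xX].
have l1 := rank_submod (X :|: C) (~: X).
have EX : (X :|: C) :&: ~: X = C :\: X.
  by apply/setP => z; rewrite !inE; case: (z \in X); rewrite ?andbF ?andbT.
have ET : (X :|: C) :|: ~: X = setT.
  by apply/setP => z; rewrite !inE; case: (z \in X); rewrite ?orbT.
rewrite EX ET r2 -/(rank M) in l1.
have l2 := rank_submod C X; rewrite r1 setUC in l2.
have l3 : #|C| <= rank_set C by move: l1 l2 le; rewrite -(cardsID X C); clear; lia.
by case/negP: nC; rewrite indepE eqn_leq rank_set_card.
Qed.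

Variables (M N : matroid) (h : N -> {set M}).
Hypotheses (sM : simple M) (sN : simple N) (hN : hyperplane_labelling h).

Lemma labelling_hyperplane n : hyperplane (h n).
Proof. by case: hN => _ hypE _ _; apply/hypE; exists n. Qed.

(** If E separates N, the intersection [Xof E] of the hyperplanes labelled by E separates M. Indeed
    each x lies in [Xof E] or in [Xof (~: E)]: the labels of the hyperplanes through x form a flat
    of corank one, and if it contained neither E nor its complement, it would lose rank in both
    parts, two in all. *)
Lemma labelling_separator_free : separator_free M -> separator_free N.
Proof.
have [injh hypE polar rNM] := hN.
move=> cM E le; pose Xof (A : {set N}) := \bigcap_(n in A) h n.
have fX A : flat (Xof A).
  by apply: flat_bigI => n _; apply: hyperplane_flat; exact: labelling_hyperplane.
have rX A : rank_set (Xof A) + rank_set A <= rank M.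
  have [_ <-] := polar _ (fX A); rewrite addnC leq_add2r; apply: rank_setS.
  by apply/subsetP => n nA; rewrite inE; apply: bigcap_inf.
have XT (A : {set N}) : Xof A = setT -> A = set0.
  move=> EX; have := rX A; rewrite EX -/(rank M) => rA.
  by apply/eqP/contraT; rewrite -(rank_set_gt0 sN); move: rA; clear; lia.
have cov x : (x \in Xof E) || (x \in Xof (~: E)).
  have [fK rK] := polar _ (flat1 sM x); rewrite (rank_set1 sM) in rK.
  set K := [set n | _] in fK rK.
  have subX (A : {set N}) : A \subset K -> x \in Xof A.
    by move=> /subsetP s; apply/bigcapP => n /s; rewrite inE sub1set.
  have drop (A : {set N}) : ~~ (A \subset K) -> rank_set (K :&: A) < rank_set A.
    case/subsetPn => n nA nK; have nKA : n \notin cl (K :&: A).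
      by apply: contra nK; apply/subsetP/cl_min; rewrite ?subsetIl.
    move: nKA; rewrite notin_cl => /eqP <-; apply: rank_setS.
    by rewrite subUset sub1set nA subsetIr.
  have [/subX ->//|/drop d1] := boolP (E \subset K).
  have [/subX ->|/drop d2] := boolP (~: E \subset K); first by rewrite orbT.
  have := rank_setU (K :&: E) (K :&: ~: E); rewrite -setIUr setUCr setIT.
  move: d1 d2 le rK; rewrite rNM; clear; lia.
have leT := rank_setU E (~: E); rewrite setUCr -/(rank N) rNM in leT.
have sX : ~: Xof E \subset Xof (~: E).
  by apply/subsetP => x; rewrite inE => /negPf xE; have := cov x; rewrite xE.
have [|E0|/XT ->] := cM (Xof E); last by left.
- by have := rank_setS sX; have := rX E; have := rX (~: E); move: leT; clear; lia.
- right; apply: setC_inj; rewrite setCT; apply: XT; apply/eqP; rewrite -subTset.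
  by rewrite -setC0 -E0.
Qed.

End Separators.

(** * Polarity between a modular matroid and its adjoint *)

Section ModularDual.
Variables (M N : matroid) (h : N -> {set M}).
Hypotheses (sM : simple M) (sN : simple N) (hN : hyperplane_labelling h) (mM : modular M).

(** Enlarging a flat of N by a label n amounts to cutting F1 with [h n]. Modularity makes the cut
    lower the rank by exactly one, so that the ranks on the two sides keep matching. *)
Lemma labelling_flat (K : {set N}) : flat K ->
  exists2 F : {set M}, flat F & K = [set n | F \subset h n].
Proof.
have [injh hypE polar rNM] := hN.
have [k] := ubnP (rank_set K); elim: k K => // k IHk K le_k fK.
have [r0|r0] := posnP (rank_set K).
  have -> : K = set0 by apply/eqP/contraT; rewrite -(rank_set_gt0 sN) r0.
  exists setT; first exact: flatT.
  apply/esym/setP => n; rewrite !inE; apply/negP => /rank_setS.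
  by rewrite leqNgt -/(rank M) (hyperplane_rank (labelling_hyperplane hN n)) leqnn.
have [K1 [fK1 sK rK]] := exists_subflat fK r0.
have : ~~ (K \subset K1) by apply/negP => /rank_setS; rewrite -rK ltnn.
case/subsetPn => n nK nK1; have [|F1 fF1 E1] := IHk K1 _ fK1; first by rewrite -ltnS rK.
have hn := labelling_hyperplane hN n.
have nF : ~~ (F1 \subset h n) by move: nK1; rewrite E1 inE.
have rF := modular_hyperplane mM fF1 hn nF.
have fF := flatI fF1 (hyperplane_flat hn).
exists (F1 :&: h n) => //; have [fp rp] := polar _ fF; have [_ rp1] := polar _ fF1.
have EK : cl (n |: K1) = K.
  apply: flat_eq; rewrite ?flat_cl ?flat_rank1 ?rK // cl_min //.
  by rewrite subUset sub1set nK.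
rewrite -EK; apply: flat_eq; first exact: flat_cl.
  apply: cl_min => //; rewrite subUset sub1set inE subsetIr /= E1.
  by apply/subsetP => m; rewrite !inE; apply: subset_trans; exact: subsetIl.
rewrite flat_rank1 // E1; move: rp rp1; rewrite -rF; clear; lia.
Qed.

Lemma labelling_point x : hyperplane [set n | x \in h n].
Proof.
have [injh hypE polar rNM] := hN; have [fK rK] := polar _ (flat1 sM x).
have -> : [set n | x \in h n] = [set n | [set x] \subset h n].
  by apply/setP => n; rewrite !inE sub1set.
by apply/hyperplaneP; split=> //; rewrite rNM -rK rank_set1 // addn1.
Qed.

Lemma labelling_hyperplane_point K : hyperplane K -> exists x, K = [set n | x \in h n].
Proof.
case/hyperplaneP => fK rK; have [injh hypE polar rNM] := hN.
have [F fF E] := labelling_flat fK; have [_ rp] := polar _ fF.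
have [|x Ex] := flat_rank1P sM fF.
  by move: rp rK; rewrite -E rNM; clear; lia.
by exists x; rewrite E Ex; apply/setP => n; rewrite !inE sub1set.
Qed.

(** A hyperplane of N is given by a point x of M, and a line of N by the flat in which [h m] and
    [h n] meet. This flat has corank two, so some hyperplane contains both it and x, and its label
    is the required point. *)
Lemma labelling_modular : modular N.
Proof.
have [injh hypE polar rNM] := hN.
apply: (meets_modular sN) => m n K mn /labelling_hyperplane_point [x ->].
have hm := labelling_hyperplane hN m; have hn := labelling_hyperplane hN n.
have nmn : ~~ (h m \subset h n).
  by apply: contra mn => s; apply/eqP/injh/hyperplane_inj.
have fE := flatI (hyperplane_flat hm) (hyperplane_flat hn).
have rE := modular_hyperplane mM (hyperplane_flat hm) hn nmn.
have rm := hyperplane_rank hm.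
have [|H /hypE [p <-]] := @exists_hyperplane _ (x |: h m :&: h n).
  by apply: leq_ltn_trans (rank_setU1 _ _) _; rewrite rE -rm.
rewrite subUset sub1set => /andP[xp sEp]; exists p; first by rewrite inE.
have [fp rp] := polar _ fE.
suff -> : cl [set m; n] = [set p | h m :&: h n \subset h p] by rewrite inE.
apply: flat_eq; first exact: flat_cl.
  apply: cl_min => //; apply/subsetP => q /set2P[] ->; rewrite inE ?subsetIl ?subsetIr //.
rewrite rank_cl rank_set2 //; move: rp; rewrite -rm -rE; clear; lia.
Qed.

End ModularDual.

(** The point of P attached to x is the label of the hyperplane of N formed by all n with x in
    [h n]. By [labelling_flat], used twice, every flat of P is the double polar of a flat of M. *)
Lemma double_labelling (M N P : matroid) (h : N -> {set M}) (g : P -> {set N}) :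
  simple M -> simple N -> simple P -> modular M ->
  hyperplane_labelling h -> hyperplane_labelling g -> isomorphic M P.
Proof.
move=> sM sN sP mM hN gP; have [injh hypE polar rNM] := hN.
have [injg hypE' polar' rPN] := gP; have mN := labelling_modular sM sN hN mM.
have exf x : exists p, g p == [set n | x \in h n].
  by have /hypE'[p <-] := labelling_point sM hN x; exists p.
pose f x := xchoose (exf x).
have gf x : g (f x) = [set n | x \in h n] by apply/eqP/(xchooseP (exf x)).
have hypsep (F : {set M}) x : flat F ->
    ([set n | F \subset h n] \subset [set n | x \in h n]) = (x \in F).
  move=> fF; apply/subsetP/idP => [sF|xF n]; last by rewrite !inE => /subsetP; apply.
  by apply: flat_capE => // H /hypE[n <-] sn; have := sF n; rewrite !inE; apply.
have injf : injective f.
  move=> x y E; apply/set1P; rewrite -hypsep ?flat1 // -gf E gf.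
  by apply/subsetP => n; rewrite !inE sub1set.
have surjf p : exists x, f x = p.
  have [x E] := labelling_hyperplane_point sM sN hN mM (labelling_hyperplane gP p).
  by exists x; apply: injg; rewrite gf E.
have imf (F : {set M}) : flat F -> f @: F = [set p | [set n | F \subset h n] \subset g p].
  move=> fF; apply/setP => p; have [x <-] := surjf p.
  by rewrite mem_imset // inE gf hypsep.
apply: (isomorphic_flats (inj_surj_bij injf surjf)) => S.
apply/idP/idP => [fS|fS]; last first.
  by rewrite imf //; have [fp _] := polar _ fS; have [] := polar' _ fp.
have [K fK E] := labelling_flat sP gP mN fS.
have [F fF EF] := labelling_flat sN hN mM fK.
by suff -> : S = F by []; apply: (imset_inj injf); rewrite E imf // EF.
Qed.

(** * Modular matroids have adjoints and are projective geometries *)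

Section DualMatroid.
Variable M : matroid.
Hypotheses (sM : simple M) (mM : modular M).
Local Notation r := (@rank_set M).
Local Notation hyp := {H : {set M} | hyperplane H}.
Implicit Types (S T : {set hyp}) (H : hyp) (F : {set M}).

Definition meet (S : {set hyp}) : {set M} := \bigcap_(H in S) val H.

Lemma meetP (S : {set hyp}) x : reflect (forall H, H \in S -> x \in val H) (x \in meet S).
Proof. exact: bigcapP. Qed.

Lemma flat_meet S : flat (meet S).
Proof. by apply: flat_bigI => H _; apply: hyperplane_flat; exact: valP. Qed.

Lemma meetU1 H S : meet (H |: S) = val H :&: meet S.
Proof. by rewrite /meet bigcap_setU big_set1. Qed.

Lemma meet0 : meet set0 = setT.
Proof. by rewrite /meet big_set0. Qed.

Lemma meetS (S T : {set hyp}) : S \subset T -> meet T \subset meet S.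
Proof. by move=> /subsetP s; apply/subsetP => x /meetP xT; apply/meetP => H /s/xT. Qed.

Lemma rank_meet_le (S T : {set hyp}) : S \subset T -> r (meet S) + #|S| <= r (meet T) + #|T|.
Proof.
have [n] := ubnP #|T :\: S|; elim: n S => // n IHn S le_n sST.
have [E|/set0Pn[H]] := eqVneq (T :\: S) set0.
  by suff -> : S = T by []; apply/eqP; rewrite eqEsubset sST -setD_eq0 E eqxx.
rewrite inE => /andP[HS HT]; have := IHn (H |: S); rewrite subUset sub1set HT sST.
have -> : T :\: (H |: S) = (T :\: S) :\ H.
  by apply/setP => K; rewrite !inE negb_or; case: (K == H) => //=; rewrite andbC.
move: le_n; rewrite (cardsD1 H (T :\: S)) inE HS HT ltnS => lt /(_ lt isT).
rewrite meetU1 cardsU1 HS addnA addn1; apply: leq_trans; rewrite leq_add2r setIC.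
apply: (modular_hyperplane_le mM); [exact: flat_meet | exact: (valP H)].
Qed.

(** A family of hyperplanes is independent if its intersection has the largest corank possible, one
    for each member; the opposite inequality is [rank_meet_ge]. *)
Definition dual_indep : {set {set hyp}} := [set S | r (meet S) + #|S| <= rank M].

Lemma rank_meet_ge S : rank M <= r (meet S) + #|S|.
Proof. by have := rank_meet_le (sub0set S); rewrite meet0 cards0 addn0. Qed.

Lemma dual_indep0 : set0 \in dual_indep.
Proof. by rewrite inE meet0 cards0 addn0. Qed.

Lemma dual_indepS (S T : {set hyp}) : S \subset T -> T \in dual_indep -> S \in dual_indep.
Proof. by rewrite !inE => /rank_meet_le; exact: leq_trans. Qed.

Lemma dual_indepU1 H S : S \in dual_indep -> ~~ (meet S \subset val H) -> H |: S \in dual_indep.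
Proof.
rewrite !inE => IS nS; rewrite meetU1 setIC.
have HS : H \notin S by apply: contra nS => HS; exact: bigcap_inf.
rewrite cardsU1 HS addnA addn1.
by rewrite (modular_hyperplane mM (flat_meet S) (valP H) nS).
Qed.

Lemma dual_indep_augment (S T : {set hyp}) :
  S \in dual_indep -> T \in dual_indep -> #|S| < #|T| ->
  exists2 H, H \in T :\: S & H |: S \in dual_indep.
Proof.
move=> IS IT lt; have [H HT nH] : exists2 H, H \in T & ~~ (meet S \subset val H).
  apply/exists_inP/contraT; rewrite negb_exists_in => /forall_inP nE.
  have : r (meet S) <= r (meet T).
    apply: rank_setS; apply/subsetP => x xS; apply/meetP => H HT.
    by have := nE H HT; rewrite negbK => /subsetP; apply.
  have := rank_meet_ge S; move: IT lt; rewrite inE; clear; lia.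
exists H; last exact: dual_indepU1.
by rewrite inE HT andbT; apply: contra nH => HS; exact: bigcap_inf.
Qed.

Definition dual_matroid : matroid := Matroid dual_indep0 dual_indepS dual_indep_augment.

(** A basis I of S has the same intersection as S: a hyperplane of S that does not contain [meet I]
    could be added to I. *)
Lemma rank_dual (S : {set dual_matroid}) : rank_set S + r (meet S) = rank M.
Proof.
have [I [II sIS cI]] := rank_basis S; have I' : I \in dual_indep := II.
have -> : meet S = meet I.
  apply/eqP; rewrite eqEsubset meetS //; apply/subsetP => x xI; apply/meetP => H HS.
  apply/contraT => xH; have nI : ~~ (meet I \subset val H) by apply/subsetPn; exists x.
  have HI : H \notin I by apply: contra nI => HI; exact: bigcap_inf.
  have JI : H |: I \in indep dual_matroid := dual_indepU1 I' nI.
  have := @card_indep_le dual_matroid _ S JI; rewrite subUset sub1set HS sIS => /(_ isT).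
  by rewrite cardsU1 HI -cI ltnn.
by apply/eqP; rewrite eqn_leq -cI addnC rank_meet_ge andbT; move: I'; rewrite inE.
Qed.

Lemma rank_dualE : rank dual_matroid = rank M.
Proof.
have := rank_dual setT; have -> : meet setT = set0.
  apply/eqP; rewrite -subset0; apply/subsetP => x /meetP xH.
  by apply: flat_capE (flat0 sM) _ => H hH _; have := xH (exist _ H hH); rewrite in_setT => /(_ isT).
by rewrite rank_set0 addn0.
Qed.

Definition polar (F : {set M}) : {set dual_matroid} := [set H : hyp | F \subset val H].

Lemma meet_polar F : flat F -> meet (polar F) = F.
Proof.
move=> fF; apply/eqP; rewrite eqEsubset; apply/andP; split; apply/subsetP => x.
  move=> /meetP xH; apply: flat_capE fF _ => H hH sFH.
  by apply: (xH (exist _ H hH)); rewrite inE.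
by move=> xF; apply/meetP => H; rewrite inE => /subsetP; apply.
Qed.

Lemma rank_polar F : flat F -> rank_set (polar F) + r F = rank M.
Proof. by move=> fF; rewrite -(rank_dual (polar F)) meet_polar. Qed.

Lemma flat_polar F : flat F -> flat (polar F).
Proof.
move=> fF; apply/flatP/eqP; rewrite eqEsubset sub_cl andbT; apply/subsetP => H.
apply: contraTT; rewrite inE => nFH; rewrite notin_cl.
have := rank_dual (H |: polar F); rewrite meetU1 meet_polar // setIC => E.
have rF := modular_hyperplane mM fF (valP H) nFH.
apply/eqP/(@addIn (r (F :&: val H))); apply: (etrans E).
by rewrite -(rank_polar fF) -rF addnS addSn.
Qed.

Lemma dual_simple : simple dual_matroid.
Proof.
apply/simpleP => G H; suff : [set G; H] \in dual_indep by [].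
rewrite inE meetU1 cards2; have -> : meet [set H] = val H by rewrite /meet big_set1.
have [<-|GH] /= := eqVneq G H; first by rewrite setIid addn1 (hyperplane_rank (valP G)).
have nGH : ~~ (val G \subset val H).
  apply: contra GH => s; apply/eqP/val_inj; exact: hyperplane_inj (valP G) (valP H) s.
have := modular_hyperplane mM (hyperplane_flat (valP G)) (valP H) nGH.
by rewrite -(hyperplane_rank (valP G)) => <-; rewrite addn2.
Qed.

Lemma dual_adjoint : adjoint_step M dual_matroid.
Proof.
split; last exact: dual_simple; split; first exact: rank_dualE.
pose phi (F : flats M) : flats dual_matroid := Flat (flat_polar (valP F)).
have hypphi (H : {H : {set M} | hyperplane H}) : polar (val H) = [set H].
  apply/setP => G; rewrite !inE; apply/idP/eqP => [s|-> //].
  by apply/val_inj/esym; exact: hyperplane_inj (valP H) (valP G) s.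
exists phi; split.
- move=> F G /(congr1 val) /= E; apply/val_inj.
  by rewrite -(meet_polar (valP F)) E meet_polar ?(valP G).
- by move=> F G s; apply/subsetP => H; rewrite !inE; exact: subset_trans.
- apply/setP => S; rewrite atomsE; apply/imsetP/eqP => [[F]|].
    rewrite coatomsE => /hyperplaneP[fF rF] ->.
    by have := rank_polar fF; rewrite -rF -addn1 addnC => /addnI.
  move=> /(flat_rank1P dual_simple (valP S)) [H E].
  exists (Flat (hyperplane_flat (valP H))); first by rewrite coatomsE (valP H).
  by apply/val_inj; rewrite E /= hypphi.
Qed.

End DualMatroid.

Section ProjectiveGeometry.
Variable M : matroid.
Hypotheses (sM : simple M) (mM : modular M).
Implicit Types (x y z a b c u v w : M).
Local Notation r := (@rank_set M).
Local Notation ln x y := (cl [set x; y]).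

Lemma in_line1 x y : x \in ln x y.
Proof. by rewrite mem_cl ?set21. Qed.

Lemma in_line2 x y : y \in ln x y.
Proof. by rewrite mem_cl ?set22. Qed.

Lemma rank_line x y : x != y -> r (ln x y) = 2.
Proof. by move=> xy; rewrite rank_cl rank_set2. Qed.

Lemma lineC x y : ln x y = ln y x.
Proof. by rewrite setUC. Qed.

Lemma line_sub x y F : flat F -> x \in F -> y \in F -> ln x y \subset F.
Proof. by move=> fF xF yF; apply: cl_min => //; apply/subsetP => z /set2P[] ->. Qed.

Lemma flat_lineE F x y : flat F -> r F = 2 -> x != y -> x \in F -> y \in F -> ln x y = F.
Proof.
move=> fF rF xy xF yF; apply: flat_eq; rewrite ?flat_cl ?line_sub ?rank_line //.
by rewrite rF.
Qed.

Lemma line_exchange x y z : z \in ln x y -> z != x -> y \in ln x z.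
Proof. by move=> zl zx; rewrite (line_eq sM _ (in_line1 x y) zl) 1?eq_sym // in_line2. Qed.

Lemma coplanar_lines_meet a b c d F : a != b -> c != d -> r F <= 3 -> flat F ->
  a \in F -> b \in F -> c \in F -> d \in F -> exists2 p, p \in ln a b & p \in ln c d.
Proof.
move=> ab cd rF fF aF bF cF dF.
have : 0 < r (ln a b :&: ln c d).
  have := mM (flat_cl [set a; b]) (flat_cl [set c; d]); rewrite !rank_line //.
  have := rank_setS (_ : ln a b :|: ln c d \subset F); rewrite subUset !line_sub // => /(_ isT).
  by move: rF; clear; lia.
by rewrite rank_set_gt0 // => /set0Pn[p]; rewrite inE => /andP[? ?]; exists p.
Qed.

(** In a modular matroid this is an equivalence relation, each of whose classes turns out to be a
    separator. *)
Definition joined x y := (x == y) || [exists z, [&& z \in ln x y, z != x & z != y]].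

Lemma joinedC x y : joined x y = joined y x.
Proof.
rewrite /joined eq_sym; congr (_ || _); apply: eq_existsb => z.
by rewrite lineC; case: (z \in _) => //=; rewrite andbC.
Qed.

Lemma joined_third x y z : z \in ln x y -> z != x -> z != y -> joined x z.
Proof.
move=> zl zx zy; apply/orP; right; apply/existsP; exists y.
have [xy|xy] := eqVneq y x; last by rewrite line_exchange // eq_sym zy.
by move: zl; rewrite xy setUid cl_set1 // inE (negPf zx).
Qed.

(** The Veblen-Young argument: with third points u on xy and v on yz, the line uv meets xz in a
    point w. It is neither x nor z, for otherwise the lines xy and yz would coincide. *)
Lemma joined_trans y x z : joined x y -> joined y z -> joined x z.
Proof.
have [->|xy] := eqVneq x y; first by [].
have [->|yz] := eqVneq y z; first by [].
have [->|xz] := eqVneq x z; first by rewrite /joined eqxx.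
rewrite {1 2}/joined (negPf xy) (negPf yz) /=.
move=> /existsP[u /and3P[ul ux uy]] /existsP[v /and3P[vl vy vz]].
have [zl|zl] := boolP (z \in ln x y); first by apply: (joined_third zl); rewrite // eq_sym.
have luy : ln u y = ln x y := line_eq sM uy ul (in_line2 x y).
have lux : ln u x = ln x y := line_eq sM ux ul (in_line1 x y).
have lvy : ln v y = ln y z := line_eq sM vy vl (in_line1 y z).
have lvz : ln v z = ln y z := line_eq sM vz vl (in_line2 y z).
have nyz : ln x y <> ln y z by move=> E; case/negP: zl; rewrite E in_line2.
have uv : u != v.
  by apply/eqP => E; case: nyz; rewrite -luy -lvy E.
pose F := cl (z |: ln x y).
have rF : r F <= 3 by rewrite rank_cl (leq_trans (rank_setU1 _ _)) // rank_line.
have sF : ln x y \subset F by apply: subset_trans (sub_cl _); exact: subsetUr.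
have zF : z \in F by rewrite mem_cl ?setU11.
have yF : y \in F by rewrite (subsetP sF) ?in_line2.
have vF : v \in F by apply: (subsetP (line_sub (flat_cl _) yF zF)).
have [w wuv wxz] := coplanar_lines_meet uv xz rF (flat_cl _) (subsetP sF _ ul) vF
  (subsetP sF _ (in_line1 x y)) zF.
apply/orP; right; apply/existsP; exists w; rewrite wxz /=; apply/andP; split.
  apply/eqP => E; rewrite E in wuv; case: nyz.
  have E1 : ln u x = ln u v by apply: line_eq => //; exact: in_line1.
  rewrite -lvy; apply/esym; apply: line_eq => //; last exact: in_line2.
  by rewrite -lux E1 in_line2.
apply/eqP => E; rewrite E in wuv; case: nyz.
have E1 : ln v z = ln u v by apply: line_eq => //; exact: in_line2.
rewrite -luy; apply: line_eq => //; last exact: in_line1.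
by rewrite -lvz E1 in_line1.
Qed.

Hypothesis cM : separator_free M.

(** The class X of x and its complement are closed under lines, hence flats. They are disjoint, so
    by modularity their ranks add up to that of M, and X, which contains x, is everything. *)
Lemma line_third x y : x != y -> exists z, [/\ z \in ln x y, z != x & z != y].
Proof.
move=> xy; pose X := [set a | joined x a].
suff : joined x y.
  by rewrite /joined (negPf xy) => /existsP[z /and3P[? ? ?]]; exists z.
have third a b c : c \in ln a b -> c != a -> c != b -> joined a c /\ joined b c.
  by move=> cl ca cb; split; [|rewrite lineC in cl]; apply: joined_third cl _ _.
have fX : flat X.
  apply: line_closed_flat => // a b; rewrite !inE => ja jb ab.
  apply/subsetP => c cl; rewrite inE; have [->//|ca] := eqVneq c a.
  have [->//|cb] := eqVneq c b; apply: joined_trans ja _.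
  by have [] := third _ _ _ cl ca cb.
have fX' : flat (~: X).
  apply: line_closed_flat => // a b; rewrite !inE => ja jb ab.
  apply/subsetP => c cl; rewrite !inE; apply: contra ja => jc.
  have [<-//|ca] := eqVneq c a; have [E|cb] := eqVneq c b; first by case/negP: jb; rewrite -E.
  by apply: joined_trans jc _; rewrite joinedC; have [] := third _ _ _ cl ca cb.
have := mM fX fX'; rewrite setUCr setICr rank_set0 addn0 -/(rank M) => E.
have [X0|XT] := cM (eq_leq (esym E)).
  by have := in_set0 x; rewrite -X0 inE /joined eqxx.
by have := in_setT y; rewrite -XT inE.
Qed.

Lemma line_points (l : {set M}) : flat l -> r l = 2 -> exists x y, x != y /\ l = ln x y.
Proof.
move=> fl rl; have [I [II sI cI]] := rank_basis l; rewrite rl in cI.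
have /cards2P[x [y [xy E]]] : #|I| == 2 by rewrite cI.
by exists x, y; split=> //; apply/esym/flat_lineE; rewrite // (subsetP sI) // E !inE eqxx ?orbT.
Qed.

Lemma modular_projective : is_projective_geometry M.
Proof.
split=> //; pose L := {l : {set M} | flat l && (r l == 2)}.
pose I x (l : L) : Prop := x \in val l.
have lnP x y : x != y -> flat (ln x y) && (r (ln x y) == 2).
  by move=> xy; rewrite flat_cl rank_line ?eqxx.
pose Ln x y xy : L := exist _ (ln x y) (lnP x y xy).
have LE x y (l : L) : x != y -> x \in val l -> y \in val l -> ln x y = val l.
  by move=> xy xl yl; have /andP[fl /eqP rl] := valP l; apply: flat_lineE.
have I1 a b : a <> b -> exists! l, I a l /\ I b l.
  move/eqP => ab; exists (Ln a b ab); split; first by split; [exact: in_line1 | exact: in_line2].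
  by move=> l [al bl]; apply/val_inj/LE.
have I2 (l : L) : exists a b c, [/\ a <> b, a <> c & b <> c] /\ [/\ I a l, I b l & I c l].
  have /andP[fl /eqP rl] := valP l; have [x [y [xy El]]] := line_points fl rl.
  have [z [zl zx zy]] := line_third xy; exists x, y, z; split.
    by split; apply/eqP; rewrite // eq_sym.
  by split; rewrite /I El ?in_line1 ?in_line2.
have I3 a b c d : [/\ a <> b, a <> c & a <> d] -> [/\ b <> c, b <> d & c <> d] ->
    [/\ ~ collinear I a b c, ~ collinear I a b d, ~ collinear I a c d & ~ collinear I b c d] ->
    lines_meet I a b c d -> lines_meet I a c b d.
  move=> [/eqP ab /eqP ac _] [_ /eqP bd /eqP cd] _ [p [[l [al bl pl]] [m [cm dm pm]]]].
  have El := LE _ _ l ab al bl; have Em := LE _ _ m cd cm dm.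
  (* Two lines with a common point span rank at most 3, where modularity makes the lines ac and bd
     meet as well. *)
  have le : r (cl (val l :|: val m)) <= 3.
    have p0 : 0 < r (val l :&: val m).
      by rewrite rank_set_gt0 //; apply/set0Pn; exists p; rewrite inE; apply/andP.
    have := rank_submod (val l) (val m); have /andP[_ /eqP] := valP l.
    have /andP[_ /eqP] := valP m; rewrite rank_cl /=.
    by move: p0; move: (r _) (r _) (r _) (r _); clear; lia.
  have inl x : x \in val l -> x \in cl (val l :|: val m) by move=> xl; rewrite mem_cl // inE xl.
  have inm x : x \in val m -> x \in cl (val l :|: val m) by move=> xl; rewrite mem_cl // inE xl orbT.
  have [q q1 q2] := coplanar_lines_meet ac bd le (flat_cl _) (inl _ al) (inm _ cm) (inl _ bl) (inm _ dm).
  exists q; split; [exists (Ln a c ac) | exists (Ln b d bd)].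
    by split; [exact: in_line1 | exact: in_line2 |].
  by split; [exact: in_line1 | exact: in_line2 |].
exists L, (ProjectiveGeometry I1 I2 I3) => S; split=> [fS a b l aS bS /eqP ab al bl c cl|sS].
  have := LE a b l ab al bl => E; move: cl; rewrite /= /I -E => cl.
  exact: subsetP (line_sub fS aS bS) c cl.
apply: line_closed_flat => // a b aS bS ab; apply/subsetP => c cl.
by apply: (sS a b (Ln a b ab)) => //; [exact/eqP | exact: in_line1 | exact: in_line2].
Qed.

End ProjectiveGeometry.

(** * Central dilatations *)

Section Dilatations.
Variables (M : matroid) (H : {set M}).
Hypotheses (sM : simple M) (mM : modular M) (cM : separator_free M) (r4 : 4 <= rank M).
Hypothesis hH : hyperplane H.
Implicit Types (x y z a b c d u v w p q e : M) (F : {set M}).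
Local Notation r := (@rank_set M).
Local Notation ln x y := (cl [set x; y]).

Let fH : flat H := hyperplane_flat hH.

(* The point at infinity of the line through x and y, for the hyperplane at
   infinity H; it is meant for x outside H and x <> y. *)
Definition dir x y : M := odflt x [pick z in ln x y :&: H].

Lemma dirP x y : x \notin H -> x != y -> dir x y \in H /\ dir x y \in ln x y.
Proof.
move=> xH xy; rewrite /dir; case: pickP => [z|nz]; first by rewrite inE => /andP[].
have [z zH zl] := modular_meets sM mM xy hH.
by have := nz z; rewrite /= inE zH zl.
Qed.

Lemma dir_inH x y : x \notin H -> x != y -> dir x y \in H.
Proof. by move=> xH xy; case: (dirP xH xy). Qed.

Lemma dir_line x y : x \notin H -> x != y -> dir x y \in ln x y.
Proof. by move=> xH xy; case: (dirP xH xy). Qed.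

Lemma dir_neq x y z : x \notin H -> x != y -> z \notin H -> z != dir x y.
Proof. by move=> xH xy; apply: contraNneq => ->; exact: dir_inH. Qed.

Lemma dir_uniq x y z : x \notin H -> x != y -> z \in H -> z \in ln x y -> dir x y = z.
Proof.
move=> xH xy zH zl; apply/eqP/contraT => dz; case/negP: (xH).
have E := line_eq sM dz (dir_line xH xy) zl.
by apply: (subsetP (line_sub fH (dir_inH xH xy) zH)); rewrite E in_line1.
Qed.

Lemma line_dir x y : x \notin H -> x != y -> ln x (dir x y) = ln x y.
Proof.
move=> xH xy; apply: (line_eq sM); rewrite ?in_line1 ?dir_line //.
exact: dir_neq.
Qed.

Lemma dirC x y : x \notin H -> y \notin H -> x != y -> dir x y = dir y x.
Proof.
move=> xH yH xy; apply: dir_uniq; rewrite // ?dir_inH 1?eq_sym //.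
by rewrite lineC dir_line // eq_sym.
Qed.

Lemma line_of_dir x y z : x \notin H -> x != y -> x != z -> dir x y = dir x z -> ln x y = ln x z.
Proof. by move=> xH xy xz E; rewrite -(line_dir xH xy) E line_dir. Qed.

Lemma dir_of_line x y u v : x \notin H -> u \notin H -> x != y -> u != v ->
  ln x y = ln u v -> dir x y = dir u v.
Proof. by move=> xH uH xy uv E; apply: dir_uniq; rewrite ?dir_inH // E dir_line. Qed.

Lemma dir_on x y z : x \notin H -> x != y -> x != z -> z \in ln x y -> dir x z = dir x y.
Proof.
move=> xH xy xz zl; apply: dir_of_line => //.
exact: (line_eq sM) (in_line1 _ _) zl.
Qed.

(** The hypothesis [4 <= rank M] leaves a point x outside F. If x is on H, a third point of the line
    ax avoids both F and H. *)
Lemma affine_point_outside F a : flat F -> r F <= 3 -> a \notin H -> a \in F ->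
  exists2 e, e \notin F & e \notin H.
Proof.
move=> fF rF aH aF; have : ~~ ([set: M] \subset F).
  by apply/negP => /rank_setS; have := leq_trans r4; rewrite -/(rank M) => le /le; rewrite leqNgt ltnS rF.
case/subsetPn => x _ xF; have [xH|xH] := boolP (x \in H); last by exists x.
have ax : a != x by apply: contraNneq xF => <-.
have [z [zl za zx]] := line_third sM mM cM ax; exists z.
  apply: contra xF => zF; apply: (subsetP (line_sub fF aF zF)).
  exact: line_exchange.
apply: contra aH => zH; apply: (subsetP (line_sub fH xH zH)).
by apply: (line_exchange sM); rewrite 1?lineC.
Qed.

Lemma rank_plane p a b : p != a -> b \notin ln p a -> r (cl (b |: ln p a)) = 3.
Proof. by move=> pa bl; rewrite flat_rank1 ?flat_cl // rank_line. Qed.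

Lemma plane_line p a b : ln p a \subset cl (b |: ln p a).
Proof. by apply: subset_trans (sub_cl _); exact: subsetUr. Qed.

Lemma plane_pt p a b : b \in cl (b |: ln p a).
Proof. by rewrite mem_cl ?setU11. Qed.

Section Center.
Variable p : M.

(** The centre p may lie on H or off it: the same construction gives the translations in the
    direction p and the homotheties that fix p. *)
Definition affine_pt x := (x \notin H) && (x != p).
Definition aligned x x' := [&& affine_pt x, affine_pt x' & x' \in ln p x].

Lemma alignedP x x' : aligned x x' ->
  [/\ x \notin H, x != p, x' \notin H, x' != p & ln p x' = ln p x].
Proof.
case/and3P => /andP[xH xp] /andP[x'H x'p] l; split=> //.
by apply: (line_eq sM) (in_line1 _ _) l; rewrite eq_sym.
Qed.

Lemma offC x y : x != p -> y != p -> (y \in ln p x) = (x \in ln p y).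
Proof. by move=> xp yp; apply/idP/idP => l; apply: (line_exchange sM). Qed.

Lemma off_neq x y : x != p -> y \notin ln p x -> x != y.
Proof. by move=> xp; apply: contraNneq => <-; exact: in_line2. Qed.

(** The point b' is where the parallel to ab through a' meets the line pb; both lie in the plane
    pab. If b' were p or a point of H, then b would lie on pa. *)
Lemma par_exists a a' b : aligned a a' -> affine_pt b -> b \notin ln p a ->
  exists2 b', aligned b b' & dir a' b' = dir a b.
Proof.
move=> pa /andP[bH bp] bl; have [aH ap a'H a'p El] := alignedP pa.
have pa_neq : p != a by rewrite eq_sym.
have ab := off_neq ap bl; set d := dir a b; have dH : d \in H := dir_inH aH ab.
have dl : d \in ln a b := dir_line aH ab.
have nad : a != d by apply: dir_neq.
have nda' : a' != d by apply: dir_neq.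
pose F := cl (b |: ln p a); have rF : r F = 3 := rank_plane pa_neq bl.
have sF : ln p a \subset F := plane_line p a b.
have bF : b \in F := plane_pt p a b.
have aF : a \in F := subsetP sF _ (in_line2 p a).
have pF : p \in F := subsetP sF _ (in_line1 p a).
have a'F : a' \in F by apply: (subsetP sF); rewrite -El in_line2.
have dF : d \in F by apply: (subsetP (line_sub (flat_cl _) aF bF)).
have pb : p != b by rewrite eq_sym.
have [b' b'd b'p] := coplanar_lines_meet sM mM nda' pb (eq_leq rF) (flat_cl _) a'F dF pF bF.
have Ead : ln a d = ln a b := line_dir aH ab.
have b'a' : a' != b'.
  apply: contraNneq bl => E; rewrite -E in b'p; rewrite -El.
  by rewrite (line_eq sM _ (in_line1 p b) b'p) ?in_line2 // eq_sym.
have db' : d \in ln a' b' by apply: (line_exchange sM) b'd _; rewrite eq_sym.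
have b'H : b' \notin H.
  apply/negP => b'H; have Ed : b' = d.
    by rewrite -(dir_uniq a'H nda' b'H b'd) (dir_uniq a'H nda' dH) ?in_line2.
  rewrite Ed in b'p; case/negP: bl; rewrite (offC ap bp).
  have bd : b != d by apply: dir_neq.
  have E1 : ln b d = ln p b := line_eq sM bd (in_line2 p b) b'p.
  have E2 : ln b d = ln a b := line_eq sM bd (in_line2 a b) dl.
  by rewrite -E1 E2 in_line1.
have b'np : b' != p.
  apply: contraNneq bl => E; rewrite E in db' b'a'.
  have dpa : d \in ln p a by rewrite -El lineC.
  by rewrite -(line_eq sM nad (in_line2 p a) dpa) Ead in_line2.
exists b'; first by rewrite /aligned /affine_pt bH bp b'H b'np.
exact: dir_uniq.
Qed.

Lemma par_uniq a' b b' b'' : a' \notin H -> a' \notin ln p b -> b' \in ln p b -> b'' \in ln p b ->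
  dir a' b' = dir a' b'' -> b' = b''.
Proof.
move=> a'H a'l b'l b''l E; apply/eqP/contraT => bb; case/negP: (a'l).
have ab' : a' != b' by apply: contraNneq a'l => ->.
have ab'' : a' != b'' by apply: contraNneq a'l => ->.
have E1 := line_of_dir a'H ab' ab'' E.
have E2 : ln b' b'' = ln a' b'.
  by apply: (line_eq sM bb (in_line2 _ _)); rewrite E1 in_line2.
by rewrite -(line_eq sM bb b'l b''l) E2 in_line1.
Qed.

Lemma aligned_off a a' b b' : aligned a a' -> aligned b b' -> b \notin ln p a -> b' \notin ln p a'.
Proof.
move=> pa pb bl; have [aH ap a'H a'p Ea] := alignedP pa; have [bH bp b'H b'p Eb] := alignedP pb.
by rewrite Ea (offC ap b'p) Eb -(offC ap bp).
Qed.

(* The planes abc and a'b'c' of a 3-space meet in a line, which lies in H as it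
   contains dir a b and dir a c, and which bc and b'c' meet in the same point. *)
Lemma desargues3 a a' b b' c c' : aligned a a' -> aligned b b' -> aligned c c' ->
  b \notin ln p a -> c \notin cl (b |: ln p a) ->
  dir a b = dir a' b' -> dir a c = dir a' c' -> dir b c = dir b' c'.
Proof.
move=> pa pb pc bl cF Eab Eac.
have [aH ap a'H a'p Ea] := alignedP pa; have [bH bp b'H b'p Eb] := alignedP pb.
have [cH cp c'H c'p Ec] := alignedP pc.
pose F := cl (b |: ln p a); have sF : ln p a \subset F := plane_line p a b.
have pa_neq : p != a by rewrite eq_sym.
have rF : r F = 3 := rank_plane pa_neq bl.
have pF : p \in F := subsetP sF _ (in_line1 p a).
have aF : a \in F := subsetP sF _ (in_line2 p a).
have bF : b \in F := plane_pt p a b.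
have cla : c \notin ln p a by apply: contra cF; exact: subsetP.
have lbF : ln p b \subset F := line_sub (flat_cl _) pF bF.
have clb : c \notin ln p b by apply: contra cF; exact: subsetP.
have ab := off_neq ap bl; have ac := off_neq ap cla; have bc := off_neq bp clb.
have b'l := aligned_off pa pb bl; have c'la := aligned_off pa pc cla; have c'lb := aligned_off pb pc clb.
have a'b' := off_neq a'p b'l; have a'c' := off_neq a'p c'la; have b'c' := off_neq b'p c'lb.
(* For a = a' the two triangles coincide; the planes used below would then not be distinct. *)
have [Eaa|aa'] := eqVneq a a'.
  subst a'; have -> : b' = b.
    apply/esym/(@par_uniq a b) => //; rewrite ?in_line2 -?Eb ?in_line2 //.
    by rewrite Eb -(offC ap bp).
  have -> // : c' = c.
  apply/esym/(@par_uniq a c) => //; rewrite ?in_line2 -?Ec ?in_line2 //.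
  by rewrite Ec -(offC ap cp).
pose X := cl (c |: ln a b); pose Y := cl (c' |: ln a' b').
pose G := cl (c |: F); have sFG : F \subset G by apply: subset_trans (sub_cl _); exact: subsetUr.
have rG : r G = 4 by rewrite /G flat_rank1 ?flat_cl // rF.
have a'F : a' \in F by apply: (subsetP sF); rewrite -Ea in_line2.
have b'F : b' \in F by apply: (subsetP lbF); rewrite -Eb in_line2.
have c'F : c' \notin F.
  apply: contra cF => c'F; apply: (subsetP (line_sub (flat_cl _) pF c'F)).
  by rewrite Ec in_line2.
have cG : c \in G := mem_cl (setU11 _ _).
have c'G : c' \in G.
  apply: (subsetP (line_sub (flat_cl _) (subsetP sFG _ pF) cG)).
  by rewrite -Ec in_line2.
have lab : ln a b \subset F := line_sub (flat_cl _) aF bF.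
have lab' : ln a' b' \subset F := line_sub (flat_cl _) a'F b'F.
have rX : r X = 3.
  by rewrite /X flat_rank1 ?flat_cl ?rank_line //; apply: contra cF; exact: subsetP.
have rY : r Y = 3.
  by rewrite /Y flat_rank1 ?flat_cl ?rank_line //; apply: contra c'F; exact: subsetP.
have sXG : X \subset G.
  by apply: cl_min (flat_cl _) _; rewrite subUset sub1set cG (subset_trans lab).
have sYG : Y \subset G.
  by apply: cl_min (flat_cl _) _; rewrite subUset sub1set c'G (subset_trans lab').
have sabX : ln a b \subset X := plane_line a b c.
have sabY : ln a' b' \subset Y := plane_line a' b' c'.
have cX : c \in X := plane_pt a b c; have c'Y : c' \in Y := plane_pt a' b' c'.
have [aX bX] := (subsetP sabX _ (in_line1 a b), subsetP sabX _ (in_line2 a b)).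
have [a'Y b'Y] := (subsetP sabY _ (in_line1 a' b'), subsetP sabY _ (in_line2 a' b')).
(* If the planes were equal, they would contain the line aa', hence p, hence the whole flat G of
   rank 4. *)
have nXY : ~~ (X \subset Y).
  apply/negP => sXY; have EXY : X = Y by apply: flat_eq => //; rewrite ?flat_cl ?rX ?rY.
  have pX : p \in X.
    have a'X : a' \in X by rewrite EXY.
    apply: (subsetP (line_sub (flat_cl _) aX a'X)).
    by apply: (line_exchange sM); rewrite 1?eq_sym // lineC -Ea in_line2.
  have : G \subset X.
    apply: cl_min (flat_cl _) _; rewrite subUset sub1set cX /=.
    apply: cl_min (flat_cl _) _; rewrite subUset sub1set bX /=.
    exact: line_sub (flat_cl _) pX aX.
  by move/rank_setS; rewrite rG rX.
have fXY : flat (X :&: Y) by apply: flatI; exact: flat_cl.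
have rXY : r (X :&: Y) = 2.
  apply/eqP; rewrite eqn_leq; apply/andP; split.
    rewrite -ltnS -rX; apply: flat_rankS => //; rewrite properE subsetIl /=.
    by apply: contra nXY; rewrite subsetI => /andP[].
  have := mM (flat_cl _ : flat X) (flat_cl _ : flat Y); rewrite rX rY.
  have := rank_setS (_ : X :|: Y \subset G); rewrite subUset sXG sYG rG => /(_ isT).
  by clear; lia.
have dXY u v u' v' : u \notin H -> u' \notin H -> u != v -> u' != v' -> dir u v = dir u' v' ->
    u \in X -> v \in X -> u' \in Y -> v' \in Y -> dir u v \in X :&: Y.
  move=> uH u'H uv u'v' E uX vX u'Y v'Y; rewrite inE.
  rewrite (subsetP (line_sub (flat_cl _) uX vX) _ (dir_line uH uv)) E.
  exact: (subsetP (line_sub (flat_cl _) u'Y v'Y) _ (dir_line u'H u'v')).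
have d1 := dXY _ _ _ _ aH a'H ab a'b' Eab aX bX a'Y b'Y.
have d2 := dXY _ _ _ _ aH a'H ac a'c' Eac aX cX a'Y c'Y.
have d12 : dir a b != dir a c.
  apply: contraNneq cF => E; apply: (subsetP lab).
  by rewrite (line_of_dir aH ab ac E) in_line2.
have sXYH : X :&: Y \subset H.
  by rewrite -(flat_lineE sM fXY rXY d12 d1 d2) line_sub ?dir_inH.
have pb_neq : p != b by rewrite eq_sym.
have [q q1 q2] : exists2 q, q \in ln b c & q \in ln b' c'.
  have rK : r (cl (c |: ln p b)) <= 3 by rewrite rank_plane.
  have sK := plane_line p b c; have cK := plane_pt p b c.
  have pK := subsetP sK _ (in_line1 p b).
  have c'K := subsetP (line_sub (flat_cl _) pK cK).
  apply: (coplanar_lines_meet sM mM bc b'c' rK (flat_cl _)) => //.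
  - exact: (subsetP sK _ (in_line2 p b)).
  - by apply: (subsetP sK); rewrite -Eb in_line2.
  - by apply: c'K; rewrite -Ec in_line2.
have qH : q \in H.
  apply: (subsetP sXYH); rewrite inE (subsetP (line_sub (flat_cl _) bX cX) _ q1).
  exact: (subsetP (line_sub (flat_cl _) b'Y c'Y) _ q2).
by rewrite (dir_uniq bH bc qH q1) (dir_uniq b'H b'c' qH q2).
Qed.

(** If a, b, c and p are coplanar, take e outside their plane, with image e' built from a and a'.
    The spatial case applies to a, b, e and to a, c, e, and then to e, b, c. *)
Lemma desargues a a' b b' c c' : aligned a a' -> aligned b b' -> aligned c c' ->
  b \notin ln p a -> c \notin ln p a -> c \notin ln p b ->
  dir a b = dir a' b' -> dir a c = dir a' c' -> dir b c = dir b' c'.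
Proof.
move=> pa pb pc bl cla clb Eab Eac.
have [aH ap a'H a'p Ea] := alignedP pa; have [bH bp b'H b'p Eb] := alignedP pb.
have [cH cp c'H c'p Ec] := alignedP pc.
pose F := cl (b |: ln p a); have sF : ln p a \subset F := plane_line p a b.
have [cF|cF] := boolP (c \in F); last exact: desargues3 pa pb pc bl cF Eab Eac.
have pF : p \in F := subsetP sF _ (in_line1 p a).
have aF : a \in F := subsetP sF _ (in_line2 p a).
have bF : b \in F := plane_pt p a b.
have pa_neq : p != a by rewrite eq_sym.
have pb_neq : p != b by rewrite eq_sym.
have rF : r F = 3 := rank_plane pa_neq bl.
have [e eF eH] := affine_point_outside (flat_cl _ : flat F) (eq_leq rF) aH aF.
have ep : e != p by apply: contraNneq eF => ->.
have eoff x : x \in F -> e \notin ln p x.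
  by move=> xF; apply: contra eF; apply: subsetP; exact: line_sub (flat_cl _) pF xF.
have [|e' pe Eae] := par_exists pa (_ : affine_pt e) (eoff a aF); first by rewrite /affine_pt eH.
have plE x y : x != p -> x \in F -> y \in F -> y \notin ln p x -> cl (y |: ln p x) = F.
  move=> xp xF yF yl; apply: flat_eq; first exact: flat_cl.
    by apply: cl_min (flat_cl _) _; rewrite subUset sub1set yF line_sub ?flat_cl.
  by rewrite rF rank_plane // eq_sym.
have Ebe : dir b e = dir b' e' by apply: (desargues3 pa pb pe bl eF Eab); rewrite Eae.
have Ece : dir c e = dir c' e'.
  by apply: (desargues3 pa pc pe cla _ Eac); rewrite ?plE // Eae.
have [eH' _ e'H _ _] := alignedP pe.
have eb : e != b by apply: contraNneq eF => ->.
have ec : e != c by apply: contraNneq eF => ->.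
have ob : b \notin ln p e by rewrite (offC ep bp) eoff.
have oc : c \notin ln p e by rewrite (offC ep cp) eoff.
have neq x x' : aligned x x' -> x \notin ln p e -> e' != x'.
  by move=> px ox; have [_ _ _ e'p _] := alignedP pe; apply: off_neq (aligned_off pe px ox).
apply: (desargues3 pe pb pc ob).
- pose K := cl (b |: ln p e); apply: contra eF => cK.
  have sK := plane_line p e b; have bK := plane_pt p e b.
  have -> : F = K; last exact: (subsetP sK _ (in_line2 p e)).
  apply: flat_eq; first exact: flat_cl.
    rewrite -(plE b c bp bF cF clb); apply: cl_min (flat_cl _) _.
    rewrite subUset sub1set cK line_sub ?flat_cl //.
    exact: (subsetP sK _ (in_line1 p e)).
  by rewrite rF rank_plane // eq_sym.
- by rewrite (dirC eH bH eb) (dirC e'H b'H (neq _ _ pb ob)).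
- by rewrite (dirC eH cH ec) (dirC e'H c'H (neq _ _ pc oc)).
Qed.

Definition par a a' b : M := odflt b [pick b' | aligned b b' && (dir a' b' == dir a b)].

Lemma parP a a' b : aligned a a' -> affine_pt b -> b \notin ln p a ->
  aligned b (par a a' b) /\ dir a' (par a a' b) = dir a b.
Proof.
move=> pa bA bl; rewrite /par; case: pickP => [b' /andP[? /eqP]|] //.
by have [b' pb E] := par_exists pa bA bl; move/(_ b'); rewrite pb E eqxx.
Qed.

(** Points of the line pa are moved with the help of an auxiliary pair of c and its image; this says
    that the auxiliary pair still takes a to a'. *)
Lemma par_self a a' c : aligned a a' -> affine_pt c -> c \notin ln p a ->
  par c (par a a' c) a = a'.
Proof.
move=> pa cA cl; have [pc Ec] := parP pa cA cl.
have [aH ap a'H a'p Ea] := alignedP pa; have [cH cp c'H c'p Ec'] := alignedP pc.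
have acl : a \notin ln p c by rewrite -(offC ap cp).
have aA : affine_pt a by rewrite /affine_pt aH.
have [pa2 E] := parP pc aA acl.
have [_ _ a2H a2p Ea2] := alignedP pa2.
have c'l := aligned_off pa pc cl; have ca' : par a a' c != a'.
  by rewrite eq_sym; exact: off_neq c'l.
have ca : c != a by rewrite eq_sym; exact: off_neq cl.
apply: (@par_uniq (par a a' c) a) => //; rewrite -?Ea ?in_line2 //.
  by rewrite Ea -Ea2 in_line2.
by rewrite E (dirC cH aH ca) (dirC c'H a'H ca').
Qed.

(** All directions in the conclusion are that of one line through p. What needs proof is that x' and
    y' stay distinct: otherwise ux and uy are parallel, and u lies on px. *)
Lemma same_line_dir u u' x x' y y' : aligned u u' -> aligned x x' -> aligned y y' ->
  x \notin ln p u -> y \in ln p x -> x != y ->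
  dir u x = dir u' x' -> dir u y = dir u' y' -> x' != y' /\ dir x y = dir x' y'.
Proof.
move=> pu px py xl yl xy Ex Ey.
have [uH up u'H u'p Eu] := alignedP pu; have [xH xp x'H x'p Ex'] := alignedP px.
have [yH yp y'H y'p Ey'] := alignedP py.
have px_neq : p != x by rewrite eq_sym.
have Exy : ln p y = ln p x by apply: (line_eq sM _ (in_line1 _ _) yl); rewrite eq_sym.
have yl' : y \notin ln p u by rewrite (offC up yp) Exy -(offC up xp).
have x'y' : x' != y'.
  apply/eqP => E; case/negP: (xl); rewrite -E in Ey.
  have E1 := line_of_dir uH (off_neq up xl) (off_neq up yl') (etrans Ex (esym Ey)).
  have E2 : ln x y = ln u x by apply: (line_eq sM xy (in_line2 _ _)); rewrite E1 in_line2.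
  rewrite (offC up xp) -(line_eq sM xy (in_line2 p x) yl) E2 in_line1 //.
split=> //; apply: dir_of_line => //.
rewrite (line_eq sM xy (in_line2 p x) yl); apply/esym/(line_eq sM x'y').
  by rewrite -Ex' in_line2.
by rewrite -Exy -Ey' in_line2.
Qed.

(** Off the line pa the image of x is obtained from a and a' by [par]; on that line, from a pair c
    and c' with c off it. Distinct lines through p are compared by [desargues], and one line by
    [same_line_dir]. The point d outside the plane pac serves where c does not. *)
Lemma central_dilatation a a' : aligned a a' -> exists s : M -> M,
  [/\ s a = a', s p = p, forall x, affine_pt x -> aligned x (s x)
    & forall x y, affine_pt x -> affine_pt y -> x != y ->
        s x != s y /\ dir x y = dir (s x) (s y)].
Proof.
move=> pa; have [aH ap a'H a'p Ea] := alignedP pa.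
have pa_neq : p != a by rewrite eq_sym.
have [|c cla cH] := affine_point_outside (flat_cl _ : flat (ln p a)) _ aH (in_line2 _ _).
  by rewrite rank_line.
have cp : c != p by apply: contraNneq cla => ->; rewrite in_line1.
pose F := cl (c |: ln p a); have sF : ln p a \subset F := plane_line p a c.
have rF : r F = 3 := rank_plane pa_neq cla.
have [d dF dH] := affine_point_outside (flat_cl _ : flat F) (eq_leq rF) aH (subsetP sF _ (in_line2 p a)).
have pF := subsetP sF _ (in_line1 p a).
have dp : d != p by apply: contraNneq dF => ->.
have dl : d \notin ln p a by apply: contra dF; exact: subsetP.
have dlc : d \notin ln p c.
  by apply: contra dF; apply: subsetP; apply: line_sub (flat_cl _) pF (plane_pt _ _ _).
have cA : affine_pt c by rewrite /affine_pt cH.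
have dA : affine_pt d by rewrite /affine_pt dH.
have aA : affine_pt a by rewrite /affine_pt aH.
have [pc Ec] := parP pa cA cla; have [pd Ed] := parP pa dA dl.
pose c' := par a a' c; pose d' := par a a' d; rewrite -/c' in pc Ec; rewrite -/d' in pd Ed.
have [_ _ c'H c'p Ec'] := alignedP pc; have [_ _ d'H d'p Ed'] := alignedP pd.
pose s x := if x == p then p else if x \in ln p a then par c c' x else par a a' x.
have onc x : affine_pt x -> x \in ln p a -> x \notin ln p c.
  move=> /andP[xH xp] xl; rewrite (offC cp xp).
  by have -> : ln p x = ln p a by apply: (line_eq sM _ (in_line1 _ _) xl); rewrite eq_sym.
have sA x : affine_pt x -> x != p by case/andP.
have son x : affine_pt x -> x \in ln p a -> aligned x (s x) /\ dir c' (s x) = dir c x.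
  move=> xA xl; rewrite /s (negPf (sA x xA)) xl; apply: parP => //; exact: onc.
have soff x : affine_pt x -> x \notin ln p a -> aligned x (s x) /\ dir a' (s x) = dir a x.
  by move=> xA xl; rewrite /s (negPf (sA x xA)) (negPf xl); apply: parP.
have spair x : affine_pt x -> aligned x (s x).
  by move=> xA; have [/(son x xA)[]|/(soff x xA)[]] := boolP (x \in ln p a).
have Ecd : dir c d = dir c' d' by apply: (desargues pa pc pd).
have dirE x x' y y' : aligned x x' -> aligned y y' -> y \notin ln p x ->
    (dir x y = dir x' y') <-> (dir y x = dir y' x').
  move=> px py yl; have [xH xp x'H x'p _] := alignedP px; have [yH yp y'H y'p _] := alignedP py.
  rewrite (dirC xH yH (off_neq xp yl)).
  by rewrite (dirC x'H y'H (off_neq x'p (aligned_off px py yl))).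
have lE x y : affine_pt x -> y \in ln p x -> affine_pt y -> ln p y = ln p x.
  by move=> xA yl yA; apply: (line_eq sM _ (in_line1 _ _) yl); rewrite eq_sym sA.
(* x on pa and y off pa: compare along c, or along d when y lies on pc. *)
have mixed x y : affine_pt x -> affine_pt y -> x \in ln p a -> y \notin ln p a ->
    dir x y = dir (s x) (s y).
  move=> xA yA xl yl; have [px Ex] := son x xA xl; have [py Ey] := soff y yA yl.
  have lx := lE _ _ aA xl xA.
  have yx : y \notin ln p x by rewrite lx.
  have [yc|yc] := boolP (y \in ln p c).
    have xd : x \notin ln p d by rewrite offC ?sA // lx.
    have yd : y \notin ln p d by rewrite offC ?sA // (lE _ _ cA yc yA).
    apply: (desargues pd px py xd yd yx).
      by apply: (desargues pc pd px) => //; rewrite ?onc.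
    by apply: (desargues pa pd py).
  apply: (desargues pc px py (onc x xA xl) yc yx) => //.
  by apply: (desargues pa pc py).
have soffs x y : affine_pt x -> affine_pt y -> y \notin ln p x -> dir x y = dir (s x) (s y).
  move=> xA yA yx; have xy : x \notin ln p y by rewrite -offC ?sA.
  have [xl|xl] := boolP (x \in ln p a).
    by apply: mixed => //; rewrite -(lE _ _ aA xl xA).
  have [yl|yl] := boolP (y \in ln p a).
    by apply/(dirE _ _ _ _ (spair x xA) (spair y yA) yx); exact: mixed.
  have [px Ex] := soff x xA xl; have [py Ey] := soff y yA yl.
  exact: (desargues pa px py).
exists s; split=> //.
- have -> : s a = par c c' a by rewrite /s (negPf ap) in_line2.
  exact: par_self.
- by rewrite /s eqxx.
- move=> x y xA yA xy; have [yx|yx] := boolP (y \in ln p x); last first.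
    split; last exact: soffs.
    have [_ _ _ sxp _] := alignedP (spair x xA).
    exact: off_neq sxp (aligned_off (spair x xA) (spair y yA) yx).
  have [xl|xl] := boolP (x \in ln p a).
    apply: (same_line_dir pc (spair x xA) (spair y yA)) => //; first exact: onc.
      by have [_ ->] := son x xA xl.
    have yl : y \in ln p a by rewrite -(lE _ _ aA xl xA).
    by have [_ ->] := son y yA yl.
  apply: (same_line_dir pa (spair x xA) (spair y yA)) => //.
    by have [_ ->] := soff x xA xl.
  have yl : y \notin ln p a by rewrite offC ?sA // (lE _ _ xA yx yA) -offC ?sA.
  by have [_ ->] := soff y yA yl.
Qed.

End Center.
End Dilatations.

(** * Coordinates on translation planes and spaces *)

Import GRing.Theory.

Section FiniteModule.
Variables (F : finFieldType) (V : finLmodType F).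
Local Open Scope ring_scope.

Definition combination n (t : 'I_n -> V) (u : 'rV[F]_n) : V := \sum_i u 0 i *: t i.

Lemma combinationP n (t : 'I_n -> V) a u v :
  combination t (a *: u + v) = a *: combination t u + combination t v.
Proof.
rewrite /combination scaler_sumr -big_split; apply: eq_bigr => i _.
by rewrite !mxE scalerDl scalerA.
Qed.

Definition free_family n (t : 'I_n -> V) := forall u, combination t u = 0 -> u = 0.

Lemma free_family_inj n (t : 'I_n -> V) : free_family t -> injective (combination t).
Proof.
move=> ft u v E; apply/eqP; rewrite -subr_eq0; apply/eqP/ft.
by rewrite addrC -scaleN1r combinationP E scaleN1r addNr.
Qed.

Lemma free_family_extend n (t : 'I_n -> V) v : free_family t ->
  (forall u, combination t u != v) ->
  free_family (fun i : 'I_n.+1 => if unlift ord0 i is Some j then t j else v).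
Proof.
move=> ft nv u; rewrite /combination big_ord_recl unlift_none.
under eq_bigr do rewrite liftK.
have -> : \sum_(i < n) u 0 (lift ord0 i) *: t i = combination t (\row_j u 0 (lift ord0 j)).
  by apply: eq_bigr => i _; rewrite mxE.
set w := \row_j _ => E; have u0 : u 0 0 = 0.
  (* With a nonzero coefficient, v would be a combination of t; the [+ 0] gives the witness the
     shape required by [combinationP]. *)
  apply/eqP; apply: contraT => u0; have /eqP := nv ((- (u 0 0)^-1) *: w + 0); case.
  rewrite combinationP [combination t 0]big1 ?addr0; last by move=> i _; rewrite mxE scale0r.
  have -> : combination t w = - (u 0 0 *: v) by apply/eqP; rewrite -addr_eq0 addrC E.
  by rewrite scalerN scaleNr opprK scalerA mulVf // scale1r.
have w0 : w = 0 by apply: ft; rewrite u0 scale0r add0r in E.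
apply/rowP => i; rewrite mxE; have [j ->|->] := unliftP ord0 i; last exact: u0.
by have /rowP/(_ j) := w0; rewrite !mxE.
Qed.

(** A free family that cannot be extended spans. Extension stops because a free family of n vectors
    embeds F^n in V and n < #|F|^n; in [H], k bounds the number of extensions still possible. *)
Lemma finite_module_coordinates : exists n (t : 'I_n -> V), bijective (combination t).
Proof.
have nbound n (t : 'I_n -> V) : free_family t -> (n <= #|V|)%N.
  move/free_family_inj/leq_card; rewrite card_mx mul1n; apply: leq_trans.
  by apply: ltnW; apply: ltn_expl; exact: finNzRing_gt1.
have step n (t : 'I_n -> V) : free_family t ->
    bijective (combination t) \/ exists t' : 'I_n.+1 -> V, free_family t'.
  move=> ft; have [/forallP sur|/forallPn[v nv]] := boolP [forall v, [exists u, combination t u == v]].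
    left; apply: inj_card_bij; first exact: free_family_inj.
    apply: (@leq_card _ _ (fun v => xchoose (existsP (sur v)))).
    apply: (can_inj (g := combination t)) => v; exact/eqP/(xchooseP (existsP (sur v))).
  right; eexists; apply: (@free_family_extend n t v) => // u.
  by apply: contra nv => E; apply/existsP; exists u.
have [m] := ubnP #|V|; suff H k n (t : 'I_n -> V) : (#|V| < n + k)%N -> free_family t ->
    exists n (t : 'I_n -> V), bijective (combination t).
  move=> lt; apply: (H m.+1 0%N (fun _ => 0)); first by rewrite add0n; apply: leq_trans lt _.
  by move=> u _; apply/rowP; case.
elim: k n t => [|k IHk] n t lt ft.
  by have := nbound n t ft; rewrite leqNgt -[n in (_ < n)%N]addn0 lt.
have [|[t' ft']] := step n t ft; first by exists n, t.
by apply: (IHk n.+1 t') => //; rewrite addSnnS.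
Qed.

End FiniteModule.

(** * The field of direction-preserving endomorphisms *)

Section DirectionField.
Variables (V : finZmodType) (D : eqType) (d : V -> D).
Local Open Scope ring_scope.
Implicit Types (s t u v w x y : V).
Hypothesis dN : forall v, v != 0 -> d (- v) = d v.
Hypothesis dB : forall u v, u != 0 -> v != 0 -> d u = d v -> u - v != 0 -> d (u - v) = d u.
Hypothesis two_dirs : exists u v, [/\ u != 0, v != 0 & d u != d v].

(** Directions are compared only where the image is nonzero, so that 0 qualifies. This is the kernel
    of a translation plane, in any dimension. *)
Definition dir_preserving (f : {ffun V -> V}) :=
  [forall x, forall y, f (x - y) == f x - f y] &&
  [forall x, (x != 0) && (f x != 0) ==> (d (f x) == d x)].

Lemma dir_preservingP (f : {ffun V -> V}) : reflect
  ((forall x y, f (x - y) = f x - f y) /\ forall x, x != 0 -> f x != 0 -> d (f x) = d x)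
  (dir_preserving f).
Proof.
apply: (iffP andP) => -[fB fd]; split.
- by move=> x y; have /forallP/(_ x)/forallP/(_ y)/eqP := fB.
- by move=> x x0 fx0; have /forallP/(_ x) := fd; rewrite x0 fx0 => /eqP.
- by apply/forallP => x; apply/forallP => y; apply/eqP.
- by apply/forallP => x; apply/implyP => /andP[x0 fx0]; apply/eqP/fd.
Qed.

Lemma dir_preserving_zmod : zmod_closed dir_preserving.
Proof.
split=> [|f g /dir_preservingP[fB fd] /dir_preservingP[gB gd]]; apply/dir_preservingP.
  by split=> [x y|x _]; rewrite !ffunE ?subr0 // eqxx.
split=> [x y|x x0]; rewrite !ffunE.
  by rewrite fB gB !opprD !opprK addrACA.
have [->|f0] := eqVneq (f x) 0.
  have [->|g0] := eqVneq (g x) 0; first by rewrite subr0 eqxx.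
  by rewrite sub0r => _; rewrite dN // gd.
have [->|g0] := eqVneq (g x) 0; first by rewrite subr0 => _; rewrite fd.
by move=> fg; rewrite dB ?fd ?gd.
Qed.

HB.instance Definition _ := GRing.isZmodClosed.Build _ dir_preserving dir_preserving_zmod.

Record dir_end := DirEnd { end_fun :> {ffun V -> V}; _ : dir_preserving end_fun }.
HB.instance Definition _ := [isSub for end_fun].
HB.instance Definition _ := [Finite of dir_end by <:].
HB.instance Definition _ := [SubChoice_isSubZmodule of dir_end by <:].

Implicit Types f g h : dir_end.

Lemma dir_endB f x y : f (x - y) = f x - f y.
Proof. have /dir_preservingP[fB _] := valP f; exact: fB. Qed.

Lemma dir_end0 f : f 0 = 0.
Proof. by rewrite -[X in f X](subrr 0) dir_endB subrr. Qed.

Lemma dir_endN f x : f (- x) = - f x.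
Proof. by rewrite -[in LHS](sub0r x) dir_endB dir_end0 sub0r. Qed.

Lemma dir_endD f x y : f (x + y) = f x + f y.
Proof. by rewrite -[in LHS](opprK y) dir_endB dir_endN opprK. Qed.

Lemma dir_endP f x : x != 0 -> f x != 0 -> d (f x) = d x.
Proof. have /dir_preservingP[_ fd] := valP f; exact: fd. Qed.

Lemma dir_end_ext f g : (forall x, f x = g x) -> f = g.
Proof. by move=> E; apply/val_inj/ffunP. Qed.

Lemma dir_end_eq0 f : (f == 0) = [forall x, f x == 0].
Proof.
apply/eqP/forallP => [-> x|f0]; first by rewrite ffunE.
by apply: dir_end_ext => x; rewrite ffunE; apply/eqP.
Qed.

Lemma one_subproof : dir_preserving [ffun x => x].
Proof. by apply/dir_preservingP; split=> [x y|x]; rewrite !ffunE. Qed.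

Lemma mul_subproof f g : dir_preserving [ffun x => f (g x)].
Proof.
apply/dir_preservingP; split=> [x y|x x0]; rewrite !ffunE ?dir_endB // => fg0.
have g0 : g x != 0 by apply: contraNneq fg0 => ->; rewrite dir_end0.
by rewrite !dir_endP.
Qed.

Definition end_one := DirEnd one_subproof.
Definition end_mul f g := DirEnd (mul_subproof f g).

Let end_mulA : associative end_mul.
Proof. by move=> f g h; apply: dir_end_ext => x; rewrite !ffunE. Qed.
Let end_mul1 : left_id end_one end_mul.
Proof. by move=> f; apply: dir_end_ext => x; rewrite !ffunE. Qed.
Let end_1mul : right_id end_one end_mul.
Proof. by move=> f; apply: dir_end_ext => x; rewrite !ffunE. Qed.
Let end_mulDl : left_distributive end_mul +%R.
Proof. by move=> f g h; apply: dir_end_ext => x; rewrite !ffunE. Qed.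
Let end_mulDr : right_distributive end_mul +%R.
Proof. by move=> f g h; apply: dir_end_ext => x; rewrite !ffunE dir_endD. Qed.
Let end_1neq0 : end_one != 0.
Proof.
have [u [_ [u0 _ _]]] := two_dirs.
by rewrite dir_end_eq0; apply/forallPn; exists u; rewrite ffunE.
Qed.

HB.instance Definition _ := GRing.Zmodule_isNzRing.Build dir_end
  end_mulA end_mul1 end_1mul end_mulDl end_mulDr end_1neq0.
HB.instance Definition _ := FinRing.isNzRing.Build dir_end.

(* If f t = 0 with t <> 0 and s has another direction, then f s = f (s + t)
   would have both the directions of s and of s + t. *)
Lemma dir_end_inj f x : f != 0 -> f x = 0 -> x = 0.
Proof.
move=> f0 fx; apply/eqP/contraT => x0; case/negP: f0; rewrite dir_end_eq0.
have off t s : t != 0 -> f t = 0 -> s != 0 -> d s != d t -> f s = 0.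
  move=> t0 ft s0 st; apply/eqP/contraT => fs.
  have st0 : s + t != 0.
    by apply: contraNneq st => /eqP; rewrite addr_eq0 => /eqP ->; rewrite dN.
  have fst : f (s + t) = f s by rewrite dir_endD ft addr0.
  have E : d s = d (s + t) by rewrite -(dir_endP (f := f) st0) fst ?dir_endP.
  have := dB st0 s0 (esym E); rewrite addrAC subrr add0r => /(_ t0) Et.
  by case/negP: st; rewrite E Et.
have [s s0 sx] : exists2 s, s != 0 & d s != d x.
  have [u [v [u0 v0 uv]]] := two_dirs; have [E|] := eqVneq (d u) (d x); last by exists u.
  by exists v; rewrite // -E eq_sym.
have fs := off x s x0 fx s0 sx.
apply/forallP => w; have [->|w0] := eqVneq w 0; first by rewrite dir_end0.
have [E|wx] := eqVneq (d w) (d x); last by rewrite (off x w).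
by rewrite (off s w) // E eq_sym.
Qed.

Lemma dir_end_domain : GRing.integral_domain_axiom dir_end.
Proof.
move=> f g fg; have [//|f0 /=] := eqVneq f 0.
rewrite dir_end_eq0; apply/forallP => x; apply/eqP/(dir_end_inj f0).
by have := congr1 (fun h : dir_end => h x) fg; rewrite !ffunE.
Qed.

Hypothesis homothety : forall u v, u != 0 -> v != 0 -> d u = d v -> exists f : V -> V,
  [/\ f u = v, {morph f : x y / x - y} & forall x, x != 0 -> f x != 0 -> d (f x) = d x].

(** V is a vector space over its direction-preserving endomorphisms. Scalars preserve directions by
    definition, and [homothety] provides a scalar between any two nonzero vectors of the same
    direction. *)
Theorem direction_coordinates : exists (F : finFieldType) (n : nat) (c : V -> 'rV[F]_n),
  [/\ bijective c, {morph c : x y / x - y}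
    & forall u v, u != 0 -> v != 0 -> (d u = d v <-> exists k, c v = k *: c u)].
Proof.
(* Wedderburn's theorem: a finite domain is a field, commutativity included. *)
pose F : finFieldType := FinDomainFieldType dir_end_domain.
pose act (k : F) (v : V) : V := (k : dir_end) v.
have actA (k l : F) v : act k (act l v) = act (k * l) v by rewrite /act !ffunE.
have act1 : left_id 1 act by move=> v; rewrite /act ffunE.
have actDr : right_distributive act +%R by move=> k u v; rewrite /act dir_endD.
have actDl v : {morph act^~ v : k l / k + l} by move=> k l; rewrite /act !ffunE.
pose W : finLmodType F := HB.pack V (GRing.Zmodule_isLmodule.Build F V actA act1 actDr actDl).
have [n [t [c cK tK]]] := finite_module_coordinates W.
have ZE (k : F) (v : W) : k *: v = act k v by [].
have cP a (u v : W) : c (a *: u + v) = a *: c u + c v.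
  by apply: (can_inj cK); rewrite combinationP !tK.
exists F, n, c; split; first by exists (combination t).
  move=> x y; have /= := cP (-1) (y : W) (x : W).
  by rewrite !scaleN1r ![- _ + _]addrC.
have cZ a (u : W) : c (a *: u) = a *: c u.
  have c0 : c 0 = 0 by apply: (can_inj cK); rewrite tK /combination big1 // => i _; rewrite mxE scale0r.
  by have := cP a u 0; rewrite addr0 c0 addr0.
move=> u v u0 v0; split=> [E|[k]].
  have [f [fu fB fd]] := homothety u0 v0 E.
  have fP : dir_preserving [ffun x => f x].
    by apply/dir_preservingP; split=> [x y|x]; rewrite !ffunE //; exact: fd.
  exists (DirEnd fP : F); rewrite -cZ; congr c.
  by rewrite ZE /act /= ffunE fu.
rewrite -cZ => /(can_inj tK) E; rewrite E ZE /act dir_endP //.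
by have := v0; rewrite E.
Qed.

End DirectionField.

(** * Dilatations and translations of an affine space given by its directions *)

Section Translations.
Variables (A D : finType) (dir : A -> A -> D) (o : A).
Local Open Scope group_scope.
Implicit Types (a b q x y z : A) (s t u : {perm A}) (d : D).

Definition dilation (s : A -> A) := forall x y, x != y -> s x != s y /\ dir x y = dir (s x) (s y).
(** The value of [dir x x] is arbitrary, hence the separate case [y == x]. *)
Definition on_line x d y := (y == x) || (dir x y == d).

Hypothesis dirC : forall x y, x != y -> dir x y = dir y x.
Hypothesis dir_trans : forall x y z, x != y -> x != z -> y != z ->
  dir x y = dir x z -> dir y z = dir x y.
Hypothesis dir_ex : forall x d, exists2 y, x != y & dir x y = d.
Hypothesis two_dirs : exists d d', d != d'.
Hypothesis dir_meet : forall a b a' b', a != b -> dir a b = dir a' b' -> a != a' -> b != b' ->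
  dir a a' != dir b b' -> exists2 q, on_line a (dir a a') q & on_line b (dir b b') q.
Hypothesis translation_ex : forall a b, a != b -> exists s : A -> A,
  [/\ s a = b, dilation s & forall x, on_line x (dir a b) (s x)].
Hypothesis homothety_ex : forall x a b, x != a -> x != b -> dir x a = dir x b ->
  exists s : A -> A, [/\ s x = x, s a = b & dilation s].

Lemma on_line_dir x d y z : on_line x d y -> on_line x d z -> y != z -> dir y z = d.
Proof.
move=> /orP[/eqP -> |/eqP Ey] /orP[/eqP -> |/eqP Ez] yz //.
- by rewrite eqxx in yz.
- by rewrite dirC.
have [xy|xy] := eqVneq x y; first by rewrite -xy.
have [xz|xz] := eqVneq x z; first by rewrite -xz dirC // eq_sym.
by rewrite (dir_trans xy xz yz) ?Ey.
Qed.

Lemma on_line_trans x d y z : on_line x d y -> on_line y d z -> on_line x d z.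
Proof.
move=> xy yz; have yx : on_line y d x.
  rewrite /on_line; case: eqVneq => //= xy'; have yx : y != x by rewrite eq_sym.
  by rewrite dirC //; move: xy; rewrite /on_line (negPf yx).
rewrite /on_line; case: eqVneq => //= zx; apply/eqP.
by rewrite eq_sym in zx; exact: on_line_dir yx yz zx.
Qed.

Lemma on_line_meet x y d d' z z' : d != d' -> on_line x d z -> on_line x d z' ->
  on_line y d' z -> on_line y d' z' -> z = z'.
Proof.
move=> dd' xz xz' yz yz'; apply/eqP/contraT => zz; case/negP: dd'.
by rewrite -(on_line_dir xz xz' zz) (on_line_dir yz yz' zz).
Qed.

Lemma on_line_refl x d : on_line x d x.
Proof. by rewrite /on_line eqxx. Qed.

Lemma on_line_self x y : on_line x (dir x y) y.
Proof. by rewrite /on_line eqxx orbT. Qed.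

Definition dil s := [forall x, forall y, (x != y) ==> (dir x y == dir (s x) (s y))].

Lemma dilP s : reflect (forall x y, x != y -> dir x y = dir (s x) (s y)) (dil s).
Proof.
apply: (iffP forallP) => [ds x y xy|ds x].
  by have /forallP/(_ y) := ds x; rewrite xy => /eqP.
by apply/forallP => y; apply/implyP => xy; apply/eqP/ds.
Qed.

Lemma dilM s t : dil s -> dil t -> dil (s * t).
Proof.
move=> /dilP ds /dilP dt; apply/dilP => x y xy.
by rewrite !permM -dt ?(inj_eq perm_inj) // ds.
Qed.

Lemma dilV s : dil s -> dil s^-1.
Proof.
move=> /dilP ds; apply/dilP => x y xy.
by rewrite [RHS]ds ?permKV // (inj_eq perm_inj).
Qed.

Lemma dil_perm (f : A -> A) : dilation f -> exists2 s, dil s & s =1 f.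
Proof.
move=> df; have fI : injective f.
  by move=> x y E; apply/eqP/contraT => /df[]; rewrite E eqxx.
by exists (perm fI); [apply/dilP => x y /df[_]; rewrite !permE | exact: permE].
Qed.

(** A point off the line xy is the intersection of two fixed lines, hence fixed. For a point of the
    line xy, the same argument is repeated with a fixed point w off that line. *)
Lemma dil_fix2 s x y : dil s -> x != y -> s x = x -> s y = y -> s = 1.
Proof.
move=> /dilP ds; have off z w v : w != z -> w != v -> dir w z != dir w v -> z != v ->
    s w = w -> s v = v -> s z = z.
  move=> wz wv nd zv sw sv; have szw : s w != s z by rewrite (inj_eq perm_inj).
  have szv : s v != s z by rewrite (inj_eq perm_inj) eq_sym.
  have vz : v != z by rewrite eq_sym.
  have dn : dir w z != dir v z.
    apply: contraNneq nd => E; have zw : z != w by rewrite eq_sym.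
    rewrite (dirC wz) -(dir_trans zw zv wv) 1?dirC 1?(eq_sym z) // 1?(dirC (x := z)) ?E //.
  apply/esym/(@on_line_meet w v (dir w z) (dir v z)) => //; rewrite ?on_line_self //.
    by have := ds w z wz; rewrite sw => ->; exact: on_line_self.
  by have := ds v z vz; rewrite sv => ->; exact: on_line_self.
move=> xy sx sy; apply/permP => z; rewrite perm1.
have [<-//|xz] := eqVneq x z; have [->//|zy] := eqVneq z y.
have [E|nd] := eqVneq (dir x z) (dir x y); last exact: (off z x y).
have [d nd] : exists d, d != dir x y.
  by have [d [d' dd']] := two_dirs; have [Ed|] := eqVneq d (dir x y); [exists d'; rewrite -Ed eq_sym | exists d].
have [w xw Ew] := dir_ex x d.
have wy : w != y by apply: contraNneq nd => <-; rewrite Ew.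
have wz : w != z by apply: contraNneq nd => Ez; rewrite -Ew Ez E.
have sw : s w = w by apply: (off w x y); rewrite ?Ew.
by apply: (off z x w) => //; [rewrite E Ew eq_sym | rewrite eq_sym].
Qed.

Definition translation s := dil s && ((s == 1) || [forall x, s x != x]).

Lemma translationP s x : translation s -> s != 1 -> s x != x.
Proof. by case/andP => _ /orP[/eqP -> /eqP //|/forallP]. Qed.

(* If the lines x (s x) and y (s y) had different directions, then their
   intersection would be a fixed point of s. *)
Lemma translation_dir s x y : translation s -> s != 1 -> dir x (s x) = dir y (s y).
Proof.
move=> ts s1; have /andP[/dilP ds _] := ts.
have nx z : z != s z by rewrite eq_sym translationP.
have [->//|xy] := eqVneq x y.
apply/eqP/contraT => nd; have [q qx qy] := dir_meet xy (ds _ _ xy) (nx x) (nx y) nd.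
have inv z : on_line z (dir z (s z)) q -> on_line z (dir z (s z)) (s q).
  move=> zq; apply: on_line_trans (on_line_self z (s z)) _.
  move: zq => /orP[/eqP ->|/eqP Ez]; first exact: on_line_refl.
  have [->|zq] := eqVneq z q; first exact: on_line_refl.
  by rewrite -{1}Ez ds // on_line_self.
by have := nx q; rewrite {1}(on_line_meet nd qx (inv x qx) qy (inv y qy)) eqxx.
Qed.

Lemma translation1 : translation 1.
Proof. by rewrite /translation eqxx andbT; apply/dilP => x y _; rewrite !perm1. Qed.

Lemma translationV s : translation s -> translation s^-1.
Proof.
case/andP => ds /orP[/eqP ->|/forallP nx]; first by rewrite invg1 translation1.
rewrite /translation dilV //; apply/orP; right; apply/forallP => x.
by rewrite -(inj_eq (@perm_inj _ s)) permKV eq_sym.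
Qed.

(** Take y in a direction other than that of s. Its image is the intersection of the line through y
    in the direction of s with the parallel to xy through [s x], and likewise for t. So s and t
    agree at two points. *)
Lemma translation_eq s t x : translation s -> translation t -> s x = t x -> s = t.
Proof.
move=> ts tt E; have [s1|s1] := eqVneq s 1.
  apply/eqP; rewrite s1 eq_sym; apply/contraT => t1.
  by have := translationP x tt t1; rewrite -E s1 perm1 eqxx.
have sx := translationP x ts s1; have t1 : t != 1.
  by apply: contraNneq sx => t1; rewrite E t1 perm1.
have [/andP[ds _] /andP[dt _]] := (ts, tt).
have [d nd] : exists d, d != dir x (s x).
  have [d [d' dd']] := two_dirs; have [Ed|] := eqVneq d (dir x (s x)); last by exists d.
  by exists d'; rewrite -Ed eq_sym.
have [y xy Ey] := dir_ex x d.
have Esy : s y = t y.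
  apply: (@on_line_meet y (s x) (dir x (s x)) d); rewrite 1?eq_sym //.
  - by rewrite (translation_dir x y ts s1) on_line_self.
  - by rewrite E (translation_dir x y tt t1) on_line_self.
  - by rewrite -Ey (dilP _ ds _ _ xy) on_line_self.
  - by rewrite E -Ey (dilP _ dt _ _ xy) on_line_self.
apply/eqP; rewrite eq_mulgV1; apply/eqP; apply: (dil_fix2 (x := x) (y := y)) => //.
- exact: dilM (dilV dt).
- by rewrite permM E permK.
- by rewrite permM Esy permK.
Qed.

Lemma translationM s t : translation s -> translation t -> translation (s * t).
Proof.
move=> ts tt; have [/andP[ds _] /andP[dt _]] := (ts, tt).
rewrite /translation dilM // andTb; case: eqVneq => //= st1; apply/forallP => x.
apply: contra st1 => /eqP; rewrite permM => E.
have -> : s = t^-1 by apply: (translation_eq ts (translationV tt) (x := x)); rewrite -[in RHS]E permK.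
by rewrite mulVg.
Qed.

(** The map supplied moves points only in the direction of ab. If x were fixed, so would be any y
    joined to x in another direction, and the map would be the identity. *)
Lemma translation_exists a b : exists2 t, translation t & t a = b.
Proof.
have [->|ab] := eqVneq a b; first by exists 1; [exact: translation1 | rewrite perm1].
have [f [fa df lf]] := translation_ex ab; have [s ds sf] := dil_perm df.
exists s; last by rewrite sf.
rewrite /translation ds; apply/orP; right; apply/forallP => x; apply: contraTneq isT => sx.
have sa : s a != a by rewrite sf fa eq_sym.
have [d nd] : exists d, d != dir a b.
  have [d [d' dd']] := two_dirs; have [Ed|] := eqVneq d (dir a b); last by exists d.
  by exists d'; rewrite -Ed eq_sym.
have [y xy Ey] := dir_ex x d; have sy : s y = y.
  apply: (@on_line_meet y x (dir a b) d); rewrite 1?eq_sym ?on_line_refl //.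
  - by rewrite sf.
  - by rewrite -Ey (dilP _ ds _ _ xy) sx on_line_self.
  - by rewrite -Ey on_line_self.
by have := dil_fix2 ds xy sx sy; move: sa => /[swap] ->; rewrite perm1 eqxx.
Qed.

(** Both products send x to the fourth vertex of the parallelogram on x, [s x] and [t x]. *)
Lemma translation_commute_dir s t x : translation s -> translation t -> s != 1 -> t != 1 ->
  dir x (s x) != dir x (t x) -> s * t = t * s.
Proof.
move=> ts tt s1 t1 nd; have [/andP[/dilP ds _] /andP[/dilP dt _]] := (ts, tt).
have nx u z : translation u -> u != 1 -> z != u z by move=> tu u1; rewrite eq_sym translationP.
apply: (@translation_eq _ _ x); rewrite ?translationM // !permM.
apply: (@on_line_meet (s x) (t x) (dir x (t x)) (dir x (s x))); rewrite 1?eq_sym //.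
- by rewrite (translation_dir x (s x) tt t1) on_line_self.
- by rewrite (ds x (t x)) ?nx // on_line_self.
- by rewrite (dt x (s x)) ?nx // on_line_self.
- by rewrite (translation_dir x (t x) ts s1) on_line_self.
Qed.

(** If s and t have the same direction, choose u in another one. Then [t * u] has a direction
    different from that of s too, so s commutes with u and with [t * u], hence with t. *)
Lemma translationC s t : translation s -> translation t -> s * t = t * s.
Proof.
move=> ts tt; have [->|s1] := eqVneq s 1; first by rewrite mulg1 mul1g.
have [->|t1] := eqVneq t 1; first by rewrite mulg1 mul1g.
have [E|] := eqVneq (dir o (s o)) (dir o (t o)); last exact: translation_commute_dir.
have [d nd] : exists d, d != dir o (s o).
  have [d [d' dd']] := two_dirs; have [Ed|] := eqVneq d (dir o (s o)); last by exists d.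
  by exists d'; rewrite -Ed eq_sym.
have [y oy Ey] := dir_ex o d; have [u tu uy] := translation_exists o y.
have u1 : u != 1 by apply: contraNneq oy => u1; rewrite -uy u1 perm1.
have Eto : dir (t o) (u (t o)) = d by rewrite -(translation_dir o (t o) tu u1) uy.
have ntu : t * u != 1.
  apply: contraNneq nd => Etu; rewrite -Eto -permM Etu perm1 dirC ?E //.
  exact: translationP.
have cu : s * u = u * s.
  by apply: (@translation_commute_dir _ _ o) => //; rewrite uy Ey eq_sym.
have ctu : s * (t * u) = (t * u) * s.
  apply: (@translation_commute_dir _ _ o) => //; first exact: translationM.
  apply: contraNneq nd => E2; rewrite permM in E2.
  have to : on_line o (dir o (s o)) (t o) by rewrite E on_line_self.
  have tuo : on_line o (dir o (s o)) (u (t o)) by rewrite E2 on_line_self.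
  rewrite -Ey -uy (translation_dir o (t o) tu u1); apply/eqP.
  by apply: on_line_dir to tuo _; rewrite eq_sym translationP.
by apply: (mulIg u); rewrite -mulgA ctu -!mulgA cu.
Qed.

Lemma translationJ s t : dil s -> translation t -> translation (t ^ s).
Proof.
move=> ds /andP[dt nt]; rewrite /translation /conjg !dilM ?dilV //=.
case/orP: nt => [/eqP ->|/forallP nx]; first by rewrite mul1g mulVg eqxx.
apply/orP; right; apply/forallP => x; rewrite !permM.
by rewrite -{2}(permKV s x) (inj_eq perm_inj).
Qed.

Lemma tr_subproof x : exists t, translation t && (t o == x).
Proof. by have [t tt <-] := translation_exists o x; exists t; rewrite tt eqxx. Qed.

Definition tr x : {perm A} := xchoose (tr_subproof x).

Lemma trP x : translation (tr x).
Proof. by have /andP[] := xchooseP (tr_subproof x). Qed.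

Lemma tr_o x : tr x o = x.
Proof. by have /andP[_ /eqP] := xchooseP (tr_subproof x). Qed.

Lemma tr_uniq t : translation t -> tr (t o) = t.
Proof. by move=> tt; apply: (translation_eq (trP _) tt (x := o)); rewrite tr_o. Qed.

Lemma tr_inj : injective tr.
Proof. by move=> x y E; rewrite -(tr_o x) E tr_o. Qed.

(** The group of translations carried over to the points: it acts regularly, and [tr x] is its
    element that takes o to x. *)
Definition addp x y := tr y x.
Definition oppp x := (tr x)^-1 o.

Lemma tr_add x y : tr (addp x y) = tr x * tr y.
Proof.
by rewrite -(tr_uniq (translationM (trP x) (trP y))) permM tr_o.
Qed.

Lemma tr_opp x : tr (oppp x) = (tr x)^-1.
Proof. by rewrite /oppp tr_uniq ?translationV ?trP. Qed.

Lemma tr_origin : tr o = 1.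
Proof. by rewrite -[in LHS](perm1 o) tr_uniq ?translation1. Qed.

Lemma addpA : associative addp.
Proof. by move=> x y z; apply: tr_inj; rewrite !tr_add mulgA. Qed.

Lemma addpC : commutative addp.
Proof. by move=> x y; apply: tr_inj; rewrite !tr_add translationC ?trP. Qed.

Lemma add0p : left_id o addp.
Proof. by move=> x; rewrite /addp tr_o. Qed.

Lemma addNp : left_inverse o oppp addp.
Proof. by move=> x; apply: tr_inj; rewrite tr_add tr_opp tr_origin mulVg. Qed.

Lemma dir_addp x y z : x != y -> dir (addp x z) (addp y z) = dir x y.
Proof. by move=> xy; have /andP[/dilP ds _] := trP z; rewrite /addp -ds. Qed.

(** Conjugation by a dilatation preserves translations; if it fixes o, it takes the translation to y
    into the translation to [s y]. *)
Lemma dil_addp s x y : dil s -> s o = o -> s (addp x y) = addp (s x) (s y).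
Proof.
move=> ds so; suff E : tr (s y) = tr y ^ s by rewrite /addp E /conjg !permM permK.
rewrite -(tr_uniq (translationJ ds (trP y))) /conjg !permM.
by rewrite -[X in s^-1 X]so permK tr_o.
Qed.

(** Translations preserve directions, so the direction of xy is that of the vector y - x seen from
    o. The homotheties at o are additive by [dil_addp], and supply the scalars. *)
Theorem affine_coordinates : exists (F : finFieldType) (n : nat) (c : A -> 'rV[F]_n),
  bijective c /\ forall a b a' b', a != b -> a' != b' ->
    (dir a b = dir a' b' <-> exists k, (c b' - c a' = k *: (c b - c a))%R).
Proof.
pose V : finZmodType := HB.pack A (GRing.isZmodule.Build A addpA addpC add0p addNp).
have dirB (x y : V) : x != y -> dir x y = dir o (y - x)%R.
  move=> xy; rewrite -(dir_addp (oppp x) xy); congr dir.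
  exact: (subrr (x : V)).
have o0 (v : V) : (v != 0%R) -> o != v by rewrite eq_sym.
have nz (x y : V) : x != y -> (y - x)%R != 0%R by rewrite subr_eq0 eq_sym.
have dN (v : V) : v != 0%R -> dir o (- v)%R = dir o v.
  by move=> v0; rewrite -[(- v)%R]sub0r -dirB // dirC // o0.
have dB (u v : V) : u != 0%R -> v != 0%R -> dir o u = dir o v -> (u - v)%R != 0%R ->
    dir o (u - v)%R = dir o u.
  move=> u0 v0 E uv; have vu : v != u by rewrite eq_sym -subr_eq0.
  by rewrite -dirB // (dir_trans (o0 _ v0) (o0 _ u0) vu) // E.
have td : exists u v : V, [/\ u != 0%R, v != 0%R & dir o u != dir o v].
  have [d [d' dd']] := two_dirs; have [u ou Eu] := dir_ex o d; have [v ov Ev] := dir_ex o d'.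
  by exists u, v; split; rewrite 1?eq_sym // Eu Ev eq_sym.
have hom (u v : V) : u != 0%R -> v != 0%R -> dir o u = dir o v -> exists f : V -> V,
    [/\ f u = v, {morph f : x y / (x - y)%R} &
      forall x : V, x != 0%R -> f x != 0%R -> dir o (f x) = dir o x].
  move=> u0 v0 E; have [f [fo fu df]] := homothety_ex (o0 _ u0) (o0 _ v0) E.
  have [s ds sf] := dil_perm df; have so : s o = o by rewrite sf.
  exists s; split=> [|x y|x x0 sx0]; first by rewrite sf.
    apply/eqP; rewrite -subr_eq0 opprB addrA subr_eq0 eq_sym.
    by apply/eqP; rewrite -[in LHS](subrK y x); exact: (dil_addp _ _ ds so).
  by rewrite -[X in dir X (s x)]so -(dilP _ ds) // o0.
have [F [n [c [bc cB cd]]]] := @direction_coordinates V D (dir o) dN dB td hom.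
exists F, n, c; split=> // a b a' b' ab ab'.
by rewrite (dirB a b) // (dirB a' b') //; have := cd _ _ (nz _ _ ab) (nz _ _ ab'); rewrite !cB.
Qed.

End Translations.

(** * Coordinatization of projective geometries *)

Definition homogeneous_coordinates (M : matroid) (F : finFieldType) n (c : M -> 'rV[F]_n) : Prop :=
  [/\ forall x, c x != 0%R,
      forall x y k, c y = (k *: c x)%R -> x = y,
      forall x y z, x != y ->
        (z \in cl [set x; y] <-> exists k l, c z = (k *: c x + l *: c y)%R)
    & forall v, v != 0%R -> exists x k, v = (k *: c x)%R].

Section Coordinatization.
Variables (M : matroid) (H : {set M}).
Hypotheses (sM : simple M) (mM : modular M) (cM : separator_free M) (r4 : 4 <= rank M).
Hypothesis hH : hyperplane H.
Implicit Types (x y z a b p q m : M).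
Local Notation r := (@rank_set M).
Local Notation ln x y := (cl [set x; y]).
Local Notation dir := (dir H).
Let fH : flat H := hyperplane_flat hH.

Lemma exists_dir a d : a \notin H -> d \in H -> exists b, [/\ b \notin H, a != b & dir a b = d].
Proof.
move=> aH dH; have ad : a != d by apply: contraNneq aH => ->.
have [b [bl ba bd]] := line_third sM mM cM ad.
have ab : a != b by rewrite eq_sym.
exists b; split=> //.
  apply: contra aH => bH; apply: (subsetP (line_sub fH dH bH)).
  by apply: (line_exchange sM); rewrite 1?lineC.
apply: (dir_uniq sM mM hH) => //; exact: (line_exchange sM).
Qed.

Lemma dir_meet_affine a b a' b' : a \notin H -> b \notin H -> a' \notin H -> b' \notin H ->
  a != b -> dir a b = dir a' b' -> a != a' -> b != b' -> dir a a' != dir b b' ->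
  exists q, [/\ q \notin H, q \in ln a a' & q \in ln b b'].
Proof.
move=> aH bH a'H b'H ab E aa' bb' nd.
pose d := dir a b; have dl : d \in ln a b := dir_line sM mM hH aH ab.
have dH : d \in H := dir_inH sM mM hH aH ab.
have rl : r (ln a b) = 2 by rewrite rank_line.
pose K := cl (a' |: ln a b).
have rK : r K <= 3 by rewrite rank_cl (leq_trans (rank_setU1 _ _)) // rl.
have sK : ln a b \subset K by apply: subset_trans (sub_cl _); exact: subsetUr.
have a'K : a' \in K by rewrite mem_cl ?setU11.
have [aK bK] := (subsetP sK _ (in_line1 a b), subsetP sK _ (in_line2 a b)).
have b'K : b' \in K.
  have [<-//|a'b'] := eqVneq a' b'.
  have da' : d \in ln a' b' by rewrite /d E dir_line.
  have nd' : d != a' by apply: contraNneq a'H => <-.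
  apply: (subsetP (line_sub (flat_cl _) a'K (subsetP sK _ dl))).
  exact: (line_exchange sM).
have [q q1 q2] := coplanar_lines_meet sM mM aa' bb' rK (flat_cl _) aK a'K bK b'K.
exists q; split=> //; apply: contra nd => qH.
by rewrite (dir_uniq sM mM hH aH aa' qH q1) (dir_uniq sM mM hH bH bb' qH q2).
Qed.

Local Notation A := {x : M | x \notin H}.
Local Notation D := {x : M | x \in H}.

Lemma affine_pointP : exists a : M, a \notin H.
Proof.
have [a _ aH] : exists2 a, a \in [set: M] & a \notin H.
  apply/subsetPn; apply/negP => /rank_setS.
  by rewrite -/(rank M) -(hyperplane_rank hH) ltnn.
by exists a.
Qed.

Lemma direction_pair : exists d d' : M, [/\ d \in H, d' \in H & d != d'].
Proof.
have [I [II sI cI]] := rank_basis H.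
have lt : 2 < #|I| by rewrite cI -ltnS (hyperplane_rank hH).
have /card_gt0P[d dI] : 0 < #|I| by apply: leq_trans lt.
have /card_gt0P[d'] : 0 < #|I :\ d| by move: lt; rewrite (cardsD1 d I) dI; clear; lia.
rewrite !inE => /andP[dd' d'I]; exists d, d'.
by split; rewrite ?(subsetP sI) // eq_sym.
Qed.

Lemma affine_part_coordinates : exists (F : finFieldType) (n : nat) (c : M -> 'rV[F]_n),
  [/\ forall a b, a \notin H -> b \notin H -> c a = c b -> a = b,
      forall v, exists2 a, a \notin H & c a = v
    & forall a b a' b', a \notin H -> b \notin H -> a' \notin H -> b' \notin H ->
        a != b -> a' != b' ->
        (dir a b = dir a' b' <-> exists k, (c b' - c a' = k *: (c b - c a))%R)].
Proof.
have [a0 a0H] := affine_pointP; have [d0 [d1 [d0H d1H d01]]] := direction_pair.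
pose o : A := exist _ a0 a0H; pose dO : D := exist _ d0 d0H.
(* For a = b the value of [dir] is a itself, which is not in H; [insubd] replaces it with [dO]. *)
pose dr (a b : A) : D := insubd dO (dir (val a) (val b)).
have drE (a b : A) : a != b -> val (dr a b) = dir (val a) (val b).
  by move=> ab; rewrite insubdK // unfold_in; apply: (dir_inH sM mM hH (valP a)).
have dr_eq (a b a' b' : A) : a != b -> a' != b' ->
    (dr a b = dr a' b') <-> (dir (val a) (val b) = dir (val a') (val b')).
  move=> ab ab'; rewrite -!drE //; split=> [-> //|]; exact: val_inj.
have onlE (a : A) d (b b' : A) : a != b -> d = dr a b -> (on_line dr a d b') =
    (val b' \in ln (val a) (val b)).
  move=> ab ->; rewrite /on_line; have [->|b'a] := eqVneq b' a; first by rewrite in_line1.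
  have ab' : a != b' by rewrite eq_sym.
  apply/eqP/idP => [/dr_eq E|l].
    by rewrite (line_of_dir sM mM hH (valP a) ab ab' (esym (E ab' ab))) in_line2.
  by apply/dr_eq => //; apply: (dir_on sM mM hH (valP a)).
have drC (a b : A) : a != b -> dr a b = dr b a.
  by move=> ab; apply/dr_eq; rewrite // 1?eq_sym // (dirC sM mM hH (valP a) (valP b)).
have dr_trans (x y z : A) : x != y -> x != z -> y != z -> dr x y = dr x z -> dr y z = dr x y.
  move=> xy xz yz /dr_eq E; rewrite [RHS]drC //; have yx : y != x by rewrite eq_sym.
  apply/dr_eq => //; apply: (dir_on sM mM hH (valP y)) => //.
  have Exy := line_of_dir sM mM hH (valP x) xy xz (E xy xz).
  by rewrite lineC Exy in_line2.
have dr_ex (x : A) (d : D) : exists2 y, x != y & dr x y = d.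
  have [b [bH xb Eb]] := exists_dir (valP x) (valP d).
  by exists (exist _ b bH : A) => //; apply: val_inj; rewrite drE.
have dr_two : exists d d' : D, d != d' by exists dO, (exist _ d1 d1H).
have dr_meet (a b a' b' : A) : a != b -> dr a b = dr a' b' -> a != a' -> b != b' ->
    dr a a' != dr b b' -> exists2 q, on_line dr a (dr a a') q & on_line dr b (dr b b') q.
  (* The hypothesis on [dir_meet] also covers a' = b', where the two lines meet at a' itself. *)
  move=> ab E aa' bb' nd; have [E'|ab'] := eqVneq a' b'.
    by exists a'; rewrite ?on_line_self // E' on_line_self.
  have nd' : dir (val a) (val a') != dir (val b) (val b').
    by apply: contra nd => /eqP E1; apply/eqP/dr_eq.
  have E2 : dir (val a) (val b) = dir (val a') (val b') by apply/dr_eq.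
  have [q [qH q1 q2]] := dir_meet_affine (valP a) (valP b) (valP a') (valP b') ab E2 aa' bb' nd'.
  by exists (exist _ q qH : A); rewrite (onlE _ _ _ _ _ erefl).
(* Shared by translations, whose centre p is in H, and homotheties, whose centre is an affine
   point. *)
have dil_ex p (a b : A) : aligned H p (val a) (val b) -> exists s : A -> A,
    [/\ s a = b, dilation dr s, forall x : A, val x != p -> val (s x) \in ln p (val x)
      & forall x : A, val x = p -> s x = x].
  move=> pab; have [s [sa sp sl sd]] := central_dilatation sM mM cM r4 hH pab.
  have sH x : x \notin H -> s x \notin H.
    move=> xH; have [E|xp] := eqVneq x p; first by rewrite E sp -E.
    have xA : affine_pt H p x by rewrite /affine_pt xH.
    by have [] := alignedP sM (sl x xA).
  pose f (x : A) : A := exist _ (s (val x)) (sH _ (valP x)).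
  have spP (x : A) : val x != p -> [/\ s (val x) != p, s (val x) \in ln p (val x)
      & dir (val x) p = dir (s (val x)) p].
    move=> xp; have xA : affine_pt H p (val x) by rewrite /affine_pt (valP x).
    have [_ _ sxH sxp El] := alignedP sM (sl _ xA); split=> //; first by rewrite -El in_line2.
    by apply: (dir_of_line sM mM hH (valP x) sxH) => //; rewrite lineC -El lineC.
  exists f; split.
  - exact: val_inj.
  - move=> x y xy; suff [n1 E1] : s (val x) != s (val y) /\
        dir (val x) (val y) = dir (s (val x)) (s (val y)).
      by split=> //; apply/dr_eq.
    (* [central_dilatation] says nothing about directions towards the centre; they are preserved
       because a point and its image are collinear with p. *)
    have [xp|xp] := eqVneq (val x) p.
      have yp : val y != p by rewrite -xp; apply: contra xy => /eqP/val_inj ->.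
      have [syp syl Ed] := spP y yp; rewrite xp sp; split; first by rewrite eq_sym.
      have pH : p \notin H by rewrite -xp (valP x).
      rewrite (dirC sM mM hH pH (valP y)) 1?eq_sym // Ed.
      by rewrite (dirC sM mM hH (sH _ (valP y)) pH).
    have [yp|yp] := eqVneq (val y) p.
      have [sxp _ Ed] := spP x xp; rewrite yp sp; by split.
    by apply: sd => //; rewrite /affine_pt ?(valP x) ?(valP y).
  - by move=> x xp; have [] := spP x xp.
  - by move=> x xp; apply: val_inj; rewrite /= xp sp.
have dr_transl (a b : A) : a != b -> exists s : A -> A,
    [/\ s a = b, dilation dr s & forall x : A, on_line dr x (dr a b) (s x)].
  move=> ab; pose p := dir (val a) (val b).
  have pH : p \in H := dir_inH sM mM hH (valP a) ab.
  have np (x : A) : val x != p by apply: contraTneq pH => <-; exact: (valP x).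
  have El : ln p (val a) = ln (val a) (val b).
    by rewrite lineC line_dir // (valP a).
  have [|s [sa sd sl _]] := dil_ex p a b.
    by rewrite /aligned /affine_pt !np (valP a) (valP b) El in_line2.
  exists s; split=> // x; rewrite /on_line; case: eqVneq => //= sx.
  apply/eqP/val_inj; rewrite !drE // 1?eq_sym //.
  apply: (dir_uniq sM mM hH (valP x)) => //; first by rewrite eq_sym.
  by apply: (line_exchange sM) => //; rewrite lineC sl.
have dr_hom (x a b : A) : x != a -> x != b -> dr x a = dr x b ->
    exists s : A -> A, [/\ s x = x, s a = b & dilation dr s].
  move=> xa xb /dr_eq E; have [|s [sa sd _ sp]] := dil_ex (val x) a b.
    rewrite /aligned /affine_pt (valP a) (valP b) /=; apply/and3P; split.
    - by rewrite eq_sym.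
    - by rewrite eq_sym.
    - by rewrite (line_of_dir sM mM hH (valP x) xa xb (E xa xb)) in_line2.
  by exists s; split=> //; exact: sp.
have [F [n [c [[g cK gK] cP]]]] := affine_coordinates o drC dr_trans dr_ex dr_two dr_meet dr_transl dr_hom.
exists F, n, (fun x => c (insubd o x)).
have cE (x : A) : c (insubd o (val x)) = c x by rewrite valKd.
split=> [a b aH bH|v|a b a' b' aH bH a'H b'H ab ab'].
- rewrite -[a]/(val (exist _ a aH : A)) -[b]/(val (exist _ b bH : A)) !cE.
  by move/(can_inj cK) ->.
- by exists (val (g v)); rewrite ?cE ?gK // (valP (g v)).
pose toA x (xH : x \notin H) : A := exist _ x xH.
have := cP (toA a aH) (toA b bH) (toA a' a'H) (toA b' b'H) ab ab'.
rewrite -[a]/(val (toA a aH)) -[b]/(val (toA b bH)) -[a']/(val (toA a' a'H)).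
by rewrite -[b']/(val (toA b' b'H)) !cE; rewrite dr_eq.
Qed.

(** * From affine to homogeneous coordinates *)

Section Homogeneous.
Variables (F : finFieldType) (n : nat) (c0 : M -> 'rV[F]_n) (o : M).
Local Open Scope ring_scope.
Hypotheses (oH : o \notin H)
  (c0_inj : forall a b, a \notin H -> b \notin H -> c0 a = c0 b -> a = b)
  (c0_surj : forall v, exists2 a, a \notin H & c0 a = v)
  (c0_dir : forall a b a' b', a \notin H -> b \notin H -> a' \notin H -> b' \notin H ->
     a != b -> a' != b' ->
     (dir a b = dir a' b' <-> exists k, c0 b' - c0 a' = k *: (c0 b - c0 a))).

(** The usual projective completion: an affine point x becomes (1, c0 x), and a point of H becomes
    (0, v) with v a vector in that direction. The latter is read off an affine point b with
    [dir o b = x], which always exists, so the default 0 of [vec] is never taken on H. *)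
Definition weight x : F := (x \notin H)%:R.
Definition vec x : 'rV[F]_n :=
  if x \notin H then c0 x else
  if [pick b | [&& b \notin H, o != b & dir o b == x]] is Some b then c0 b - c0 o else 0.
Definition hcoord x : 'rV[F]_(1 + n) := row_mx (weight x)%:M (vec x).

Let wA x : x \notin H -> weight x = 1.
Proof. by rewrite /weight => ->. Qed.

Let wH x : x \in H -> weight x = 0.
Proof. by rewrite /weight => ->. Qed.

Let vA x : x \notin H -> vec x = c0 x.
Proof. by rewrite /vec => ->. Qed.

Let vH x : x \in H -> exists b, [/\ b \notin H, o != b, dir o b = x & vec x = c0 b - c0 o].
Proof.
move=> xH; rewrite /vec xH /=; case: pickP => [b /and3P[bH ob /eqP E]|nb]; first by exists b.
by have [b [bH ob E]] := exists_dir oH xH; have := nb b; rewrite bH ob E eqxx.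
Qed.

Let dirE x a b : x \in H -> a \notin H -> b \notin H -> a != b ->
  (dir a b = x <-> exists k, vec b - vec a = k *: vec x).
Proof.
move=> xH aH bH ab; have [b0 [b0H ob0 <- ->]] := vH xH; rewrite !vA // -c0_dir //.
by split=> ->.
Qed.

Let v_neq a b : a \notin H -> b \notin H -> a != b -> vec b - vec a != 0.
Proof.
move=> aH bH; apply: contraNneq => /eqP; rewrite subr_eq0 !vA // => /eqP/c0_inj -> //.
Qed.

Let vH_neq x : x \in H -> vec x != 0.
Proof.
move=> xH; have [b [bH ob _ ->]] := vH xH; rewrite -!vA //; exact: v_neq.
Qed.

Let hcoordE x y z k l : hcoord z = k *: hcoord x + l *: hcoord y <->
  weight z = k * weight x + l * weight y /\ vec z = k *: vec x + l *: vec y.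
Proof.
rewrite /hcoord !scale_row_mx add_row_mx; split=> [/eq_row_mx[/(congr1 (fun A : 'M_1 => A 0 0))]|[-> ->]].
  by rewrite !mxE eqxx !mulr1n.
by congr row_mx; apply/matrixP => i j; rewrite !ord1 !mxE eqxx !mulr1n.
Qed.

Definition dependent x y z := exists k l, hcoord z = k *: hcoord x + l *: hcoord y.

Let depC x y z : dependent x y z -> dependent y x z.
Proof. by case=> k [l E]; exists l, k; rewrite addrC. Qed.

Let dirE0 x a b : x \in H -> a \notin H -> b \notin H -> a != b -> dir a b = x ->
  exists2 k, k != 0 & vec b - vec a = k *: vec x.
Proof.
move=> xH aH bH ab /dirE[] // k E; exists k => //; apply: contraNneq (v_neq aH bH ab).
by move=> k0; rewrite E k0 scale0r.
Qed.

(** The first coordinate makes k + l equal to 1 for an affine z and to 0 for z in H. In both cases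
    dependence then says that z, or z as a direction, belongs to the line of direction pq through
    p. *)
Let depAA p q z : p \notin H -> q \notin H -> p != q -> (z \in ln p q <-> dependent p q z).
Proof.
move=> pH qH pq; have [zH|zH] := boolP (z \in H).
  split=> [zl|[k [l /hcoordE[]]]].
    have [k k0 E] := dirE0 zH pH qH pq (dir_uniq sM mM hH pH pq zH zl).
    exists (- k^-1), k^-1; apply/hcoordE; rewrite wH // !wA // mulr1 mulr1 addNr; split=> //.
    by rewrite scaleNr addrC -scalerBr E scalerA mulVf // scale1r.
  rewrite wH // !wA // !mulr1 => /esym/eqP; rewrite addr_eq0 => /eqP -> E.
  have Ez : vec z = l *: (vec q - vec p) by rewrite E scaleNr addrC scalerBr.
  have l0 : l != 0 by apply: contraNneq (vH_neq zH) => l0; rewrite Ez l0 scale0r.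
  have <- : dir p q = z; last exact: dir_line.
  by apply/dirE => //; exists l^-1; rewrite Ez scalerA mulVf // scale1r.
have [->|zp] := eqVneq z p.
  split=> [_|_]; last exact: in_line1.
  by exists 1, 0; rewrite scale1r scale0r addr0.
have pz : p != z by rewrite eq_sym.
split=> [zl|[k [l /hcoordE[]]]].
  have /(c0_dir pH qH pH zH pq pz)[k E] := esym (dir_on sM mM hH pH pq pz zl).
  exists (1 - k), k; apply/hcoordE; rewrite !wA // !mulr1 subrK; split=> //.
  rewrite scalerBl scale1r -addrA [- _ + _]addrC -scalerBr !vA // -E addrC subrK //.
rewrite !wA // !mulr1 => /esym E1 E2.
have Ek : k = 1 - l by rewrite -E1 addrK.
have /(c0_dir pH qH pH zH pq pz) Ed : exists k, c0 z - c0 p = k *: (c0 q - c0 p).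
  exists l; rewrite -!vA // E2 Ek scalerBl scale1r scalerBr.
  by rewrite addrAC (addrAC (vec p)) subrr add0r addrC.
by rewrite (line_of_dir sM mM hH pH pq pz Ed) in_line2.
Qed.

(** An affine point b of the line pq takes the place of q, as [hcoord b] is [hcoord p] plus a
    nonzero multiple of [hcoord q]. *)
Let depAH p q z : p \notin H -> q \in H -> (z \in ln p q <-> dependent p q z).
Proof.
move=> pH qH; have [b [bH pb Eb]] := exists_dir pH qH.
have [k k0 E] := dirE0 qH pH bH pb Eb.
have -> : ln p q = ln p b by rewrite -Eb line_dir.
rewrite depAA //; have Evb : vec b = vec p + k *: vec q by rewrite -E addrC subrK.
have hb : hcoord b = 1 *: hcoord p + k *: hcoord q.
  by apply/hcoordE; rewrite (wA pH) (wA bH) (wH qH) mulr0 addr0 mulr1 scale1r.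
split=> [[a [d Ez]]|[a [d Ez]]].
  by exists (a + d), (d * k); rewrite Ez hb scale1r scalerDr scalerDl scalerA addrA.
exists (a - d / k), (d / k); rewrite Ez hb scale1r scalerDr scalerBl scalerA divfK //.
by rewrite addrA subrK.
Qed.

Let prop_eq x y k : hcoord y = k *: hcoord x -> x = y.
Proof.
move=> E; have /hcoordE[] : hcoord y = k *: hcoord x + 0 *: hcoord x by rewrite scale0r addr0.
rewrite mul0r addr0 scale0r addr0 => E1 E2.
have [xH|xH] := boolP (x \in H); have [yH|yH] := boolP (y \in H).
- have [b [bH ob Eb _]] := vH yH; have [l El] := (dirE yH oH bH ob).1 Eb.
  have <- : dir o b = x by apply/dirE => //; exists (l * k); rewrite El E2 scalerA.
  exact: Eb.
- by move: E1; rewrite wA // wH // mulr0 => /eqP; rewrite oner_eq0.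
- move: E1; rewrite wH // wA // mulr1 => k0; have := vH_neq yH.
  by rewrite E2 -k0 scale0r eqxx.
- by move: E1 E2; rewrite !wA // mulr1 => <-; rewrite scale1r !vA // => /c0_inj ->.
Qed.

(** A line inside H is seen from the affine points o and b, with b on op. In the plane opq a point z
    of H is on pq exactly if the line oz meets bq in an affine point, and the cases already settled
    translate this into coordinates. *)
Let depHH p q z : p \in H -> q \in H -> p != q -> (z \in ln p q <-> dependent p q z).
Proof.
move=> pH qH pq; have sl : ln p q \subset H := line_sub fH pH qH.
have [zH|zH] := boolP (z \in H); last first.
  split=> [/(subsetP sl)|[k [l /hcoordE[]]]]; first by rewrite (negPf zH).
  by rewrite wA // !wH // !mulr0 addr0 => /eqP; rewrite oner_eq0.
have [->|zq] := eqVneq z q.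
  split=> [_|_]; last exact: in_line2.
  by exists 0, 1; rewrite scale1r scale0r add0r.
have [b [bH ob Eb]] := exists_dir oH pH; have [k k0 E] := dirE0 pH oH bH ob Eb.
have ap : o \notin ln p q by apply: contra oH; exact: subsetP.
pose K := cl (o |: ln p q); have rK : r K = 3%N := rank_plane sM pq ap.
have sK : ln p q \subset K := plane_line p q o; have oK : o \in K := plane_pt p q o.
have [pK qK] := (subsetP sK _ (in_line1 p q), subsetP sK _ (in_line2 p q)).
have opb : ln o p = ln o b by rewrite -Eb line_dir.
have bK : b \in K.
  by apply: (subsetP (line_sub (flat_cl _) oK pK)); rewrite opb in_line2.
have neqH x y : x \notin H -> y \in H -> x != y by move=> xH; apply: contraTneq => <-.
have notob : o \notin ln b q.
  apply/negP => ol; case/negP: pq; rewrite -Eb; apply/eqP/(dir_uniq sM mM hH oH ob qH).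
  by rewrite lineC; apply: (line_exchange sM).
split=> [zl|[l [m /hcoordE[_ Ez]]]].
  have zK := subsetP sK _ zl.
  have [m m1 m2] := coplanar_lines_meet sM mM (neqH o z oH zH) (neqH b q bH qH) (eq_leq rK)
    (flat_cl _) oK zK bK qK.
  have mH : m \notin H.
    apply: contra zq => mH; rewrite -(dir_uniq sM mM hH oH (neqH o z oH zH) zH (in_line2 _ _)).
    rewrite (dir_uniq sM mM hH oH (neqH o z oH zH) mH m1).
    rewrite -(dir_uniq sM mM hH bH (neqH b q bH qH) mH m2).
    by rewrite (dir_uniq sM mM hH bH (neqH b q bH qH) qH (in_line2 _ _)).
  have [k1 [k2 /hcoordE[]]] := (depAH m oH zH).1 m1; rewrite (wA mH) (wA oH) (wH zH) mulr0 addr0 mulr1 => <- Em1.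
  have [l1 [l2 /hcoordE[]]] := (depAH m bH qH).1 m2; rewrite (wA mH) (wA bH) (wH qH) mulr0 addr0 mulr1 => <- Em2.
  rewrite scale1r in Em1; rewrite scale1r in Em2.
  have k20 : k2 != 0.
    apply: contraNneq notob => k20; suff -> : o = m by [].
    by apply: c0_inj => //; rewrite -!vA // Em1 k20 scale0r addr0.
  have Ez : k2 *: vec z = k *: vec p + l2 *: vec q.
    by rewrite -E -addrA [- _ + _]addrC addrA -Em2 Em1 [vec o + _]addrC addrK.
  exists (k2^-1 * k), (k2^-1 * l2); apply/hcoordE; rewrite !wH // !mulr0 addr0; split=> //.
  by rewrite -!scalerA -scalerDr -Ez scalerA mulVf // scale1r.
have [l0|l0] := eqVneq l 0.
  have <- : q = z; last exact: in_line2.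
  apply: (@prop_eq q z m); rewrite -[RHS]add0r -[X in X + _](scale0r (hcoord p)).
  by apply/hcoordE; rewrite !wH // !mulr0 addr0 Ez l0.
(* The factor k / l makes the component along p equal to [vec b - vec o], so that x is on bq as well
   as on oz. *)
have [x xH Ex] := c0_surj (vec o + (k / l) *: vec z).
rewrite -vA // in Ex.
have xz : x \in ln o z.
  apply/depAH => //; exists 1, (k / l); apply/hcoordE.
  by rewrite (wA xH) (wA oH) (wH zH) mulr0 addr0 mulr1 scale1r.
have xq : x \in ln b q.
  apply/depAH => //; exists 1, (k / l * m); apply/hcoordE.
  rewrite (wA xH) (wA bH) (wH qH) mulr0 addr0 mulr1 scale1r; split=> //.
  by rewrite Ex Ez scalerDr !scalerA divfK // -E addrA [vec o + _]addrC subrK.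
have xK : x \in K by apply: (subsetP (line_sub (flat_cl _) bK qK)).
have xo : x != o by apply: contraNneq notob => <-.
have zK : z \in K.
  apply: (subsetP (line_sub (flat_cl _) oK xK)).
  exact: (line_exchange sM).
have fK : flat K := flat_cl _.
have nKH : ~~ (K \subset H) by apply/subsetPn; exists o.
have rKH : r (K :&: H) = 2%N.
  by have := modular_hyperplane mM fK hH nKH; rewrite rK => -[].
have -> : ln p q = K :&: H.
  by apply: (flat_lineE sM (flatI fK fH) rKH pq); rewrite inE ?pK ?qK.
by rewrite inE zK.
Qed.

Lemma hcoord_homogeneous : homogeneous_coordinates hcoord.
Proof.
split.
- move=> x; have [xH|xH] := boolP (x \in H).
    apply: contraNneq (vH_neq xH) => /(congr1 rsubmx).
    by rewrite row_mxKr => ->; apply/eqP/matrixP => i j; rewrite !mxE.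
  apply/eqP => /(congr1 lsubmx)/matrixP/(_ 0 0).
  by rewrite row_mxKl !mxE eqxx wA // mulr1n => /eqP; rewrite oner_eq0.
- exact: prop_eq.
- move=> x y z xy; rewrite -/(dependent x y z).
  have [xH|xH] := boolP (x \in H); have [yH|yH] := boolP (y \in H).
  + exact: depHH.
  + by rewrite lineC depAH //; split; apply: depC.
  + exact: depAH.
  + exact: depAA.
move=> v v0; rewrite -[v]hsubmxK.
have E : lsubmx v = (v 0 (lshift n 0))%:M.
  by apply/matrixP => i j; rewrite !ord1 !mxE eqxx mulr1n.
set l := v 0 _ in E; rewrite E; have [l0|l0] := eqVneq l 0.
  have r0 : rsubmx v != 0.
    by apply: contraNneq v0 => r0; rewrite -[v]hsubmxK E l0 r0 raddf0 row_mx0.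
  have [b bH Eb] := c0_surj (c0 o + rsubmx v).
  have ob : o != b.
    by apply: contraNneq r0 => ob; rewrite -(addKr (c0 o) (rsubmx v)) -Eb -ob addNr.
  have dH := dir_inH sM mM hH oH ob.
  have [k k0 Ek] := dirE0 dH oH bH ob erefl.
  exists (dir o b), k; rewrite /hcoord (wH dH) scale_row_mx -Ek !vA // Eb l0.
  by rewrite !raddf0 addrAC subrr add0r.
have [b bH Eb] := c0_surj (l^-1 *: rsubmx v).
exists b, l; rewrite /hcoord wA // scale_row_mx vA // Eb scalerA mulfV // scale1r.
by rewrite scale_scalar_mx mulr1.
Qed.

End Homogeneous.

Theorem projective_coordinates : exists (F : finFieldType) (n : nat) (c : M -> 'rV[F]_n),
  homogeneous_coordinates c.
Proof.
have [F [n [c [ci cs cd]]]] := affine_part_coordinates; have [o oH] := affine_pointP.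
by exists F, (1 + n)%N, (hcoord c o); exact: hcoord_homogeneous.
Qed.

End Coordinatization.

(** * Coordinates, PG(r-1, q) and duality *)

Section PGRank.
Variables (F : finFieldType) (n : nat).
Local Open Scope ring_scope.
Implicit Types (U : PG F n) (S : {set PG F n}).

Definition pg_span S : {vspace 'rV[F]_n} := <<pg_vecs S>>%VS.

Lemma mem_pg_span S U : U \in S -> pg_vec U \in pg_span S.
Proof. by move=> US; apply: memv_span; rewrite mem_pg_vecs. Qed.

Lemma pg_spanS (S T : {set PG F n}) : S \subset T -> (pg_span S <= pg_span T)%VS.
Proof.
move=> /subsetP sST; apply: sub_span => v /mapP[U]; rewrite mem_enum => /sST US ->.
by rewrite mem_pg_vecs.
Qed.

Lemma pg_indepU1 U S : S \in pg_indep F n -> pg_vec U \notin pg_span S -> U |: S \in pg_indep F n.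
Proof.
rewrite !inE => fS nU; have nUS : U \notin S by apply: contra nU; exact: mem_pg_span.
by rewrite (perm_free (pg_vecsU1 nUS)) free_cons nU.
Qed.

Lemma pg_rank S : rank_set S = \dim (pg_span S).
Proof.
have [I [II sIS cI]] := rank_basis S.
have fI : free (pg_vecs I) by move: II; rewrite inE.
have -> : pg_span S = pg_span I.
  apply/eqP; rewrite eqEsubv; apply/andP; split; last exact: pg_spanS.
  apply/span_subvP => v /mapP[U].
  rewrite mem_enum => US ->; apply/contraT => nU.
  have := card_indep_le (pg_indepU1 II nU : _ \in indep (PG F n)) (_ : U |: I \subset S).
  rewrite subUset sub1set US sIS -cI cardsU1 => /(_ isT).
  have -> : U \notin I by apply: contra nU; exact: mem_pg_span.
  by rewrite ltnn.
by move: fI; rewrite /free => /eqP ->; rewrite size_map -cardE cI.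
Qed.

Lemma pg_cl S U : (U \in cl S) = (pg_vec U \in pg_span S).
Proof.
have [US|US] := boolP (U \in S); first by rewrite mem_cl ?mem_pg_span.
have E : pg_span (U |: S) = (<[pg_vec U]> + pg_span S)%VS.
  by rewrite /pg_span (eq_span (perm_mem (pg_vecsU1 US))) span_cons.
rewrite in_cl !pg_rank E; apply/eqP/idP => [Ed|Uin].
  have : (pg_span S == (<[pg_vec U]> + pg_span S))%VS.
    by rewrite eqEdim addvSr Ed leqnn.
  by move/eqP => ->; rewrite (subvP (addvSl _ _)) ?memv_line.
by congr (\dim _); apply/addv_idPr; rewrite -memvE.
Qed.

Lemma pg_point_of (v : 'rV[F]_n) : v != 0 -> exists U k, [/\ k != 0 & pg_vec U = k *: v].
Proof.
move=> v0; have pP : is_pg_point [set u in <[v]>%VS].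
  by apply/existsP; exists v; rewrite v0 eqxx.
pose U : pg_point F n := Sub _ pP; exists U.
have /andP[u0 /eqP E] := pg_vecP U.
have : pg_vec U \in val U by rewrite E inE memv_line.
rewrite inE => /vlineP[k Ek]; exists k; split=> //.
by apply: contraNneq u0 => k0; rewrite Ek k0 scale0r.
Qed.

Lemma pg_vec_prop U W k : pg_vec U = k *: pg_vec W -> U = W.
Proof.
move=> E; have /andP[u0 /eqP EU] := pg_vecP U; have /andP[w0 /eqP EW] := pg_vecP W.
have k0 : k != 0 by apply: contraNneq u0 => k0; rewrite E k0 scale0r.
apply: val_inj; rewrite EU EW; apply/setP => v; rewrite !inE E.
apply/vlineP/vlineP => -[l ->]; first by exists (l * k); rewrite scalerA.
by exists (l / k); rewrite scalerA divfK.
Qed.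

Lemma rank_PG : rank (PG F n) = n.
Proof.
rewrite /rank pg_rank; have -> : pg_span setT = fullv.
  apply/eqP; rewrite eqEsubv subvf /=; apply/subvP => v _.
  have [->|v0] := eqVneq v 0; first exact: mem0v.
  have [U [k [k0 E]]] := pg_point_of v0.
  rewrite -(scalerK k0 v) -E; apply: memvZ; apply: mem_pg_span; exact: in_setT.
by rewrite dimvf /dim /= mul1n.
Qed.

End PGRank.

(** * A matroid with homogeneous coordinates is a projective space *)

Section FromCoordinates.
Variables (M : matroid) (F : finFieldType) (n : nat) (c : M -> 'rV[F]_n).
Hypotheses (sM : simple M) (mM : modular M) (hc : homogeneous_coordinates c).
Local Open Scope ring_scope.
Implicit Types (x y z : M) (S : {set M}).

Definition image_span S : {vspace 'rV[F]_n} := <<[seq c x | x <- enum S]>>%VS.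

Lemma mem_image_span S x : x \in S -> c x \in image_span S.
Proof. by move=> xS; apply/memv_span/map_f; rewrite mem_enum. Qed.

(** The multiples of the vectors of S are closed under addition: a nonzero sum of multiples of [c x]
    and [c y] represents a point of the line xy, which the flat S contains. *)
Lemma image_span_flat S v : flat S -> v \in image_span S -> v != 0 ->
  exists2 x, x \in S & exists k, v = k *: c x.
Proof.
have [c0 cI cL cS] := hc; move=> fS vS v0.
pose P v := v = 0 \/ exists2 x, x \in S & exists k, v = k *: c x.
suff [E|//] : P v by rewrite E eqxx in v0.
rewrite (coord_span (X := in_tuple [seq c x | x <- enum S]) vS).
apply: (big_ind P); first by left.
  move=> u w [->|[x xS [k Eu]]]; first by rewrite add0r.
  move=> [->|[y yS [l Ew]]]; first by rewrite addr0; right; exists x => //; exists k.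
  have [E|uw0] := eqVneq (u + w) 0; first by left.
  right; have [z [m Em]] := cS _ uw0; exists z; last by exists m.
  have m0 : m != 0 by apply: contraNneq uw0 => m0; rewrite Em m0 scale0r.
  have Ez : c z = m^-1 *: (u + w) by rewrite Em scalerK.
  have [xy|xy] := eqVneq x y.
    have <- // : x = z; apply: (cI _ _ (m^-1 * (k + l))).
    by rewrite Ez Eu Ew xy -scalerDl scalerA.
  apply: (subsetP (line_sub fS xS yS)); apply/cL => //.
  by exists (m^-1 * k), (m^-1 * l); rewrite Ez Eu Ew scalerDr !scalerA.
move=> i _; right; have : (in_tuple [seq c x | x <- enum S])`_i \in [seq c x | x <- enum S].
  exact: mem_nth.
by case/mapP => x; rewrite mem_enum => xS ->; exists x => //; exists (coord (in_tuple [seq c x | x <- enum S]) i v).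
Qed.

Lemma cl_coord S x : (x \in cl S) = (c x \in image_span S).
Proof.
have [c0 cI cL cS] := hc; apply/idP/idP => [|xS].
  pose T := [set x | c x \in image_span S].
  suff fT : flat T.
    move=> xS; have : x \in T; last by rewrite inE.
    by apply: subsetP xS; apply: cl_min fT _; apply/subsetP => y yS; rewrite inE mem_image_span.
  apply: line_closed_flat => // y z; rewrite !inE => yT zT yz; apply/subsetP => w.
  by move/(cL _ _ _ yz) => [k [l E]]; rewrite inE E memvD ?memvZ.
have s : (image_span S <= image_span (cl S))%VS.
  apply: sub_span => v /mapP[y]; rewrite mem_enum => yS ->.
  by apply: map_f; rewrite mem_enum mem_cl.
have [y yS [k /cI <-]] := image_span_flat (flat_cl S) (subvP s _ xS) (c0 x).
exact: yS.
Qed.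

Lemma coordinates_PG : isomorphic M (PG F n).
Proof.
have [c0 cI cL cS] := hc.
have exU x : exists U : PG F n, [exists k, (k != 0) && (pg_vec U == k *: c x)].
  have [U [k [k0 E]]] := pg_point_of (c0 x).
  by exists U; apply/existsP; exists k; rewrite k0 E eqxx.
pose f x := xchoose (exU x).
have fP x : exists k, k != 0 /\ pg_vec (f x) = k *: c x.
  by have /existsP[k /andP[k0 /eqP E]] := xchooseP (exU x); exists k.
have injf : injective f.
  move=> x y E; have [k [k0 Ek]] := fP x; have [l [l0 El]] := fP y.
  apply: (cI _ _ (l^-1 * k)).
  by rewrite -scalerA -Ek E El scalerK.
have surf U : exists x, f x = U.
  have /andP[u0 _] := pg_vecP U; have [x [k E]] := cS _ u0; exists x.
  have [l [l0 El]] := fP x; have k0 : k != 0 by apply: contraNneq u0 => k0; rewrite E k0 scale0r.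
  by apply: (@pg_vec_prop _ _ _ _ (l * k^-1)); rewrite El E scalerA divfK.
exists f; first exact: inj_surj_bij injf surf.
have spanE S : pg_span (f @: S) = image_span S.
  apply/eqP; rewrite eqEsubv; apply/andP; split; apply/span_subvP => v /mapP[u].
    rewrite mem_enum => /imsetP[x xS ->] ->; have [k [_ ->]] := fP x.
    by rewrite memvZ ?mem_image_span.
  rewrite mem_enum => uS ->; have [k [k0 E]] := fP u.
  by rewrite -(scalerK k0 (c u)) -E memvZ // mem_pg_span // imset_f.
have clE S x : (f x \in cl (f @: S)) = (x \in cl S).
  rewrite pg_cl spanE cl_coord; have [k [k0 ->]] := fP x.
  by apply/idP/idP => [/(memvZ k^-1)|/(memvZ k) //]; rewrite scalerK.
move=> S; have fD x : f @: S :\ f x = f @: (S :\ x).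
  apply/setP => U; have [y <-] := surf U.
  by rewrite !inE (inj_eq injf) !mem_imset // !inE.
rewrite !indep_cl; apply/forall_inP/forall_inP => nS x xS.
  by rewrite -clE -fD; apply: nS; exact: imset_f.
by have [y yS ->] := imsetP xS; rewrite fD clE; exact: nS.
Qed.

End FromCoordinates.

(** * Normal vectors of hyperplanes *)

Section DualCoordinates.
Variables (F : finFieldType) (n : nat).
Local Open Scope ring_scope.

(** The columns of a cokernel matrix of the rows w1 and w2 are orthogonal to both, hence to w, which
    puts w in the row space. *)
Lemma annihilator_span (w1 w2 w : 'rV[F]_n) :
  (forall u : 'rV[F]_n, u *m w1^T = 0 -> u *m w2^T = 0 -> u *m w^T = 0) ->
  exists k l, w = k *: w1 + l *: w2.
Proof.
move=> ann; have : (w <= col_mx w1 w2)%MS.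
  have := mulmx_coker (col_mx w1 w2); rewrite submxE; set C := cokermx _.
  rewrite mul_col_mx -[0]vsubmxK => /eq_col_mx[]; rewrite !linear0 => E1 E2.
  rewrite -trmx_eq0 trmx_mul; apply/eqP/row_matrixP => i; rewrite row_mul row0.
  by apply: ann; rewrite -row_mul -trmx_mul (E1, E2) trmx0 row0.
case/submxP => D ->; rewrite -[D]hsubmxK mul_row_col.
exists (lsubmx D 0 0), (rsubmx D 0 0).
by rewrite {1}[lsubmx D]mx11_scalar {1}[rsubmx D]mx11_scalar !mul_scalar_mx.
Qed.

Variables (M N : matroid) (h : N -> {set M}) (c : M -> 'rV[F]_n).
Hypotheses (sM : simple M) (sN : simple N) (mM : modular M) (hN : hyperplane_labelling h)
  (hc : homogeneous_coordinates c).

Implicit Types (u v w : 'rV[F]_n) (x y z : M).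

Definition kernel (w : 'rV[F]_n) : {set M} := [set x | c x *m w^T == 0].

Lemma kernel_flat w : flat (kernel w).
Proof.
have [c0 cI cL cS] := hc; apply: line_closed_flat => // x y.
rewrite !inE => /eqP xK /eqP yK xy; apply/subsetP => z /(cL _ _ _ xy)[k [l E]].
by rewrite inE E mulmxDl -!scalemxAl xK yK !scaler0 addr0.
Qed.

Lemma kernel_ann w u : (forall x, x \in kernel w -> c x *m u^T = 0) ->
  forall v : 'rV[F]_n, v *m w^T = 0 -> v *m u^T = 0.
Proof.
have [c0 cI cL cS] := hc; move=> ku v vw; have [->|v0] := eqVneq v 0; first exact: mul0mx.
have [x [k E]] := cS v v0; have k0 : k != 0 by apply: contraNneq v0 => k0; rewrite E k0 scale0r.
rewrite E -scalemxAl ku ?scaler0 // inE.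
by rewrite -(scalerK k0 (c x)) -E -scalemxAl vw scaler0.
Qed.

(** Some x is outside the kernel. Subtracting from [c y] the multiple of [c x] on which w takes the
    same value gives a vector of the kernel, so y is on a line that joins x to a point of it. *)
Lemma kernel_hyperplane w : w != 0 -> hyperplane (kernel w).
Proof.
have [c0 cI cL cS] := hc; move=> w0.
have [x xK] : exists x, x \notin kernel w.
  apply/existsP/contraT => /existsPn nK; case/negP: w0; rewrite -trmx_eq0.
  apply/eqP/row_matrixP => i; rewrite row0 rowE.
  apply: (@kernel_ann 0 w); last by rewrite trmx0 mulmx0.
  by move=> x _; have := nK x; rewrite negbK inE => /eqP.
apply/hyperplaneP; split; first exact: kernel_flat.
rewrite -(flat_rank1 (kernel_flat w) xK); congr rank_set.
apply/setP => y; rewrite in_setT; have [->|yx] := eqVneq y x; first by rewrite mem_cl ?setU11.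
pose a := (c x *m w^T) 0 0; pose b := (c y *m w^T) 0 0.
have a0 : a != 0.
  apply: contra xK => /eqP Ea; rewrite inE [_ *m _]mx11_scalar -/a Ea.
  by apply/eqP/matrixP => i j; rewrite !mxE mul0rn.
pose v := c y - (b / a) *: c x.
have vw : v *m w^T = 0.
  rewrite mulmxBl -scalemxAl [c y *m _]mx11_scalar [c x *m _]mx11_scalar -/a -/b.
  by rewrite scale_scalar_mx divfK // subrr.
have [v0|v0] := eqVneq v 0.
  by case/eqP: yx; apply/esym/(cI _ _ (b / a))/eqP; rewrite -subr_eq0; apply/eqP.
have [z [k E]] := cS v v0; have k0 : k != 0 by apply: contraNneq v0 => k0; rewrite E k0 scale0r.
have zK : z \in kernel w.
  by rewrite inE -(scalerK k0 (c z)) -E -scalemxAl vw scaler0.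
have xz : x != z by apply: contraNneq xK => ->.
apply: (subsetP (line_sub (flat_cl _) (mem_cl (setU11 _ _)) (mem_cl (setU1r _ zK)))).
apply/(cL _ _ _ xz); exists (b / a), k; rewrite -E /v.
by rewrite addrC subrK.
Qed.

(** For x outside H, [c x] is not in the span of the vectors of H; a column of the cokernel of the
    matrix of these vectors that does not kill [c x] is a normal vector. *)
Lemma hyperplane_kernel H : hyperplane H -> exists w, w != 0 /\ H = kernel w.
Proof.
have [c0 cI cL cS] := hc; move=> hH; have fH := hyperplane_flat hH.
have [x _ xH] : exists2 x, x \in [set: M] & x \notin H.
  by apply/subsetPn/negP => /rank_setS; rewrite -/(rank M) -(hyperplane_rank hH) ltnn.
pose B := \matrix_(i < #|H|) c (enum_val i).
have xB : ~~ (c x <= B)%MS.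
  apply: contra xH => /submxP[D E]; have /flatP <- := fH.
  rewrite (cl_coord sM mM hc) E mulmx_sum_row; apply: memv_suml => i _; apply: memvZ.
  by rewrite rowK mem_image_span // enum_valP.
rewrite submxE in xB; have [j xj] : exists j, c x *m col j (cokermx B) != 0.
  apply/existsP/contraT => /existsPn nj; case/negP: xB; apply/eqP/matrixP => i j.
  have := nj j; rewrite negbK colE mulmxA -colE => /eqP/matrixP/(_ i 0).
  by rewrite !mxE.
exists (col j (cokermx B))^T; split.
  by apply: contraNneq xj => E; rewrite -[col j _]trmxK E trmx0 mulmx0.
apply: hyperplane_sub_eq => //.
  apply/subsetP => y yH; rewrite inE trmxK.
  have -> : c y = row (enum_rank_in yH y) B by rewrite rowK enum_rankK_in.
  by rewrite colE mulmxA -row_mul mulmx_coker row0 mul0mx.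
rewrite ltnNge; apply: contra xj => le.
have : x \in kernel (col j (cokermx B))^T.
  by rewrite (flat_eq (kernel_flat _) (subsetT _) le) in_setT.
by rewrite inE trmxK.
Qed.

(** A line of N consists of the labels of the hyperplanes through the intersection of two of them;
    by [annihilator_span] their normal vectors are the combinations of the two given ones. The field
    and the dimension are unchanged. *)
Lemma dual_coordinates : exists c' : N -> 'rV[F]_n, homogeneous_coordinates c'.
Proof.
have [injh hypE polar rNM] := hN; have [c0 cI cL cS] := hc.
have exw m : exists w, (w != 0) && (h m == kernel w).
  by have [w [w0 ->]] := hyperplane_kernel (labelling_hyperplane hN m); exists w; rewrite w0 eqxx.
pose c' m := xchoose (exw m); exists c'.
have c'0 m : c' m != 0 by have /andP[] := xchooseP (exw m).
have c'h m : h m = kernel (c' m) by have /andP[_ /eqP] := xchooseP (exw m).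
have in_h m x : (x \in h m) = (c x *m (c' m)^T == 0) by rewrite c'h inE.
split=> //.
- move=> m p k E; apply/injh/hyperplane_inj; try exact: labelling_hyperplane hN _.
  apply/subsetP => x; rewrite !in_h E => /eqP xm.
  by rewrite linearZ /= -scalemxAr xm scaler0.
- move=> m p q mp.
  have hm := labelling_hyperplane hN m; have hp := labelling_hyperplane hN p.
  have nmp : ~~ (h m \subset h p).
    by apply: contra mp => s; apply/eqP/injh/hyperplane_inj.
  have fE := flatI (hyperplane_flat hm) (hyperplane_flat hp).
  have rE := modular_hyperplane mM (hyperplane_flat hm) hp nmp.
  have rm := hyperplane_rank hm; have [fp rp] := polar _ fE.
  have -> : cl [set m; p] = [set q | h m :&: h p \subset h q].
    apply: flat_lineE => //; rewrite ?inE ?subsetIl ?subsetIr //.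
    by move: rp; rewrite -rm -rE; clear; lia.
  rewrite inE; split=> [/subsetP s|[k [l E]]].
    apply: annihilator_span => u um up; have [->|u0] := eqVneq u 0; first exact: mul0mx.
    have [x [k Ek]] := cS u u0.
    have k0 : k != 0 by apply: contraNneq u0 => k0; rewrite Ek k0 scale0r.
    have Ex : c x = k^-1 *: u by rewrite Ek scalerK.
    have : x \in h q by apply: s; rewrite inE !in_h Ex -!scalemxAl um up scaler0 eqxx.
    by rewrite in_h Ek -scalemxAl => /eqP ->; rewrite scaler0.
  apply/subsetP => x; rewrite inE !in_h => /andP[/eqP xm /eqP xp].
  by rewrite E linearD !linearZ /= mulmxDr -!scalemxAr xm xp !scaler0 addr0.
- move=> v v0; have /hypE[m Em] := kernel_hyperplane v0; exists m.
  have [k [l E]] : exists k l, v = k *: c' m + l *: c' m.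
    apply: annihilator_span => u um _; apply: (kernel_ann (w := c' m)) um => x.
    by rewrite -c'h Em inE => /eqP.
  by exists (k + l); rewrite scalerDl.
Qed.

End DualCoordinates.

(** * Adjoint sequences *)

Lemma adjoint_card (M N : matroid) : adjoint_step M N ->
  #|N| = #|[set H | hyperplane (H : {set M})]|.
Proof.
move=> /adjoint_labelling[h [injh hypE _ _]].
rewrite -(card_codom injh) cardsE; apply: eq_card => H.
rewrite [in RHS]unfold_in; apply/codomP/idP => [[x ->]|/hypE[x <-]]; last by exists x.
by apply/hypE; exists x.
Qed.

Definition well_connected (r : nat) (M : matroid) : Prop :=
  [/\ simple M, rank M = r & separator_free M].

Lemma well_connected_step r M N : well_connected r M -> adjoint_step M N -> well_connected r N.
Proof.
move=> [sM rM cM] MN; have [h hN] := adjoint_labelling MN.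
have [[rN _] sN] := MN; split=> //; first by rewrite rN.
exact: (labelling_separator_free sM sN hN).
Qed.

Lemma modular_step M N : simple M -> modular M -> adjoint_step M N -> modular N.
Proof.
move=> sM mM MN; have [h hN] := adjoint_labelling MN.
by have [_ sN] := MN; exact: (labelling_modular sM sN hN mM).
Qed.

Lemma double_adjoint M N P : simple M -> modular M -> adjoint_step M N -> adjoint_step N P ->
  isomorphic M P.
Proof.
move=> sM mM MN NP; have [h hN] := adjoint_labelling MN; have [g gP] := adjoint_labelling NP.
have [[_ sN] [_ sP]] := (MN, NP); exact: double_labelling hN gP.
Qed.

Lemma modular_of_card r M N : 3 <= r -> well_connected r M -> adjoint_step M N -> #|N| <= #|M| ->
  modular M.
Proof.
move=> r3 [sM rM _] MN le; apply: (meets_modular sM); apply: card_hyperplanes_eq => //.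
  by rewrite rM.
apply/eqP; rewrite eqn_leq -(adjoint_card MN) le andbT (adjoint_card MN).
by apply: card_hyperplanes => //; rewrite rM ltnW.
Qed.

Lemma adjoint_seq_ind (Q : matroid -> Prop) (A : nat -> matroid) i n :
  (forall M N, Q M -> adjoint_step M N -> Q N) ->
  Q (A i) -> (forall k, i <= k < n -> adjoint_step (A k) (A k.+1)) ->
  forall k, i <= k <= n -> Q (A k).
Proof.
move=> Qstep Qi st; elim=> [|k IHk] /andP[]; first by rewrite leqn0 => /eqP E; rewrite -E.
rewrite leq_eqVlt => /orP[/eqP <- //|ik kn]; apply: Qstep (st k _); last by rewrite -ltnS ik kn.
by apply: IHk; rewrite -ltnS ik ltnW.
Qed.

(** Beyond the index n the terms are iterated duals; the type T carries along the simplicity and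
    modularity that each further dual requires. *)
Lemma modular_continuation n (A : nat -> matroid) : simple (A n) -> modular (A n) ->
  (forall k, k < n -> adjoint_step (A k) (A k.+1)) ->
  exists B, infinite_continuation n A B.
Proof.
move=> sA mA st; pose T := {X : matroid | simple X /\ modular X}.
pose dual (X : T) : T := let: exist M P := X in
  exist _ (dual_matroid P.2) (conj (@dual_simple M P.2)
    (modular_step P.1 P.2 (dual_adjoint P.1 P.2))).
pose E k := iter k dual (exist _ (A n) (conj sA mA) : T).
exists (fun k => if k <= n then A k else sval (E (k - n))); split=> [k ->//|k].
have [lt|le] := ltnP k n; first by rewrite (ltnW lt); exact: st.
have Ek : (if k <= n then A k else sval (E (k - n))) = sval (E (k - n)).
  by case: leqP => // kn; have -> : k = n; [apply/eqP; rewrite eqn_leq kn le | rewrite subnn].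
rewrite Ek subSn //=; case: (E (k - n)) => X [sX mX] /=; exact: (@dual_adjoint X sX mX).
Qed.

Section Assembly.
Variables (r i : nat) (B : nat -> matroid).
Hypotheses (wB : well_connected r (B i)) (mB : modular (B i))
  (stB : forall k, i <= k -> adjoint_step (B k) (B k.+1)).

Lemma continuation_modular k : i <= k -> well_connected r (B k) /\ modular (B k).
Proof.
move=> ik; apply: (@adjoint_seq_ind (fun X => well_connected r X /\ modular X) B i k) => //.
- move=> X Y [wX mX] XY; split; first exact: well_connected_step wX XY.
  by have [sX _ _] := wX; exact: modular_step XY.
- by move=> l /andP[il _]; exact: stB.
- by rewrite ik leqnn.
Qed.

Lemma continuation_period l k : i <= l -> isomorphic (B (l + 2 * k)) (B l).
Proof.
move=> il; elim: k => [|k IHk]; first by rewrite addn0; exact: isomorphic_refl.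
apply: isomorphic_trans IHk; apply: isomorphic_sym.
have ik : i <= l + 2 * k by apply: leq_trans il (leq_addr _ _).
have [[s _ _] m] := continuation_modular ik.
have -> : l + 2 * k.+1 = (l + 2 * k).+2 by clear; lia.
by apply: (double_adjoint s m (stB ik)); apply: stB; exact: leqW.
Qed.

Lemma continuation_plane k : r = 3 -> i <= k -> is_projective_plane (B k).
Proof.
move=> r_eq /continuation_modular[[s rk c] m]; split; last by rewrite rk.
exact: modular_projective.
Qed.

(** Coordinates of [B i] are carried along the sequence with F and m fixed; comparing ranks
    identifies m with r. *)
Lemma continuation_PG : 4 <= r ->
  exists F : finFieldType, forall k, i <= k -> isomorphic (B k) (PG F r).
Proof.
move=> r4; have [s rk c] := wB.
have [|H hH _] := @exists_hyperplane (B i) set0; first by rewrite rank_set0 rk; apply: leq_trans r4.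
have [|F [m [co hco]]] := @projective_coordinates (B i) H s mB c _ hH; first by rewrite rk.
exists F => k ik.
pose Q X := [/\ simple X, modular X & exists c' : X -> 'rV[F]_m, homogeneous_coordinates c'].
have [sk mk [c' hc']] : Q (B k).
  apply: (@adjoint_seq_ind Q B i k); last by rewrite ik leqnn.
  - move=> X Y [sX mX [cX hX]] XY; have [h hY] := adjoint_labelling XY.
    have [_ sY] := XY; split=> //; first exact: modular_step XY.
    exact: dual_coordinates hY hX.
  - by split=> //; exists co.
  - by move=> l /andP[il _]; exact: stB.
have iso := coordinates_PG sk mk hc'.
by have [[_ <- _] _] := continuation_modular ik; rewrite (isomorphic_rank iso) rank_PG.
Qed.

End Assembly.

Theorem theorem5p4 (M : matroid) (r : nat) (M_simple : simple M)
    (M_connected : connected M) (M_rank : rank M = r) (r_ge3 : 3 <= r)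
    (n : nat) (A : nat -> matroid) (A_adj : adjoint_sequence M n A)
    (i j : nat) (lt_ij : i < j) (le_jn : j <= n)
    (A_ij : isomorphic (A i) (A j)) :
  (r = 3 ->
     (exists B, infinite_continuation n A B) /\
     (forall B, infinite_continuation n A B ->
        (odd (j - i) ->
           exists2 P, is_projective_plane P &
             forall k, i <= k -> isomorphic (B k) P) /\
        (~~ odd (j - i) ->
           (exists2 P, is_projective_plane P &
              forall k, isomorphic (B (i + 2 * k)) P) /\
           (exists2 Q, is_projective_plane Q &
              forall k, isomorphic (B (i + 2 * k + 1)) Q)))) /\
  (4 <= r ->
     (exists B, infinite_continuation n A B) /\
     (forall B, infinite_continuation n A B ->
        exists F : finFieldType,
          forall k, i <= k -> isomorphic (B k) (PG F r))).
Proof.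
have [A0 st] := A_adj; have le_in : i < n := leq_trans lt_ij le_jn.
have wA k : k <= n -> well_connected r (A k).
  move=> kn; apply: (@adjoint_seq_ind (well_connected r) A 0 n) => //.
  - by move=> X Y; exact: well_connected_step.
  - by rewrite A0; split=> //; exact: connected_separator_free.
have mono k : k < n -> #|A k| <= #|A k.+1|.
  move=> kn; have [s rk _] := wA k (ltnW kn).
  by rewrite (adjoint_card (st k kn)); apply: card_hyperplanes; rewrite // rk ltnW.
have monoj k : i.+1 + k <= n -> #|A i.+1| <= #|A (i.+1 + k)|.
  elim: k => [|k IHk]; first by rewrite addn0.
  rewrite addnS => lt; apply: leq_trans (IHk (ltnW lt)) _; exact: mono.
(* Monotonicity from i + 1 to j, together with the isomorphism of [A i] and [A j], shows that the
   step from i to i + 1 does not increase the number of points. *)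
have mi : modular (A i).
  apply: (modular_of_card r_ge3 (wA i (ltnW le_in)) (st i le_in)).
  rewrite (isomorphic_card A_ij); have := monoj (j - i.+1); rewrite subnKC //; exact.
have mA k : i <= k <= n -> modular (A k).
  move=> ikn; suff [] : well_connected r (A k) /\ modular (A k) by [].
  apply: (@adjoint_seq_ind (fun X => well_connected r X /\ modular X) A i n) => //.
  - move=> X Y [wX mX] XY; split; first exact: well_connected_step wX XY.
    by have [sX _ _] := wX; exact: modular_step XY.
  - by split=> //; apply: wA; exact: ltnW.
  - by move=> l /andP[_]; exact: st.
have [sn _ _] := wA n (leqnn n).
have exB : exists B, infinite_continuation n A B.
  by apply: modular_continuation => //; apply: mA; rewrite leqnn ltnW.
have contB B : infinite_continuation n A B -> [/\ well_connected r (B i), modular (B i),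
    forall k, i <= k -> adjoint_step (B k) (B k.+1) & isomorphic (B i) (B j)].
  by case=> BA stB; rewrite !BA ?(ltnW le_in) //; split=> //; exact/wA/ltnW.
split=> [r_eq|r4]; split=> // B /contB[wB mB stB ij]; last exact: continuation_PG wB mB stB r4.
have per l k := continuation_period wB mB stB (l := l) k.
have plane k := continuation_plane wB mB stB (k := k) r_eq.
split=> [oji|_]; last first.
  split; first by exists (B i); [exact: plane | move=> k; exact: per].
  exists (B i.+1); first by apply: plane; exact: leqnSn.
  by move=> k; rewrite addnAC addn1; apply: per; exact: leqnSn.
exists (B i); first exact: plane.
(* For odd j - i, the index j has the parity of i + 1, so the period 2 merges the two classes. *)
have iS : isomorphic (B i.+1) (B i).
  apply: isomorphic_trans (isomorphic_sym ij).
  have -> : j = i.+1 + 2 * (j - i)./2.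
    by have := odd_double_half (j - i); rewrite oji -mul2n; move: lt_ij; clear; lia.
  apply: isomorphic_sym; apply: per; exact: leqnSn.
move=> k ik; rewrite -(subnKC ik) -(odd_double_half (k - i)) -mul2n.
case: (odd _); last by rewrite add0n; exact: per.
by rewrite addnA addn1; apply: isomorphic_trans iS; apply: per; exact: leqnSn.
Qed.
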